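(* Let $\Omega\subset\mathbb{R}^2$ be either $\mathbb{R}^2$, or an exterior domain with smooth boundary, or a perturbed half-space with smooth boundary, and let $T>0$. Let $v_0=0$, and let $v$ be a smooth bounded solution (with pressure $p$) of \[ \begin{cases} v_t-\Delta v+(v\cdot\nabla)v+\nabla p=0, & (x,t)\in\Omega\times(0,T),\\ \operatorname{div}v=0, & (x,t)\in\Omega\times(0,T),\\ v(x,t)=0, & x\in\partial\Omega,\\ v(x,0)=v_0(x), & x\in\Omega. \end{cases} \] Let $\omega=\partial_1v^2-\partial_2v^1$. If, for some $t\in(0,T)$, \[ \varepsilon_\omega(t):=\lim_{R\to\infty}\left(\sup_{(x,\tau)\in(\Omega\cap\{|x|\ge R\})\times(0,t)}|x|^{1/2}|\omega(x,\tau)|\right)=0 \] and if, for the same $t$, \[ \frac{\partial\omega}{\partial\nu}\,\omega\in L^1(\partial\Omega\times(0,t))\quad\text{and}\quad\int_0^t\int_{\partial\Omega}\frac{\partial\omega}{\partial\nu}(x,\tau)\,\omega(x,\tau)\,dS\,d\tau\le0, \] then $v\equiv0$ on $\Omega\times[0,t]$.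
   Context: $v=(v^1,v^2)$ is the velocity field, $v_0=(v_0^1,v_0^2)$ the initial velocity, and $p$ the scalar pressure; smooth means $v\in C^\infty(\bar\Omega\times[0,T))$. $\frac{\partial}{\partial\nu}$ denotes the normal derivative on $\partial\Omega$, with $\nu$ the unit outward normal. An exterior domain is the complement of a compact set; a perturbed half-space is a domain that coincides with the half-plane $\mathbb{R}^2_+$ outside some ball. When $\Omega=\mathbb{R}^2$ there is no boundary, and the conditions on $\partial\Omega$ are void.
   Formalization: For Ω=ℝ² the pressure is additionally assumed to satisfy p(x,s)=o(|x|) as |x|→∞ for each s∈(0,T); without it the claim fails, e.g. v=(t,0), p=-x₁ has v₀=0 and ω=0 but v≢0. *)

(* Defs.v *)
From HB Require Import structures.
From mathcomp Require Import all_boot all_order all_algebra.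
From mathcomp Require Import all_classical all_reals all_analysis.

Set Implicit Arguments.
Unset Strict Implicit.
Unset Printing Implicit Defensive.

Import Order.TTheory GRing.Theory Num.Theory.
Import numFieldNormedType.Exports.

Local Open Scope classical_set_scope.
Local Open Scope ring_scope.

Notation plane R := (R * R)%type.
Notation spacetime R := (plane R * R)%type.

(* [plane R] with its Borel sigma-algebra *)
Notation borel_plane R := (measurableTypeR R * measurableTypeR R)%type.

(* The library norm on a product is the max norm. *)
Definition enorm (R : realType) (x : plane R) : R :=
  Num.sqrt (x.1 ^+ 2 + x.2 ^+ 2).

Section smoothness.
Context (R : realType) (V W : normedModType R).

Definition iterD (s : seq V) (f : V -> W) : V -> W :=
  foldr (fun (w : V) (g : V -> W) => 'D_w g) f s.

Definition smooth_on (U : set V) (f : V -> W) : Prop :=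
  forall (s : seq V) (z : V), U z ->
    (forall w : V, derivable (iterD s f) z w) /\ {for z, continuous (iterD s f)}.

(* C^oo up to the part of the boundary of U contained in Q, U <= Q <= closure U:
   f is continuous on Q and all its derivatives in U extend continuously to Q *)
Definition smooth_up_to (U Q : set V) (f : V -> W) : Prop :=
  [/\ smooth_on U f,
      {within Q, continuous f}
    & forall s : seq V, exists g : V -> W,
        {within Q, continuous g} /\ {in U, g =1 iterD s f}].

End smoothness.

Section domains.
Context (R : realType).
Implicit Types (Omega : set (plane R)) (x : plane R).

Definition frontier Omega : set (plane R) := closure Omega `\` interior Omega.

Definition domain Omega : Prop := [/\ Omega !=set0, open Omega & connected Omega].

Definition gradient (rho : plane R -> R) x : plane R :=
  ('D_((1, 0) : plane R) rho x, 'D_((0, 1) : plane R) rho x).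

Definition local_defining_function Omega x (rho : plane R -> R) : Prop :=
  exists U : set (plane R),
    [/\ open_nbhs x U, smooth_on U rho,
        forall y, U y -> (Omega y <-> rho y < 0)
      & gradient rho x <> 0].

Definition smooth_boundary Omega : Prop :=
  forall x, frontier Omega x ->
    exists rho : plane R -> R, local_defining_function Omega x rho.

Definition exterior_domain Omega : Prop := domain Omega /\ compact (~` Omega).

Definition perturbed_half_space Omega : Prop :=
  domain Omega /\
  exists (c : plane R) (r : R), 0 < r /\
    forall x, r < enorm (x - c) -> (Omega x <-> 0 < x.2).

Definition outward_unit_normal Omega (nu : plane R -> plane R) : Prop :=
  forall x, frontier Omega x ->
    exists rho : plane R -> R, local_defining_function Omega x rho /\
      nu x = (enorm (gradient rho x))^-1 *: gradient rho x.

(* The line element dS: the Borel measure carried by the boundary that gives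
   each simple regular smooth arc of the boundary its length.  Such arcs
   determine the measure; it is the zero measure when the boundary is empty. *)
Definition surface_measure Omega
    (sigma : {measure set (borel_plane R) -> \bar R}) : Prop :=
  sigma (~` frontier Omega) = 0%E /\
  forall (gamma : R -> plane R) (a b : R) (U : set R),
    a <= b -> open U -> `[a, b] `<=` U -> smooth_on U gamma ->
    {in `[a, b]%classic &, injective gamma} ->
    (forall s, `[a, b]%classic s -> 'D_1 gamma s <> 0) ->
    gamma @` `[a, b] `<=` frontier Omega ->
    sigma (gamma @` `[a, b]) =
      (\int[@lebesgue_measure R]_(s in `[a, b]) (enorm ('D_1 gamma s))%:E)%E.

End domains.

Section navier_stokes.
Context (R : realType).
Implicit Types (Omega : set (plane R)) (v : spacetime R -> plane R)
  (p f : spacetime R -> R) (T t : R) (z : spacetime R).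

Definition e1 : spacetime R := ((1, 0), 0).
Definition e2 : spacetime R := ((0, 1), 0).
Definition et : spacetime R := ((0, 0), 1).

Definition omega v z : R := ('D_e1 v z).2 - ('D_e2 v z).1.

(* v is smooth and bounded; of p only the existence of the space derivatives
   is required, the equation then gives their smoothness *)
Record smooth_bounded_solution Omega T (v0 : plane R -> plane R) v p : Prop := {
  sol_smooth : smooth_up_to (Omega `*` `]0, T[) (closure Omega `*` `[0, T[) v;
  sol_bounded : exists M : R,
    forall z, (Omega `*` `]0, T[) z -> enorm (v z) <= M;
  sol_pressure : forall z, (Omega `*` `]0, T[) z ->
    derivable p z e1 /\ derivable p z e2;
  sol_momentum : forall z, (Omega `*` `]0, T[) z ->
    'D_et v z - ('D_e1 ('D_e1 v) z + 'D_e2 ('D_e2 v) z)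
      + ((v z).1 *: 'D_e1 v z + (v z).2 *: 'D_e2 v z)
      + ('D_e1 p z, 'D_e2 p z) = 0;
  sol_divergence : forall z, (Omega `*` `]0, T[) z ->
    ('D_e1 v z).1 + ('D_e2 v z).2 = 0;
  sol_no_slip : forall x s, frontier Omega x -> 0 < s < T -> v (x, s) = 0;
  sol_initial : forall x, Omega x -> v (x, 0) = v0 x }.

(* On the whole plane the equations determine the pressure gradient only up to
   a function of time: v(x,t) = g(t), p(x,t) = - g'(t).x is a smooth bounded
   solution with vanishing vorticity for every smooth g.  The pressure usually
   associated with a bounded velocity is the one given by Riesz transforms,
   which rules these flows out; its growth o(|x|) is all that is required. *)
Definition admissible_pressure Omega T p : Prop :=
  Omega = setT -> forall s, 0 < s < T ->
    forall e, 0 < e -> exists r : R, forall x : plane R,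
      r <= enorm x -> `|p (x, s)| <= e * enorm x.

Definition vorticity_tail Omega v t (r : R) : \bar R :=
  ereal_sup [set (Num.sqrt (enorm z.1) * `|omega v z|)%:E |
    z in (Omega `&` [set x | r <= enorm x]) `*` `]0, t[].

(* boundary value of f, from inside Omega at fixed time *)
Definition trace Omega f z : R :=
  lim (f (y, z.2) @[y --> within Omega (nbhs z.1)]).

Definition normal_derivative Omega (nu : plane R -> plane R) f z : R :=
  trace Omega ('D_e1 f) z * (nu z.1).1 + trace Omega ('D_e2 f) z * (nu z.1).2.

Definition vorticity_flux Omega (nu : plane R -> plane R) v z : R :=
  normal_derivative Omega nu (omega v) z * trace Omega (omega v) z.

End navier_stokes.

(* Main.v *)
Require Import Defs.
From HB Require Import structures.
From mathcomp Require Import all_boot all_order all_algebra.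
From mathcomp Require Import all_classical all_reals all_analysis.
From mathcomp Require Import ring lra measurable_realfun.

Set Implicit Arguments.
Unset Strict Implicit.
Unset Printing Implicit Defensive.

Import Order.TTheory GRing.Theory Num.Theory.
Import numFieldNormedType.Exports.

Local Open Scope classical_set_scope.
Local Open Scope ring_scope.

(** The vorticity [w] of a plane flow satisfies the scalar equation
    [w_t + v . grad w = Laplacian w] (lemma [vorticity_equation]), without a stretching term.
    Multiplied by [psi^2 w], with a cut-off [psi] of radius [r], and integrated over the domain
    and the times before [t], it gives an energy balance.  The enstrophy at the initial time
    is 0 ([vort_initial]: the velocity is 0 there, and so are its space derivatives), the
    drift has no boundary term because of the no-slip condition, and the boundary term of the
    Laplacian is the vorticity flux ([energy_slice]).  The terms in which [psi] is
    differentiated are supported where [|x|] is between [r] and [2 r], a set of area of order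
    [r^2], and are of the order of [w^2 / r]; so the decay of [|x|^(1/2) w] makes them tend
    to 0 ([energy_lower]).  Since the flux has a nonpositive integral, the limit leaves
    [grad w = 0] ([vorticity_gradient0]).

    As [div v = 0], the Laplacian of [v] is the rotated gradient of [w], so that each
    component of [v] is harmonic in space ([velocity_harmonic]), bounded, and 0 on the
    boundary.  The plane has cut-offs of arbitrarily small Dirichlet integral, the
    logarithmic ones; with Caccioppoli's inequality they show that such a function has
    gradient 0 ([liouville]).  Hence [v] depends on time only.  If there is a boundary, this
    common value is 0.  Otherwise the domain is the whole plane, the momentum equation says
    that [- v_t] is the pressure gradient, which is then constant in space, and the growth
    condition on the pressure forces it to vanish ([time_derivative0]); the velocity keeps
    its initial value 0.

    All integrations by parts rest on the divergence theorem for fields of bounded support in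
    a domain with smooth boundary ([divergence_theorem]), for the surface measure determined
    by the length of boundary arcs.  The implicit function theorem makes the boundary locally
    a graph over a coordinate axis, up to rotations by a right angle; below a graph the
    theorem is Fubini's theorem and the fundamental theorem of calculus ([graph_green]); on a
    boundary arc the surface measure is the arc length ([arc_integral]); and a partition by
    cut-offs joins the local statements. *)

(** * Functions continuous on a subset *)

(** Pointwise, through the filter [within A], rather than through the subspace topology, so
   that the limit rules for [+%R] and [*%R] apply directly. *)
Definition cont_on {T U : topologicalType} (A : set T) (f : T -> U) : Prop :=
  forall x, A x -> f y @[y --> within A (nbhs x)] --> f x.

Section cont_on_gen.
Context {T U V : topologicalType}.
Implicit Types (A B : set T) (f g : T -> U).

Lemma cont_onP A f : cont_on A f <-> {within A, continuous f}.
Proof. by split=> /subspace_continuousP. Qed.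

Lemma cont_onS A B f : A `<=` B -> cont_on B f -> cont_on A f.
Proof.
move=> AB cf x Ax; apply: cvg_trans (cf x (AB _ Ax)).
apply: cvg_app; exact: within_subset.
Qed.

Lemma eq_cont_on A f g : (forall x, A x -> f x = g x) ->
  cont_on A f -> cont_on A g.
Proof.
move=> fg cf x Ax; rewrite -(fg _ Ax).
apply: cvg_trans (cf x Ax); apply: near_eq_cvg.
by near=> y; apply: fg; near: y; exact: withinT.
Unshelve. all: by end_near. Qed.

Lemma continuous_cont_on A f : continuous f -> cont_on A f.
Proof. by move=> cf x _; apply: cvg_within_filter; exact: cf. Qed.

Lemma cont_on_cst A (c : U) : cont_on A (fun=> c).
Proof. by move=> x _; exact: cvg_cst. Qed.

Lemma cont_on_comp A (B : set U) f (g : U -> V) :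
  (forall x, A x -> B (f x)) -> cont_on A f -> cont_on B g ->
  cont_on A (g \o f).
Proof.
move=> AB cf cg x Ax; apply: cvg_trans (cg _ (AB _ Ax)).
have Pf := cf x Ax.
move=> W /=; rewrite /within /= nbhs_simpl /= => h.
rewrite /nbhs /= in h.
have := Pf _ h; rewrite !nbhs_simpl/= /within /= => H.
apply: filterS H => y H Ay; apply: (H Ay); exact: AB.
Qed.

Lemma cont_on_at A f x : cont_on A f -> nbhs x A -> {for x, continuous f}.
Proof.
move=> cf nA; have Ax := nbhs_singleton nA.
have := cf x Ax; apply: cvg_trans.
move=> W; rewrite /within/= !nbhs_simpl/= => h.
by apply: filterS2 h nA => y; apply.
Qed.

(** The form of continuity on [A] from which measurability on [A] follows. *)
Lemma cont_on_open A f (O : set U) : cont_on A f -> open O ->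
  exists W, open W /\ A `&` f @^-1` O = A `&` W.
Proof.
move=> cf oO; exists (interior (~` A `|` f @^-1` O)); split; first exact: open_interior.
apply/seteqP; split=> x [Ax h]; split=> //; last first.
  by have := interior_subset h; case.
have : nbhs (f x) O by exact: open_nbhs_nbhs.
move=> /(cf x Ax) H.
have {}H : \forall y \near x, A y -> O (f y) by exact: H.
change (\forall y \near x, (~` A `|` f @^-1` O) y).
apply: filterS H => y H.
by have [Ay|nAy] := pselect (A y); [right; exact: H|left].
Qed.

End cont_on_gen.

Section cont_on_real.
Context {R : realType} {T : topologicalType}.
Implicit Types (A : set T) (f g : T -> R).

Lemma cont_onD A f g : cont_on A f -> cont_on A g ->
  cont_on A (fun x => f x + g x).
Proof. by move=> cf cg x Ax; apply: cvgD; [exact: cf|exact: cg]. Qed.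

Lemma cont_onM A f g : cont_on A f -> cont_on A g ->
  cont_on A (fun x => f x * g x).
Proof. by move=> cf cg x Ax; apply: cvgM; [exact: cf|exact: cg]. Qed.

Lemma cont_on_sqr A f : cont_on A f -> cont_on A (fun x => f x ^+ 2).
Proof.
move=> cf; apply: (eq_cont_on (f := fun x => f x * f x)); last exact: cont_onM.
by move=> x _; rewrite expr2.
Qed.

Lemma cont_onN A f : cont_on A f -> cont_on A (fun x => - f x).
Proof. by move=> cf x Ax; apply: cvgN; exact: cf. Qed.

Lemma cont_onB A f g : cont_on A f -> cont_on A g ->
  cont_on A (fun x => f x - g x).
Proof. by move=> cf cg x Ax; apply: cvgB; [exact: cf|exact: cg]. Qed.

End cont_on_real.

(** * Borel sets of the plane and of space-time *)

Section basis.

(** A countable basis of measurable neighbourhoods puts the open sets into the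
   product sigma-algebra; products of bases are bases of products. *)
Definition measurable_basis {T : topologicalType} (m : set (set T)) : Prop :=
  exists B : nat -> set T, (forall n, m (B n)) /\
    forall x U, nbhs x U -> exists n, B n x /\ B n `<=` U.

Lemma measurable_basis_prod {T1 T2 : topologicalType} m1 m2 (m : set (set (T1 * T2))) :
  (forall A B, m1 A -> m2 B -> m (A `*` B)) ->
  measurable_basis m1 -> measurable_basis m2 -> measurable_basis m.
Proof.
move=> mm [B1 [mB1 b1]] [B2 [mB2 b2]].
exists (fun n => match unpickle n : option (nat * nat) with
   Some ij => B1 ij.1 `*` B2 ij.2 | None => B1 0%N `*` B2 0%N end); split.
  by move=> n; case: unpickle => [ij|]; exact: mm.
move=> [x y] U [[P Q] /= [/b1[i [B1x B1P]] /b2[j [B2y B2Q]]] PQU].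
by exists (pickle (i, j)); rewrite pickleK; split=> // -[a b] /= [? ?];
  apply: PQU; split=> /=; [exact: B1P|exact: B2Q].
Qed.

Lemma measurable_basis_open {T : topologicalType} (m : set (set T)) (A : set T) :
  m set0 -> (forall F : nat -> set T, (forall n, m (F n)) -> m (\bigcup_n F n)) ->
  measurable_basis m -> open A -> m A.
Proof.
move=> m0 mU [B [mB bB]] oA.
have -> : A = \bigcup_n (if `[< B n `<=` A >] then B n else set0).
  apply/seteqP; split=> [x Ax|x [n _]].
    have [n [Bx BA]] := bB x A (open_nbhs_nbhs (conj oA Ax)).
    by exists n => //; rewrite asboolT.
  by case: asboolP => // BA /BA.
by apply: mU => n; case: asboolP.
Qed.

Lemma measurable_basis_R (R : realType) :
  measurable_basis (@measurable _ (measurableTypeR R) : set (set R)).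
Proof.
exists (fun n => match unpickle n : option (rat * rat) with
  Some cr => ball (ratr cr.1 : R) (ratr cr.2) | None => set0 end); split.
  move=> n; case: unpickle => [cr|]; last exact: measurable0.
  by rewrite ball_itv; exact: measurable_itv.
move=> x U; rewrite nbhsE => -[V [oV Vx] VU].
have [] := @open_subball_rat R V x oV; first exact/mem_set.
move=> c [r] /= [xB BV]; exists (pickle (c, r)); rewrite pickleK; split.
  exact/set_mem.
exact: subset_trans VU.
Qed.

End basis.

Section borel.
Context (R : realType).

Lemma measurable_basis_plane :
  measurable_basis (@measurable _ (borel_plane R) : set (set (plane R))).
Proof.
apply: measurable_basis_prod (measurable_basis_R R) (measurable_basis_R R).
by move=> A B mA mB; exact: measurableX.
Qed.

Lemma open_measurable_plane (A : set (plane R)) : open A ->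
  measurable (A : set (borel_plane R)).
Proof.
apply: measurable_basis_open measurable_basis_plane.
  exact: measurable0.
by move=> F mF; exact: bigcup_measurable.
Qed.

Lemma closed_measurable_plane (A : set (plane R)) : closed A ->
  measurable (A : set (borel_plane R)).
Proof.
move=> cA; rewrite -[A]setCK; apply: measurableC; apply: open_measurable_plane.
by rewrite openC.
Qed.

Lemma open_measurable_spacetime (A : set (spacetime R)) : open A ->
  measurable (A : set (borel_plane R * measurableTypeR R)).
Proof.
apply: (@measurable_basis_open _ (@measurable _ (borel_plane R * measurableTypeR R)%type)).
- exact: measurable0.
- by move=> F mF; exact: bigcup_measurable.
apply: measurable_basis_prod measurable_basis_plane (measurable_basis_R R).
by move=> A0 B mA mB; exact: measurableX.
Qed.

Lemma cont_on_measurable (A : set (plane R)) (f : plane R -> R) :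
  measurable (A : set (borel_plane R)) -> cont_on A f ->
  measurable_fun (A : set (borel_plane R)) f.
Proof.
move=> mA cf; apply: (measurability _ (RGenOpens.measurableE R)).
move=> _ [_ [a [b ->] <-]].
have [W [oW ->]] := cont_on_open cf (@interval_open _ (BRight a) (BLeft b) isT isT).
by apply: measurableI => //; exact: open_measurable_plane.
Qed.

Lemma cont_on_measurable_spacetime (A : set (spacetime R)) (f : spacetime R -> R) :
  measurable (A : set (borel_plane R * measurableTypeR R)) -> cont_on A f ->
  measurable_fun (A : set (borel_plane R * measurableTypeR R)) f.
Proof.
move=> mA cf; apply: (measurability _ (RGenOpens.measurableE R)).
move=> _ [_ [a [b ->] <-]].
have [W [oW ->]] := cont_on_open cf (@interval_open _ (BRight a) (BLeft b) isT isT).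
by apply: measurableI => //; exact: open_measurable_spacetime.
Qed.

End borel.

(** * Directional derivatives *)

Section directional.
Context {R : realType} {V : normedModType R}.
Implicit Types (z u w : V).

Lemma is_derive_line {W : normedModType R} (f : V -> W) z w (a : R) d :
  is_derive (z + a *: w) w f d <-> is_derive a (1 : R) (fun h => f (z + h *: w)) d.
Proof.
have E : (fun h : R => h^-1 *: ((fun h => f (z + h *: w)) (h *: (1 : R) + a)
      - f (z + a *: w))) =
   (fun h => h^-1 *: (f (h *: w + (z + a *: w)) - f (z + a *: w))).
  apply/funext => h; congr (_ *: (f _ - _)).
  by rewrite [h *: 1]mulr1 scalerDl addrCA.
split=> -[D v]; split.
- by move: D; rewrite /derivable; rewrite -E.
- by move: v; rewrite /derive -E.
- by move: D; rewrite /derivable; rewrite -E.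
- by move: v; rewrite /derive -E.
Qed.

Lemma is_derive_shiftv {W : normedModType R} (f : V -> W) z w u d :
  is_derive (z + w) u f d -> is_derive z u (fun y => f (y + w)) d.
Proof.
have E : (fun h : R => h^-1 *: (f (h *: u + z + w) - f (z + w))) =
   (fun h : R => h^-1 *: (f (h *: u + (z + w)) - f (z + w))).
  by apply/funext => h; rewrite addrA.
by move=> [D v]; split; [move: D|move: v]; rewrite /derivable /derive E.
Qed.

Lemma is_derive_fst {W1 W2 : normedModType R} (f : V -> W1 * W2) z u d :
  is_derive z u f d -> is_derive z u (fun y => (f y).1) d.1.
Proof.
move=> [D v]; rewrite -v; apply: DeriveDef.
  by apply/cvg_ex; exists ('D_u f z).1; exact: (cvg_comp _ _ D (cvg_fst)).
by apply/cvg_lim => //; exact: (cvg_comp _ _ D (cvg_fst)).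
Qed.

Lemma is_derive_snd {W1 W2 : normedModType R} (f : V -> W1 * W2) z u d :
  is_derive z u f d -> is_derive z u (fun y => (f y).2) d.2.
Proof.
move=> [D v]; rewrite -v; apply: DeriveDef.
  by apply/cvg_ex; exists ('D_u f z).2; exact: (cvg_comp _ _ D (cvg_snd)).
by apply/cvg_lim => //; exact: (cvg_comp _ _ D (cvg_snd)).
Qed.

Lemma is_derive_pair {W1 W2 : normedModType R} (f : V -> W1) (g : V -> W2) z u d e :
  is_derive z u f d -> is_derive z u g e ->
  is_derive z u (fun y => (f y, g y)) (d, e).
Proof.
move=> [Df <-] [Dg <-].
have H : (fun h : R => h^-1 *: ((fun y => (f y, g y)) (h *: u + z) - (f z, g z)))
   @ 0^' --> ('D_u f z, 'D_u g z).
  by apply: (cvg_pair Df Dg).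
apply: DeriveDef; first by apply/cvg_ex; exists ('D_u f z, 'D_u g z).
by apply/cvg_lim.
Qed.

Lemma mvt_line (f df : V -> R) z w (a b : R) : a <= b ->
  (forall h, a <= h <= b -> is_derive (z + h *: w) w f (df (z + h *: w))) ->
  exists2 c, a <= c <= b &
    f (z + b *: w) - f (z + a *: w) = df (z + c *: w) * (b - a).
Proof.
move=> ab H.
have D h : a <= h <= b -> is_derive h 1 (fun h => f (z + h *: w)) (df (z + h *: w)).
  by move=> ?; apply/is_derive_line; exact: H.
have [||c cab E] := @MVT_segment R (fun h => f (z + h *: w))
   (fun h => df (z + h *: w)) a b ab.
- by move=> x; rewrite in_itv/= => /andP[/ltW ? /ltW ?]; apply: D; apply/andP.
- apply: derivable_within_continuous => x; rewrite in_itv/= => xab.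
  by have [] := D x xab.
by exists c => //; move: cab; rewrite in_itv.
Qed.

(** Clairaut's theorem: the mean value theorem, applied twice in either order, writes the
   second difference over a small parallelogram as a value of either mixed derivative at a
   nearby point. *)
Lemma clairaut (f g k g' k' : V -> R) u w z :
  (\forall y \near z, is_derive y u f (g y)) ->
  (\forall y \near z, is_derive y w f (k y)) ->
  (\forall y \near z, is_derive y w g (g' y)) ->
  (\forall y \near z, is_derive y u k (k' y)) ->
  {for z, continuous g'} -> {for z, continuous k'} -> g' z = k' z.
Proof.
move=> fg fk gg kk cg ck; apply/eqP; apply: contraT => gk.
pose eta := `|g' z - k' z| / 2.
have eta0 : 0 < eta by rewrite divr_gt0// normr_gt0 subr_eq0.
have ng : \forall y \near z, `|g' z - g' y| < eta by exact: cvgr_dist_lt cg _ eta0.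
have nk : \forall y \near z, `|k' z - k' y| < eta by exact: cvgr_dist_lt ck _ eta0.
have : \forall y \near z, [/\ is_derive y u f (g y), is_derive y w f (k y),
  is_derive y w g (g' y) & is_derive y u k (k' y)] /\
  `|g' z - g' y| < eta /\ `|k' z - k' y| < eta.
  by near do (split; [split|split]).
move=> /nbhs_normP[e /= e0 He].
pose h := e / (2 * (1 + `|u| + `|w|)).
have uw0 : 0 < 1 + `|u| + `|w| by rewrite -addrA ltr_pwDl// addr_ge0.
have h0 : 0 < h by rewrite divr_gt0// mulr_gt0.
have hin a b : 0 <= a <= h -> 0 <= b <= h -> ball_ Num.norm z e (z + a *: u + b *: w).
  move=> /andP[a0 ah] /andP[b0 bh]; rewrite /ball_/= -addrA opprD addNKr normrN.
  rewrite (le_lt_trans (ler_normD _ _))// !normrZ !ger0_norm//.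
  apply: (@le_lt_trans _ _ (h * (1 + `|u| + `|w|))).
    rewrite !mulrDr mulr1 -addrA; apply: ler_wpDl; first exact: ltW.
    by apply: lerD; apply: ler_wpM2r.
  rewrite /h invfM mulrA -mulrA mulVf ?gt_eqF// mulr1.
  by rewrite ltr_pdivrMr// ltr_pMr// ltr1n.
have hh0 : 0 <= (0 : R) <= h by apply/andP; split=> //; exact: ltW.
have hhh : 0 <= h <= h by apply/andP; split=> //; exact: ltW.
have [|c ch E1] := @mvt_line (fun y => f (y + h *: w) - f y)
   (fun y => g (y + h *: w) - g y) z u 0 h (ltW h0).
  move=> t ht; apply: is_deriveB.
    by apply: is_derive_shiftv; have [[]] := He _ (hin t h ht hhh).
  by have := hin t 0 ht hh0; rewrite scale0r addr0 => /He[[]].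
have [|d dh E2] := @mvt_line g g' (z + c *: u) w 0 h (ltW h0).
  by move=> t ht; have [[]] := He _ (hin c t ch ht).
have [|c1 ch1 E3] := @mvt_line (fun y => f (y + h *: u) - f y)
   (fun y => k (y + h *: u) - k y) z w 0 h (ltW h0).
  move=> t ht; apply: is_deriveB.
    by apply: is_derive_shiftv; rewrite addrAC; have [[]] := He _ (hin h t hhh ht).
  by have := hin 0 t hh0 ht; rewrite scale0r addr0 => /He[[]].
have [|d1 dh1 E4] := @mvt_line k k' (z + c1 *: w) u 0 h (ltW h0).
  by move=> t ht; rewrite addrAC; have [[]] := He _ (hin t c1 ht ch1).
have E : g' (z + c *: u + d *: w) = k' (z + d1 *: u + c1 *: w).
  move: E1 E2 E3 E4; rewrite !scale0r !addr0 !subr0 => E1 E2 E3 E4.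
  have hn : h != 0 by rewrite gt_eqF.
  apply: (mulIf hn); apply: (mulIf hn).
  rewrite -E2 -[in RHS](addrAC z) -E4 -E1 -E3.
  by rewrite (addrAC z (h *: w)); ring.
have [_ [d1g _]] := He _ (hin c d ch dh).
have [_ [_ d1k]] := He _ (hin d1 c1 dh1 ch1).
exfalso; have : `|g' z - k' z| < eta + eta.
  rewrite [X in `|X|](_ : _ = (g' z - g' (z + c *: u + d *: w)) -
     (k' z - k' (z + d1 *: u + c1 *: w))); last by rewrite E; ring.
  by rewrite (le_lt_trans (ler_normB _ _))// ltrD.
by rewrite /eta -splitr ltxx.
Unshelve. all: by end_near. Qed.

End directional.

(** * The chain rule for functions of two variables *)

Notation ux R := ((1, 0) : plane R).
Notation uy R := ((0, 1) : plane R).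

Section coordinates.
Context {R : realType}.
Implicit Types (x : plane R) (a b : R).

Lemma plane_stepx x a : x + a *: ux R = (x.1 + a, x.2).
Proof.
by case: x => x1 x2; rewrite -[LHS]/(x1 + a * 1, x2 + a * 0) mulr1 mulr0 addr0.
Qed.

Lemma plane_stepy x a : x + a *: uy R = (x.1, x.2 + a).
Proof.
by case: x => x1 x2; rewrite -[LHS]/(x1 + a * 0, x2 + a * 1) mulr1 mulr0 addr0.
Qed.

Lemma plane_normE x : `|x| = Num.max `|x.1| `|x.2|.
Proof. by []. Qed.

End coordinates.

Section chain.
Context {R : realType}.
Implicit Types (x : plane R) (f : plane R -> R).

Let lin2 (p q : R) (k : plane R) : R := p * k.1 + q * k.2.

Let lin2_linear p q : linear (lin2 p q).
Proof.
move=> c [k1 k2] [l1 l2].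
change (p * (c * k1 + l1) + q * (c * k2 + l2) = c * (p * k1 + q * k2) + (p * l1 + q * l2)).
by ring.
Qed.

HB.instance Definition _ p q := GRing.isLinear.Build R (plane R) R _ (lin2 p q)
  (lin2_linear p q).

Let lin2_continuous p q : continuous (lin2 p q).
Proof.
move=> k; apply: cvgD; apply: cvgM; try exact: cvg_cst.
  exact: cvg_fst.
exact: cvg_snd.
Qed.

(** The increment is a horizontal step followed by a vertical one; the mean value theorem
   turns each step into a partial derivative at a nearby point. *)
Lemma C1_differentiable f f1 f2 x :
  (\forall y \near x, is_derive y (ux R) f (f1 y)) ->
  (\forall y \near x, is_derive y (uy R) f (f2 y)) ->
  {for x, continuous f1} -> {for x, continuous f2} ->
  differentiable f x /\ ('d f x : plane R -> R) = lin2 (f1 x) (f2 x).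
Proof.
move=> d1 d2 c1 c2.
have key : f \o shift x = cst (f x) + lin2 (f1 x) (f2 x) +o_ (0 : plane R) id.
  apply/eqaddoP => _/posnumP[eps].
  have e4 : 0 < eps%:num / 2 by [].
  have n1 : \forall y \near x, `|f1 x - f1 y| < eps%:num / 2 by exact: cvgr_dist_lt c1 _ e4.
  have n2 : \forall y \near x, `|f2 x - f2 y| < eps%:num / 2 by exact: cvgr_dist_lt c2 _ e4.
  have : \forall y \near x, (is_derive y (ux R) f (f1 y) /\ is_derive y (uy R) f (f2 y)) /\
     (`|f1 x - f1 y| < eps%:num / 2 /\ `|f2 x - f2 y| < eps%:num / 2).
    by near do (split; split).
  move=> /nbhs_normP[e /= e0 He].
  apply/(@nbhs_normP R (plane R)); exists e => //= -[a b]; rewrite /ball_/= sub0r normrN => abe.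
  have H (s t : R) : `|s| <= `|a| -> `|t| <= `|b| -> ball_ Num.norm x e (x + s *: (ux R) + t *: (uy R)).
    move=> sa tb; rewrite plane_stepx plane_stepy /= /ball_/=.
    apply: le_lt_trans abe; rewrite !plane_normE /=.
    by rewrite !opprD !addrA !subrr !add0r !normrN ge_max !le_max sa tb orbT.
  have mvt z w df (c : R) : (forall s, `|s| <= `|c| -> is_derive (z + s *: w) w f (df (z + s *: w))) ->
     exists2 s, `|s| <= `|c| & f (z + c *: w) - f z = df (z + s *: w) * c.
    move=> D; have [c0|c0] := leP 0 c.
      have [|s /andP[s0 sc]] := @mvt_line R _ f df z w 0 c c0.
        by move=> h /andP[h0 hc]; apply: D; rewrite !ger0_norm.
      rewrite scale0r addr0 subr0 => E; exists s => //.
      by rewrite !ger0_norm.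
    have [|s /andP[s0 sc]] := @mvt_line R _ f df z w c 0 (ltW c0).
      by move=> h /andP[h0 hc]; apply: D; rewrite !ler0_norm ?lerN2// ltW.
    rewrite scale0r addr0 sub0r mulrN => E; exists s.
      by rewrite !ler0_norm ?lerN2// ltW.
    by rewrite -opprB E opprK.
  have [|s sa E1] := mvt x (ux R) f1 a.
    by move=> s sa; have := H s 0 sa; rewrite scale0r addr0 normr0 => /(_ (normr_ge0 _))/He[[]].
  have [|t tb E2] := mvt (x + a *: (ux R)) (uy R) f2 b.
    by move=> t tb; have [[]] := He _ (H a t (lexx _) tb).
  have [_ [h1 _]] := He _ (H s 0 sa ltac:(by rewrite normr0)).
  have [_ [_ h2]] := He _ (H a t (lexx _) tb).
  rewrite scale0r addr0 in h1.
  rewrite -[X in `|X|]/(f ((a, b) + x) - (f x + (f1 x * a + f2 x * b))).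
  have -> : (a, b) + x = x + a *: (ux R) + b *: (uy R).
    by rewrite plane_stepx plane_stepy /= [LHS]surjective_pairing/=; congr pair; exact: addrC.
  rewrite [X in `|X|](_ : _ = (f1 (x + s *: (ux R)) - f1 x) * a +
      (f2 (x + a *: (ux R) + t *: (uy R)) - f2 x) * b); last first.
    by rewrite !mulrBl -E1 -E2; ring.
  rewrite (le_trans (ler_normD _ _))// !normrM.
  have na : `|a| <= `|(a, b)| by rewrite [leRHS]/Num.norm/= le_max lexx.
  have nb : `|b| <= `|(a, b)| by rewrite [leRHS]/Num.norm/= le_max lexx orbT.
  rewrite [leRHS](_ : _ = eps%:num / 2 * `|(a, b)| + eps%:num / 2 * `|(a, b)|); last by field.
  by apply: lerD; apply: ler_pM => //; rewrite distrC ltW.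
have E := diff_unique (@lin2_continuous (f1 x) (f2 x)) key.
split=> //; apply/diff_locallyP; rewrite E; split=> //; exact: lin2_continuous.
Unshelve. all: by end_near. Qed.

Lemma is_derive_chain f f1 f2 x (c1 c2 : R -> R) (s d1 d2 : R) :
  (c1 s, c2 s) = x ->
  (\forall y \near x, is_derive y (ux R) f (f1 y)) ->
  (\forall y \near x, is_derive y (uy R) f (f2 y)) ->
  {for x, continuous f1} -> {for x, continuous f2} ->
  is_derive s 1 c1 d1 -> is_derive s 1 c2 d2 ->
  is_derive s 1 (fun t => f (c1 t, c2 t)) (f1 x * d1 + f2 x * d2).
Proof.
move=> xE h1 h2 k1 k2 D1 D2.
have [df dE] := C1_differentiable h1 h2 k1 k2.
have dc : differentiable (fun t => (c1 t, c2 t)) s.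
  by apply: differentiable_pair; apply/derivable1_diffP; [have [] := D1|have [] := D2].
have dfc : differentiable f ((fun t => (c1 t, c2 t)) s) by rewrite xE.
have := differentiable_comp dc dfc => dd.
apply: DeriveDef; first exact/derivable1_diffP.
rewrite deriveE// (diff_comp dc dfc) /= xE dE /lin2 -deriveE//.
by have := is_derive_pair D1 D2 => -[_ ->].
Qed.

End chain.

(** * Integrals over products *)

Section fubini.
Context {d1 d2 : measure_display} {T1 : measurableType d1} {T2 : measurableType d2}.
Context {R : realType}.
Variables (m1 : {sigma_finite_measure set T1 -> \bar R})
  (m2 : {sigma_finite_measure set T2 -> \bar R}).
Variables (X : set T1) (Y : set T2) (f : T1 * T2 -> R).
Hypotheses (mX : measurable X) (mY : measurable Y).
Hypothesis fint : (m1 \x m2)%E.-integrable (X `*` Y) (EFin \o f).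

Let g : T1 * T2 -> \bar R := (EFin \o f) \_ (X `*` Y).

Let gint : (m1 \x m2)%E.-integrable setT g.
Proof. by rewrite /g -(integrable_mkcond (EFin \o f))//; exact: measurableX. Qed.

(** Integrability of every slice, and not only of almost every one, is what identifies the
   real-valued inner integral with the extended one. *)
Lemma Rintegral_prod1 :
  (forall x, X x -> m2.-integrable Y (fun y => (f (x, y))%:E)) ->
  \int[(m1 \x m2)%E]_(z in X `*` Y) f z = \int[m1]_(x in X) \int[m2]_(y in Y) f (x, y).
Proof.
move=> fin; rewrite /Rintegral [in LHS]integral_mkcond -(integral12_prod_meas1 gint).
rewrite [in RHS]integral_mkcond; congr fine; apply: eq_integral => x _.
rewrite /fubini_F patchE; case: ifPn => [/set_mem Xx|/negP nX].
  rewrite fineK; last exact: integrable_fin_num (fin x Xx).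
  rewrite [RHS]integral_mkcond; apply: eq_integral => y _; rewrite /g !patchE.
  case: ifPn => [/set_mem[/= _ Yy]|/negP nXY].
    by rewrite mem_set.
  rewrite ifF//; apply/negP => /set_mem Yy; apply: nXY; exact/mem_set.
apply: integral0_eq => y _; rewrite /g patchE ifF//.
by apply/negP => /set_mem[/= Xx _]; apply: nX; exact/mem_set.
Qed.

Lemma Rintegral_prod2 :
  (forall y, Y y -> m1.-integrable X (fun x => (f (x, y))%:E)) ->
  \int[(m1 \x m2)%E]_(z in X `*` Y) f z = \int[m2]_(y in Y) \int[m1]_(x in X) f (x, y).
Proof.
move=> fin; rewrite /Rintegral [in LHS]integral_mkcond -(integral21_prod_meas1 gint).
rewrite [in RHS]integral_mkcond; congr fine; apply: eq_integral => y _.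
rewrite /fubini_G patchE; case: ifPn => [/set_mem Yy|/negP nY].
  rewrite fineK; last exact: integrable_fin_num (fin y Yy).
  rewrite [RHS]integral_mkcond; apply: eq_integral => x _; rewrite /g !patchE.
  case: ifPn => [/set_mem[/= Xx _]|/negP nXY].
    by rewrite mem_set.
  rewrite ifF//; apply/negP => /set_mem Xx; apply: nXY; exact/mem_set.
apply: integral0_eq => x _; rewrite /g patchE ifF//.
by apply/negP => /set_mem[/= _ Yy]; apply: nY; exact/mem_set.
Qed.

End fubini.

Section product_sigma_finite.
Context {d1 d2 : measure_display} {T1 : measurableType d1} {T2 : measurableType d2}.
Context {R : realType}.
Variables (m1 : {sigma_finite_measure set T1 -> \bar R})
  (m2 : {sigma_finite_measure set T2 -> \bar R}).

Lemma product_sigma_finite : sigma_finite setT (m1 \x m2)%E.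
Proof.
have /sigma_finiteP[F [UF ndF finF]] := sigma_finiteT m1.
have /sigma_finiteP[G [UG ndG finG]] := sigma_finiteT m2.
exists (fun n => F n `*` G n); last first.
  move=> n; have [mF Fn] := finF n; have [mG Gn] := finG n; split.
    exact: measurableX.
  by rewrite product_measure1E//; rewrite lte_mul_pinfty// ge0_fin_numE.
apply/seteqP; split=> // -[x y] _.
have : [set: T1] x by []. have : [set: T2] y by [].
rewrite UF UG => -[j _ Gj] [i _ Fi]; exists (maxn i j) => //; split=> /=.
  by apply: (subsetPset _ _ (ndF _ _ (leq_maxl i j))).
by apply: (subsetPset _ _ (ndG _ _ (leq_maxr i j))).
Qed.

End product_sigma_finite.

Section plane_measure.
Context (R : realType).

(** Under a name of its own the product carries a sigma-finite structure, and can be a factor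
   of a further product with time. *)
Definition plane_measure : set (borel_plane R) -> \bar R :=
  (@lebesgue_measure R \x @lebesgue_measure R)%E.

HB.instance Definition _ := Measure.on plane_measure.
HB.instance Definition _ := Measure_isSigmaFinite.Build _ _ _ plane_measure
  (product_sigma_finite (@lebesgue_measure R) (@lebesgue_measure R)).

End plane_measure.

Section bounded_support.
Context {d : measure_display} {T : measurableType d} {R : realType}.
Variable mu : {measure set T -> \bar R}.

Lemma integrable_bounded (A : set T) (f : T -> R) (M : R) :
  measurable A -> (mu A < +oo)%E -> measurable_fun A f ->
  (forall x, A x -> `|f x| <= M) -> mu.-integrable A (EFin \o f).
Proof.
move=> mA Afin mf fM; apply: measurable_bounded_integrable => //.
exists M; split; first exact: num_real.
by move=> N MN x Ax /=; rewrite (le_trans (fM x Ax))// ltW.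
Qed.

Lemma integrable_bounded_support (A B : set T) (f : T -> R) (M : R) :
  measurable A -> measurable B -> (mu (A `&` B) < +oo)%E ->
  measurable_fun (A `&` B) f ->
  (forall x, A x -> B x -> `|f x| <= M) -> (forall x, A x -> ~ B x -> f x = 0) ->
  mu.-integrable A (EFin \o f).
Proof.
move=> mA mB ABfin mf fM f0.
have : mu.-integrable (A `&` B) (EFin \o f).
  by apply: (@integrable_bounded _ _ M) => //; [exact: measurableI|move=> x []; exact: fM].
move/(integrable_restrict mu mB mA); apply: eq_integrable => // x /set_mem Ax.
rewrite patchE; case: ifPn => //= /negP nB; rewrite f0// => Bx; apply: nB; exact/mem_set.
Qed.

Lemma Rintegral_support (A B : set T) (f : T -> R) :
  (forall x, A x -> ~ B x -> f x = 0) ->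
  \int[mu]_(x in A) f x = \int[mu]_(x in A `&` B) f x.
Proof.
move=> f0; rewrite Rintegral_mkcondr; apply: eq_Rintegral => x /set_mem Ax.
rewrite patchE; case: ifPn => //= /negP nB; rewrite f0// => Bx; apply: nB; exact/mem_set.
Qed.

End bounded_support.

Section boxes.
Context {R : realType}.
Implicit Types (A C : set (plane R)) (f : plane R -> R).

Definition box (r : R) : set (plane R) := [set x | `|x| <= r].

Lemma boxE r : box r = `[- r, r]%classic `*` `[- r, r]%classic.
Proof.
apply/seteqP; split=> -[x y]; rewrite /box/= plane_normE/= ge_max !ler_norml !in_itv/=.
  by move=> /andP[].
by move=> [-> ->].
Qed.

Lemma compact_box r : compact (box r).
Proof. by rewrite boxE; apply: compact_setX; exact: segment_compact. Qed.

Lemma closed_box r : closed (box r).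
Proof. by apply: compact_closed; [exact: norm_hausdorff|exact: compact_box]. Qed.

Lemma measurable_box r : measurable (box r : set (borel_plane R)).
Proof. by apply: closed_measurable_plane; exact: closed_box. Qed.

Lemma plane_measure_box r : 0 <= r -> plane_measure (box r) = ((2 * r) ^+ 2)%:E.
Proof.
move=> r0; rewrite boxE /plane_measure product_measure1E//; try exact: measurable_itv.
rewrite /= lebesgue_measure_itv/= lte_fin.
have [rr|rr] := ltP (- r) r.
  by rewrite -EFinD -EFinM; congr EFin; ring.
have -> : r = 0 by lra.
by rewrite mul0e mulr0 expr0n.
Qed.

Lemma plane_measure_finite A r : measurable (A : set (borel_plane R)) ->
  A `<=` box r -> (plane_measure A < +oo)%E.
Proof.
move=> mA Ar; apply: (@le_lt_trans _ _ (plane_measure (box `|r|))).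
  apply: le_measure; rewrite ?inE//; first exact: measurable_box.
  by apply: subset_trans Ar _ => x /= xr; rewrite /box/= (le_trans xr)// ler_norm.
by rewrite plane_measure_box ?ltry.
Qed.

Lemma cont_on_bounded {T : topologicalType} (K : set T) (f : T -> R) :
  compact K -> cont_on K f -> exists M, forall x, K x -> `|f x| <= M.
Proof.
move=> cK /cont_onP cf.
have [M [_ HM]] := compact_bounded (continuous_compact cf cK).
exists (M + 1) => x Kx; apply: (HM (M + 1)); first by rewrite ltrDl.
by exists x.
Qed.

(** Continuity up to the boundary bounds the function on the compact part of the closure
   that meets its support. *)
Lemma cont_on_integrable A C f r : measurable (A : set (borel_plane R)) ->
  closed C -> A `<=` C -> cont_on C f -> (forall x, A x -> r < `|x| -> f x = 0) ->
  (@plane_measure R).-integrable A (EFin \o f).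
Proof.
move=> mA cC AC cf f0.
have cK : compact (C `&` box r).
  by apply: (subclosed_compact _ (@compact_box r)) => //; apply: closedI => //; exact: closed_box.
have [M HM] := cont_on_bounded cK (cont_onS (@subIsetl _ _ _) cf).
apply: (@integrable_bounded_support _ (borel_plane R) R (@plane_measure R) A (box r) f M) => //.
- exact: measurable_box.
- apply: (@plane_measure_finite _ r); last exact: subIsetr.
  by apply: measurableI => //; exact: measurable_box.
- apply: cont_on_measurable; first by apply: measurableI => //; exact: measurable_box.
  by apply: cont_onS cf => x [/AC].
- by move=> x Ax xr; apply: HM; split => //; exact: AC.
by move=> x Ax /negP; rewrite -ltNge; exact: f0.
Qed.

Lemma cont_on_integrable_spacetime A C (f : spacetime R -> R) r (a b : R) :
  measurable (A : set (borel_plane R)) ->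
  closed C -> A `<=` C -> cont_on (C `*` `[a, b]) f ->
  (forall x s, A x -> a < s < b -> r < `|x| -> f (x, s) = 0) ->
  (@plane_measure R \x @lebesgue_measure R)%E.-integrable (A `*` `]a, b[) (EFin \o f).
Proof.
move=> mA cC AC cf f0.
have cK : compact ((C `&` box r) `*` `[a, b]).
  apply: compact_setX; last exact: segment_compact.
  by apply: (subclosed_compact _ (@compact_box r)) => //; apply: closedI => //; exact: closed_box.
have [|M HM] := cont_on_bounded cK (f := f).
  by apply: cont_onS cf => -[x s] [[/= Cx _] sab].
have mi : measurable (`]a, b[ : set (measurableTypeR R)) by exact: measurable_itv.
apply: (@integrable_bounded_support _ (borel_plane R * measurableTypeR R)%type R (@plane_measure R \x @lebesgue_measure R)%E (A `*` `]a, b[) (box r `*` setT) f M) => //.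
- exact: measurableX.
- by apply: measurableX => //; exact: measurable_box.
- rewrite -setXI setIT.
  have mAr : measurable (A `&` box r : set (borel_plane R)).
    by apply: measurableI => //; exact: measurable_box.
  have /= -> := @product_measure1E _ _ _ _ R (@plane_measure R) (@lebesgue_measure R) _ _ mAr mi.
  rewrite lte_mul_pinfty ?ge0_fin_numE//.
    apply: (@plane_measure_finite _ r); last exact: subIsetr.
    by apply: measurableI => //; exact: measurable_box.
  by rewrite /= lebesgue_measure_itv/=; case: ifPn => // _; rewrite -EFinD ltry.
- apply: cont_on_measurable_spacetime.
    rewrite -setXI setIT; apply: measurableX => //.
    by apply: measurableI => //; exact: measurable_box.
  apply: cont_onS cf => -[x s] [[/= /AC Cx]]; rewrite /= ?in_itv/= => /andP[? ?] _; split=> //=.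
  by rewrite ?in_itv/= !ltW.
- move=> [x s] [/= Ax]; rewrite in_itv/= => /andP[? ?] [xr _]; apply: HM; split=> /=.
    by split => //; exact: AC.
  by rewrite ?in_itv/= !ltW.
- move=> [x s] [/= Ax]; rewrite in_itv/= => sab H; apply: f0 => //.
  by rewrite ltNge; apply/negP => xr; apply: H.
Qed.

End boxes.

(** * Smooth functions and the implicit function theorem *)

Section smooth_facts.
Context {R : realType} {V W : normedModType R}.
Implicit Types (U : set V) (f : V -> W).

Lemma smooth_on_is_derive U f z w : smooth_on U f -> U z ->
  is_derive z w f ('D_w f z).
Proof. by move=> sf Uz; apply: derivableP; have [] := sf [::] z Uz. Qed.

Lemma smooth_on_continuous U f z : smooth_on U f -> U z -> {for z, continuous f}.
Proof. by move=> sf Uz; have [] := sf [::] z Uz. Qed.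

Lemma smooth_on_derive U f w : smooth_on U f -> smooth_on U ('D_w f).
Proof.
move=> sf s z Uz; have := sf (rcons s w) z Uz.
by have -> : Defs.iterD (rcons s w) f = Defs.iterD s ('D_w f) by elim: s => //= a s ->.
Qed.

End smooth_facts.

Section Ck.
Context {R : realType}.
Implicit Types (I : set R) (f g : R -> R).

Fixpoint Ck (n : nat) I f : Prop :=
  if n is n'.+1 then (forall x, I x -> derivable f x 1) /\ Ck n' I ('D_1 f)
  else forall x, I x -> {for x, continuous f}.

Lemma eq_derive_open I f g x : open I -> (forall y, I y -> f y = g y) -> I x ->
  (derivable f x 1 -> derivable g x 1) /\ 'D_1 f x = 'D_1 g x.
Proof.
move=> oI fg Ix.
have n : \forall y \near x, f y = g y.
  by apply: filterS (open_nbhs_nbhs (conj oI Ix)).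
split; last by apply: near_eq_derive => //; rewrite oner_neq0.
by apply: near_eq_derivable => //; rewrite oner_neq0.
Qed.

Lemma eq_Ck n I f g : open I -> (forall x, I x -> f x = g x) -> Ck n I f -> Ck n I g.
Proof.
move=> oI; elim: n f g => [|n IH] f g fg /=.
  move=> cf x Ix; have := cf x Ix; rewrite /prop_for /continuous_at (fg _ Ix).
  apply: cvg_trans; apply: near_eq_cvg.
  by apply: filterS (open_nbhs_nbhs (conj oI Ix)) => y Iy; rewrite fg.
move=> [df cf]; split=> [x Ix|].
  by have [+ _] := eq_derive_open oI fg Ix; apply; exact: df.
by apply: IH cf => x Ix; have [_] := eq_derive_open oI fg Ix.
Qed.

Lemma CkW n I f : Ck n.+1 I f -> Ck n I f.
Proof.
elim: n f => [|n IH] f [df cf].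
  by move=> x Ix; apply/differentiable_continuous/derivable1_diffP; exact: df.
by split=> //; exact: IH.
Qed.

Lemma Ck_cst n I (c : R) : Ck n I (fun=> c).
Proof.
elim: n c => [|n IH] c /=; first by move=> x _; exact: cvg_cst.
split; first by move=> x _; exact: derivable_cst.
have -> : 'D_1 (fun=> c : R) = (fun=> 0) :> (R -> R).
  by apply/funext => x; exact: derive_cst.
exact: IH.
Qed.

Lemma CkD n I f g : open I -> Ck n I f -> Ck n I g -> Ck n I (fun x => f x + g x).
Proof.
move=> oI; elim: n f g => [|n IH] f g /=.
  by move=> cf cg x Ix; apply: cvgD; [exact: cf|exact: cg].
move=> [df cf] [dg cg]; split.
  by move=> x Ix; apply: derivableD; [exact: df|exact: dg].
apply: eq_Ck (IH _ _ cf cg) => // x Ix.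
by rewrite -deriveD//; [exact: df|exact: dg].
Qed.

Lemma CkM n I f g : open I -> Ck n I f -> Ck n I g -> Ck n I (fun x => f x * g x).
Proof.
move=> oI; elim: n f g => [|n IH] f g.
  by move=> cf cg x Ix; apply: cvgM; [exact: cf|exact: cg].
move=> Cf Cg; have [df cf] := Cf; have [dg cg] := Cg; split.
  by move=> x Ix; apply: derivableM; [exact: df|exact: dg].
apply: (@eq_Ck _ _ (fun x => f x * 'D_1 g x + g x * 'D_1 f x)) => // [x Ix|].
  by rewrite deriveM//; [exact: df|exact: dg].
by apply: CkD => //; apply: IH => //; exact: CkW.
Qed.

Lemma CkV n I f : open I -> (forall x, I x -> f x != 0) -> Ck n I f ->
  Ck n I (fun x => (f x)^-1).
Proof.
move=> oI f0; elim: n => [|n IH].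
  by move=> cf x Ix; apply: cvgV; [exact: f0|exact: cf].
move=> Cf; have [df cf] := Cf; split.
  by move=> x Ix; apply: derivableV; [exact: f0|exact: df].
apply: (@eq_Ck _ _ (fun x => (-1) * (f x)^-1 * (f x)^-1 * 'D_1 f x)) => // [x Ix|].
  rewrite deriveV; [|exact: f0|exact: df].
  by rewrite -[_ *: _]/(_ * _) expr2 invfM mulN1r !mulNr.
by do !apply: CkM => //; [exact: Ck_cst|apply: IH; exact: CkW|apply: IH; exact: CkW].
Qed.

(** The chain rule replaces [phi] by its partial derivatives, which are again smooth; this
   is the regularity gain in the implicit function theorem. *)
Lemma Ck_graph n I (U : set (plane R)) (phi : plane R -> R) (h : R -> R) :
  open I -> open U -> (forall x, I x -> U (x, h x)) ->
  smooth_on U phi -> Ck n I h -> Ck n I (fun x => phi (x, h x)).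
Proof.
move=> oI oU IU; elim: n phi => [|n IH] phi sphi.
  move=> ch x Ix; apply: (@continuous_comp _ _ _ (fun x => (x, h x)) phi).
    have cx : {for x, continuous (fun y : R => y)} by exact: cvg_id.
    exact: (cvg_pair cx (ch x Ix)).
  by apply: smooth_on_continuous sphi _; exact: IU.
move=> Ch; have [dh ch] := Ch.
have D x : I x -> is_derive x 1 (fun x => phi (x, h x))
    ('D_(ux R) phi (x, h x) * 1 + 'D_(uy R) phi (x, h x) * 'D_1 h x).
  move=> Ix; have UP := IU _ Ix.
  apply: (@is_derive_chain R phi ('D_(ux R) phi) ('D_(uy R) phi) (x, h x) id h x 1) => //.
  - by apply: filterS (open_nbhs_nbhs (conj oU UP)) => y Uy; exact: smooth_on_is_derive sphi Uy.
  - by apply: filterS (open_nbhs_nbhs (conj oU UP)) => y Uy; exact: smooth_on_is_derive sphi Uy.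
  - by apply: smooth_on_continuous (smooth_on_derive _ sphi) UP.
  - by apply: smooth_on_continuous (smooth_on_derive _ sphi) UP.
  - by apply: derivableP; exact: dh.
split; first by move=> x Ix; have [] := D x Ix.
apply: (@eq_Ck _ _ (fun x => 'D_(ux R) phi (x, h x) + 'D_(uy R) phi (x, h x) * 'D_1 h x)) => //.
  by move=> x Ix; have [_ ->] := D x Ix; rewrite mulr1.
have Cn := CkW Ch.
apply: CkD => //; first exact: (IH ('D_(ux R) phi) (smooth_on_derive (ux R) sphi) Cn).
by apply: CkM => //; exact: (IH ('D_(uy R) phi) (smooth_on_derive (uy R) sphi) Cn).
Qed.

(** On the line a directional derivative is a multiple of the derivative, so that
   all iterated ones exist as soon as the function is C^k for every k. *)
Lemma Ck_smooth_on I (g1 g2 : R -> R) : open I -> (forall n, Ck n I g1) ->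
  (forall n, Ck n I g2) -> smooth_on I (fun s => (g1 s, g2 s) : plane R).
Proof.
move=> oI C1 C2 s z Iz.
have [k1 [k2 [K1 K2 E]]] : exists k1 k2 : R -> R, [/\ (forall n, Ck n I k1),
   (forall n, Ck n I k2) & forall x, I x ->
     Defs.iterD s (fun s => (g1 s, g2 s) : plane R) x = (k1 x, k2 x)].
  elim: s => [|w s [k1 [k2 [K1 K2 E]]]]; first by exists g1, g2.
  exists (fun x => w * 'D_1 k1 x), (fun x => w * 'D_1 k2 x); split.
  - by move=> n; apply: CkM => //; [exact: Ck_cst|have [] := K1 n.+1].
  - by move=> n; apply: CkM => //; [exact: Ck_cst|have [] := K2 n.+1].
  move=> x Ix /=.
  have D1 : is_derive x 1 k1 ('D_1 k1 x) by apply: derivableP; have [] := K1 1%N; move=> /(_ x Ix).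
  have D2 : is_derive x 1 k2 ('D_1 k2 x) by apply: derivableP; have [] := K2 1%N; move=> /(_ x Ix).
  have D := is_derive_pair D1 D2.
  have df : differentiable (fun y => (k1 y, k2 y)) x by apply/derivable1_diffP; have [] := D.
  have -> : 'D_w (Defs.iterD s (fun s => (g1 s, g2 s) : plane R)) x =
       'D_w (fun y => (k1 y, k2 y)) x.
    have [->|w0] := eqVneq w 0; first by rewrite !derive0.
    apply: near_eq_derive => //.
    by apply: filterS (open_nbhs_nbhs (conj oI Ix)) => y; exact: E.
  rewrite deriveE// -[w in LHS]mulr1 -[w * 1]/(w *: 1) linearZ/= -deriveE//.
  by have [_ ->] := D.
have D1 : is_derive z 1 k1 ('D_1 k1 z) by apply: derivableP; have [] := K1 1%N; move=> /(_ z Iz).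
have D2 : is_derive z 1 k2 ('D_1 k2 z) by apply: derivableP; have [] := K2 1%N; move=> /(_ z Iz).
have df : differentiable (fun y => (k1 y, k2 y)) z.
  by apply/derivable1_diffP; have [] := is_derive_pair D1 D2.
have nE : \forall y \near z, Defs.iterD s (fun s => (g1 s, g2 s) : plane R) y = (k1 y, k2 y).
  by apply: filterS (open_nbhs_nbhs (conj oI Iz)) => y; exact: E.
split=> [w|].
  have [->|w0] := eqVneq w 0; first exact: derivable0.
  apply: (@near_eq_derivable _ _ _ (fun y => (k1 y, k2 y))) => //.
    by apply: filterS nE => y ->.
  exact: diff_derivable.
rewrite /prop_for /continuous_at (E _ Iz).
apply: cvg_trans (differentiable_continuous df).
by apply: near_eq_cvg; apply: filterS nE => y ->.
Qed.

End Ck.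

Section implicit_function.
Context {R : realType}.

Lemma is_derive_eps (h : R -> R) (x L : R) :
  (forall e : R, 0 < e -> exists2 d : R, 0 < d & forall t : R, t != 0 -> `|t| < d ->
     `|(h (x + t) - h x) / t - L| < e) ->
  is_derive x 1 h L.
Proof.
move=> H.
have C : (fun t : R => t^-1 *: ((h \o shift x) (t *: (1 : R)) - h x)) @ 0^' --> L.
  apply/cvgrPdist_lt => e /H[d d0 Hd]; rewrite /dnbhs /within/=.
  apply/nbhs_normP; exists d => //= t; rewrite /ball_/= sub0r normrN => td t0.
  have := Hd t t0 td; rewrite distrC /= -[t^-1 *: _]/(_ * _) [t *: 1]mulr1.
  by rewrite (addrC t x) mulrC.
apply: DeriveDef; first by apply/cvg_ex; exists L.
exact/cvg_lim.
Qed.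

(** The zero set of a smooth function with positive vertical derivative is the graph
   of a function h; the difference quotients of h are
   [- rho_x (P) / rho_y (Q)] for points P and Q that tend to the base point.  This formula
   for h' then raises the regularity of h by one, as often as wanted.  The factor 4 leaves
   a strip of height [2 * k] below the graph inside the neighbourhood. *)
Lemma implicit_function (U : set (plane R)) (rho : plane R -> R) (p q : R) :
  open U -> U (p, q) -> smooth_on U rho -> rho (p, q) = 0 ->
  0 < 'D_(uy R) rho (p, q) ->
  exists (d k : R) (h : R -> R), [/\ 0 < d /\ 0 < k,
    (forall x y, `|x - p| < d -> `|y - q| < 4 * k -> U (x, y)),
    (forall x, `|x - p| < d -> `|h x - q| < k /\ rho (x, h x) = 0),
    (forall x y, `|x - p| < d -> `|y - q| < 4 * k -> (rho (x, y) < 0 <-> y < h x) /\ (h x < y -> 0 < rho (x, y))) &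
    (forall n, Ck n [set x | `|x - p| < d] h)].
Proof.
move=> oU Upq srho r0 dr0.
pose r1 := 'D_(ux R) rho; pose r2 := 'D_(uy R) rho.
have cr2 : {for (p, q), continuous r2}.
  exact: smooth_on_continuous (smooth_on_derive _ srho) Upq.
have : \forall z \near (p, q), U z /\ 0 < r2 z.
  near=> z; split; first by near: z; exact: open_nbhs_nbhs.
  near: z; exact: (cvgr_gt _ cr2 _ dr0).
move=> /nbhs_normP[e /= e0 He].
pose k := e / 4; have k0 : 0 < k by rewrite divr_gt0.
have kE : 4 * k = e by rewrite /k mulrC divfK.
have He' x y : `|x - p| < e -> `|y - q| < e -> U (x, y) /\ 0 < r2 (x, y).
  move=> xp yq; apply: He; rewrite /ball_/= plane_normE/= gt_max distrC xp/= distrC.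
  by rewrite yq.
have mono x y1 y2 : `|x - p| < e -> `|y1 - q| < e -> `|y2 - q| < e -> y1 < y2 ->
    rho (x, y1) < rho (x, y2).
  move=> xp y1q y2q y12.
  have [||c /andP[c0 c1]] := @mvt_line R _ rho r2 (x, y1) (uy R) 0 (y2 - y1).
  - by rewrite subr_ge0 ltW.
  - move=> t /andP[t0 t1]; rewrite plane_stepy/=.
    apply: smooth_on_is_derive srho _; apply: (proj1 (He' _ _ _ _)) => //.
    by move: y1q y2q; rewrite !ltr_norml; lra.
  rewrite !plane_stepy/= addr0 subr0 (addrC y1) subrK => E.
  rewrite -subr_gt0 E mulr_gt0 ?subr_gt0//; apply: (proj2 (He' _ _ _ _)) => //.
  by move: y1q y2q; rewrite !ltr_norml; lra.
have cont x y : `|x - p| < e -> `|y - q| < e -> {for (x, y), continuous rho}.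
  move=> xp yq; apply: smooth_on_continuous srho _.
  exact: (proj1 (He' _ _ xp yq)).
have cont1 x y : `|x - p| < e -> `|y - q| < e -> rho (t, y) @[t --> x] --> rho (x, y).
  move=> xp yq; have := cont x y xp yq; apply: (@continuous_comp _ _ _ (fun t => (t, y)) rho).
  have cx : {for x, continuous (fun y : R => y)} by exact: cvg_id.
  exact: (cvg_pair cx (cvg_cst _)).
have pe : `|p - p| < e by rewrite subrr normr0.
have qe : `|q - q| < e by rewrite subrr normr0.
have qke : `|(q + k) - q| < e by rewrite addrAC subrr add0r gtr0_norm// -kE ltr_pMl// ltr1n.
have qke' : `|(q - k) - q| < e by rewrite addrAC subrr add0r normrN gtr0_norm// -kE ltr_pMl// ltr1n.
have top : 0 < rho (p, q + k) by rewrite -r0; apply: mono => //; rewrite ltrDl.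
have bot : rho (p, q - k) < 0 by rewrite -r0; apply: mono => //; rewrite gtrBl.
have : \forall x \near p, 0 < rho (x, q + k) /\ rho (x, q - k) < 0.
  near=> x; split; near: x.
    exact: (cvgr_gt _ (cont1 p (q + k) pe qke) _ top).
  exact: (cvgr_lt _ (cont1 p (q - k) pe qke') _ bot).
move=> /nbhs_normP[d1 /= d10 Hd1].
pose d := Num.min d1 e; have d0 : 0 < d by rewrite lt_min d10.
have dxe x : `|x - p| < d -> `|x - p| < e by rewrite lt_min => /andP[].
have dx1 x : `|x - p| < d -> 0 < rho (x, q + k) /\ rho (x, q - k) < 0.
  by rewrite lt_min => /andP[h _]; apply: Hd1; rewrite /ball_/= distrC.
have ex x : exists y, `|x - p| < d -> `|y - q| < k /\ rho (x, y) = 0.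
  have [xd|] := boolP (`|x - p| < d); last by exists q.
  have [tx bx] := dx1 x xd; have xe := dxe x xd.
  have [|||c] := @IVT R (fun y => rho (x, y)) (q - k) (q + k) 0.
  - by rewrite lerD2l; lra.
  - apply/cont_onP => y; rewrite /= in_itv/= => /andP[yl yr].
    have ye : `|y - q| < e by rewrite -kE ltr_norml; move: k0; lra.
    apply: cvg_within_filter.
    have := cont x y xe ye; apply: (@continuous_comp _ _ _ (fun t => (x, t)) rho).
    have cx : {for y, continuous (fun y : R => y)} by exact: cvg_id.
    exact: (cvg_pair (cvg_cst _) cx).
  - by rewrite ge_min le_max !(ltW tx, ltW bx) orbT.
  rewrite in_itv/= => /andP[c1 c2] rc; exists c => _; split=> //.
  have cnk : c != q + k by apply: contraTneq tx => <-; rewrite rc ltxx.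
  have cnk' : c != q - k by apply: contraTneq bx => <-; rewrite rc ltxx.
  have cl : q - k < c by rewrite lt_neqAle eq_sym cnk'.
  have cr : c < q + k by rewrite lt_neqAle cnk.
  by rewrite ltr_norml; move: cl cr; lra.
have [h Hh] := choice ex.
have ke : k < e by rewrite -kE ltr_pMl// ltr1n.
have sgn x y : `|x - p| < d -> `|y - q| < e -> (rho (x, y) < 0 <-> y < h x).
  move=> xd ye; have [hk hr] := Hh x xd; have he := lt_trans hk ke; have xe := dxe x xd.
  split=> [ry|yh]; last by rewrite -hr; apply: mono.
  rewrite ltNge; apply/negP; rewrite le_eqVlt => /predU1P[E|hy].
    by move: ry; rewrite -E hr ltxx.
  by have := mono x _ _ xe he ye hy; rewrite hr => /(lt_trans ry); rewrite ltxx.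
have sgn' x y : `|x - p| < d -> `|y - q| < e -> h x < y -> 0 < rho (x, y).
  move=> xd ye hy; have [hk hr] := Hh x xd; have he := lt_trans hk ke; have xe := dxe x xd.
  by rewrite -hr; apply: mono.
have oI : open [set x | `|x - p| < d].
  have -> : [set x | `|x - p| < d] = ball p d.
    by apply/seteqP; split=> x; rewrite -ball_normE/= distrC.
  exact: ball_open.
have ch x : `|x - p| < d -> {for x, continuous h}.
  move=> xd; have [hk hr] := Hh x xd; have xe := dxe x xd.
  apply/cvgrPdist_lt => eps eps0.
  pose b := Num.min (eps / 2) (e - k).
  have b0 : 0 < b by rewrite lt_min subr_gt0 ke divr_gt0.
  have be : b <= e - k by rewrite ge_min lexx orbT.
  have h1 : `|h x + b - q| < e.
    by rewrite addrAC (le_lt_trans (ler_normD _ _))// (gtr0_norm b0); move: hk be; lra.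
  have h2 : `|h x - b - q| < e.
    by rewrite addrAC (le_lt_trans (ler_normD _ _))// normrN (gtr0_norm b0); move: hk be; lra.
  have t1 : 0 < rho (x, h x + b) by apply: sgn' => //; rewrite ltrDl.
  have t2 : rho (x, h x - b) < 0 by apply/sgn => //; rewrite gtrBl.
  near=> y.
  have yd : `|y - p| < d by near: y; exact: (open_nbhs_nbhs (conj oI xd)).
  have : 0 < rho (y, h x + b).
    by near: y; exact: (cvgr_gt _ (cont1 x (h x + b) xe h1) _ t1).
  have : rho (y, h x - b) < 0.
    by near: y; exact: (cvgr_lt _ (cont1 x (h x - b) xe h2) _ t2).
  move=> /sgn -/(_ yd h2) hyb ty.
  have hyb' : h y <= h x + b.
    rewrite leNgt; apply/negP => /sgn -/(_ yd h1) /(lt_trans ty).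
    by rewrite ltxx.
  have bb : b <= eps / 2 by rewrite ge_min lexx.
  by rewrite ltr_norml; move: hyb hyb' bb eps0; lra.
have Dh x : `|x - p| < d -> is_derive x 1 h (- r1 (x, h x) * (r2 (x, h x))^-1).
  move=> xd; have [hk hr] := Hh x xd; have he := lt_trans hk ke; have xe := dxe x xd.
  have [UP r2P] := He' x (h x) xe he.
  have c1 : {for (x, h x), continuous r1} by exact: smooth_on_continuous (smooth_on_derive _ srho) UP.
  have c2 : {for (x, h x), continuous r2} by exact: smooth_on_continuous (smooth_on_derive _ srho) UP.
  apply: is_derive_eps => eps eps0.
  have cQ : - r1 z.1 * (r2 z.2)^-1 @[z --> ((x, h x), (x, h x))] --> - r1 (x, h x) * (r2 (x, h x))^-1.
    apply: cvgM.
      apply: cvgN; apply: (@continuous_comp _ _ _ fst r1 ((x, h x), (x, h x))); [exact: cvg_fst|exact: c1].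
    apply: cvgV; first by rewrite gt_eqF.
    apply: (@continuous_comp _ _ _ snd r2 ((x, h x), (x, h x))); [exact: cvg_snd|exact: c2].
  have := @cvgr_dist_lt _ _ _ _ _ _ _ cQ _ eps0.
  move=> /(_ _) /(@nbhs_normP R (plane R * plane R)%type)[eta0 /= e00 Heta0].
  pose eta := Num.min eta0 (e - k).
  have eta_0 : 0 < eta by rewrite lt_min e00 subr_gt0.
  have nh : \forall y \near x, `|h x - h y| < eta by exact: cvgr_dist_lt (ch x xd) _ eta_0.
  have : \forall y \near x, `|y - p| < d /\ `|h x - h y| < eta.
    near=> y; split; last by near: y.
    by near: y; exact: (open_nbhs_nbhs (conj oI xd)).
  move=> /nbhs_normP[d2 /= d20 Hd2].
  exists (Num.min d2 eta); first by rewrite lt_min d20.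
  move=> t t0; rewrite lt_min => /andP[td2 teta].
  have seg s : `|s| <= `|t| -> `|(x + s) - p| < d.
    move=> st; apply: (proj1 (Hd2 _ _)); rewrite /ball_/= opprD addNKr normrN.
    exact: le_lt_trans td2.
  have xtd : `|x + t - p| < d by exact: seg.
  have [htk htr] := Hh (x + t) xtd; have hte := lt_trans htk ke.
  have [_ hxt] : `|x + t - p| < d /\ `|h x - h (x + t)| < eta.
    by apply: Hd2; rewrite /ball_/= opprD addNKr normrN.
  have [s st E1] : exists2 s, `|s| <= `|t| &
     rho (x + t, h (x + t)) - rho (x, h (x + t)) = r1 (x + s, h (x + t)) * t.
    have D s : `|s| <= `|t| -> is_derive ((x, h (x + t)) + s *: ux R) (ux R) rho
        (r1 ((x, h (x + t)) + s *: ux R)).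
      move=> st; apply: smooth_on_is_derive srho _; rewrite plane_stepx/=.
      by apply: (proj1 (He' _ _ _ _)) => //; exact/dxe/seg.
    have [tp|tn] := leP 0 t.
      have [|s /andP[s0 st]] := @mvt_line R _ rho r1 (x, h (x + t)) (ux R) 0 t tp.
        by move=> s /andP[s0 st]; apply: D; rewrite !ger0_norm.
      rewrite !plane_stepx/= addr0 subr0 => E; exists s => //.
      by rewrite !ger0_norm.
    have [|s /andP[s0 st]] := @mvt_line R _ rho r1 (x, h (x + t)) (ux R) t 0 (ltW tn).
      by move=> s /andP[s0 st]; apply: D; rewrite !ler0_norm ?lerN2// ltW.
    rewrite !plane_stepx/= addr0 sub0r mulrN => E; exists s.
      by rewrite !ler0_norm ?lerN2// ltW.
    by rewrite -opprB E opprK.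
  have [s2 s2t E2] : exists2 r, `|r| <= `|h (x + t) - h x| &
     rho (x, h (x + t)) - rho (x, h x) = r2 (x, h x + r) * (h (x + t) - h x).
    have D r : `|r| <= `|h (x + t) - h x| -> is_derive ((x, h x) + r *: uy R) (uy R) rho
        (r2 ((x, h x) + r *: uy R)).
      move=> rt'; apply: smooth_on_is_derive srho _; rewrite plane_stepy/=.
      apply: (proj1 (He' _ _ _ _)) => //; rewrite addrAC (le_lt_trans (ler_normD _ _))//.
      have : eta <= e - k by rewrite ge_min lexx orbT.
      by move: hxt hk; rewrite distrC; move: rt'; lra.
    set u := h (x + t) - h x in D *.
    have htE : h (x + t) = h x + u by rewrite /u; ring.
    have [tp|tn] := leP 0 u.
      have [|r /andP[r0' rt'']] := @mvt_line R _ rho r2 (x, h x) (uy R) 0 u tp.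
        by move=> r /andP[r0' su]; apply: D; rewrite !ger0_norm.
      rewrite !plane_stepy/= addr0 subr0 htE => E; exists r => //.
      by rewrite !ger0_norm.
    have [|r /andP[r0' rt'']] := @mvt_line R _ rho r2 (x, h x) (uy R) u 0 (ltW tn).
      by move=> r /andP[r0' su]; apply: D; rewrite !ler0_norm ?lerN2// ltW.
    rewrite !plane_stepy/= addr0 sub0r mulrN htE => E; exists r.
      by rewrite !ler0_norm ?lerN2// ltW.
    by rewrite -opprB E opprK.
  have s2e : `|h x + s2 - q| < e.
    rewrite addrAC (le_lt_trans (ler_normD _ _))//.
    have : eta <= e - k by rewrite ge_min lexx orbT.
    by move: hxt hk; rewrite distrC; move: s2t; lra.
  have [_ r2Q] := He' x (h x + s2) xe s2e.
  rewrite [X in `|X - _|](_ : _ = - r1 (x + s, h (x + t)) * (r2 (x, h x + s2))^-1); last first.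
    have : r1 (x + s, h (x + t)) * t + r2 (x, h x + s2) * (h (x + t) - h x) = 0.
      by rewrite -E1 -E2 htr hr; ring.
    move=> E; have r2n : r2 (x, h x + s2) != 0 by rewrite gt_eqF.
    have -> : h (x + t) - h x = - (r1 (x + s, h (x + t)) * t) * (r2 (x, h x + s2))^-1.
      apply: (mulIf r2n); rewrite mulfVK//.
      by apply/eqP; rewrite -subr_eq0 opprK; apply/eqP; rewrite -[RHS]E; ring.
    by field; apply/andP; split.
  rewrite distrC; apply: (Heta0 ((x + s, h (x + t)), (x, h x + s2))).
  have ee : eta <= eta0 by rewrite ge_min lexx.
  rewrite /ball_/=; apply: lt_le_trans ee.
  rewrite -[X in `|X|]/((x - (x + s), h x - h (x + t)), (x - x, h x - (h x + s2))).
  rewrite [`|_|]/(Num.max _ _) gt_max !plane_normE/= !gt_max.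
  rewrite !opprD !addNKr !normrN subrr normr0 eta_0 hxt /=.
  by rewrite (le_lt_trans st)//= (le_lt_trans s2t)// distrC.
exists d, k, h; split=> //.
- by move=> x y xd; rewrite kE => ye; exact: (proj1 (He' x y (dxe x xd) ye)).
- by move=> x y xd; rewrite kE => ye; split; [exact: sgn|exact: sgn'].
have UI x : [set x | `|x - p| < d] x -> [set z | U z /\ 0 < r2 z] (x, h x).
  by move=> xd; apply: He'; [exact: dxe|exact: lt_trans (Hh x xd).1 ke].
elim=> [|n IH]; first by move=> x xd; exact: ch.
split; first by move=> x xd; have [] := Dh x xd.
have UI' x : [set x | `|x - p| < d] x -> U (x, h x) by move=> /UI[].
apply: (@eq_Ck _ _ _ (fun x => (-1) * r1 (x, h x) * (r2 (x, h x))^-1)) => //.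
  by move=> x xd; have [_ ->] := Dh x xd; rewrite mulN1r.
have G1 := Ck_graph oI oU UI' (smooth_on_derive (ux R) srho) IH.
have G2 := Ck_graph oI oU UI' (smooth_on_derive (uy R) srho) IH.
apply: CkM => //; first by apply: CkM => //; exact: Ck_cst.
by apply: CkV => // x /UI[_ r2p]; rewrite gt_eqF.
Unshelve. all: by end_near. Qed.

End implicit_function.

(** * One-dimensional integrals *)

Section ftc.
Context {R : realType}.
Notation mu := (@lebesgue_measure R).

Lemma cont_on_itv_integrable (a b : R) (f : R -> R) :
  cont_on `[a, b] f -> mu.-integrable `[a, b] (EFin \o f).
Proof.
move=> /cont_onP cf; apply: continuous_compact_integrable => //.
exact: segment_compact.
Qed.

Lemma Rintegral_ftc (a b : R) (f F : R -> R) : a < b ->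
  cont_on `[a, b] f -> cont_on `[a, b] F ->
  (forall x, a < x < b -> is_derive x 1 F (f x)) ->
  \int[mu]_(x in `[a, b]) f x = F b - F a.
Proof.
move=> ab /cont_onP cf /cont_onP cF dF.
have dF' x : x \in `]a, b[ -> is_derive x 1 F (f x) by rewrite in_itv/=; exact: dF.
rewrite /Rintegral (@continuous_FTC2 R f F a b ab cf)//.
- move/(continuous_within_itvP F ab) : cF => [_ Fa Fb].
  by split=> // x /dF' [].
- by move=> x /dF'[_]; rewrite derive1E.
Qed.

(** Reflection at [c]: the distance to the upper end becomes the variable. *)
Lemma Rintegral_reflect (c l : R) (f : R -> R) : 0 <= l -> cont_on `[c - l, c] f ->
  \int[mu]_(y in `[c - l, c]) f y = \int[mu]_(s in `[0, l]) f (c - s).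
Proof.
move=> l0 /cont_onP cf.
pose F (s : R) := c - s.
have dF (x : R) : is_derive x (1 : R) F (-1).
  by rewrite /F -[-1]sub0r; apply: is_deriveB.
have F'E : F^`()%classic = cst (-1).
  by apply/funext => x; rewrite derive1E; have [_ ->] := dF x.
have cF : continuous F by move=> x; apply/differentiable_continuous/derivable1_diffP; have [] := dF x.
have E0 : F 0 = c by rewrite /F subr0.
have -> : \int[mu]_(y in `[c - l, c]) f y = \int[mu]_(y in `[F l, F 0]) f y by rewrite E0.
rewrite /Rintegral (@integration_by_substitution_decreasing R F f 0 l l0)//.
- by congr fine; apply: eq_integral => x _; rewrite F'E !fctE /= opprK mulr1.
- by move=> x y _ _ xy; rewrite /F ltrD2l ltrN2.
- by rewrite F'E => x _; exact: cvg_cst.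
- by rewrite F'E; exact: is_cvg_cst.
- by rewrite F'E; exact: is_cvg_cst.
- split; first by move=> x _; have [] := dF x.
    by apply: cvg_at_right_filter; exact: cF.
  by apply: cvg_at_left_filter; exact: cF.
by rewrite E0.
Qed.

End ftc.

(** * Rotation by a right angle *)

Section rotation.
Context {R : realType}.

Definition rot (x : plane R) : plane R := (- x.2, x.1).

Lemma rot_continuous : continuous rot.
Proof.
move=> x; have c1 : {for x, continuous (fun x : plane R => - x.2)}.
  by apply: cvgN; exact: cvg_snd.
have c2 : {for x, continuous (fun x : plane R => x.1)} by exact: cvg_fst.
exact: (cvg_pair c1 c2).
Qed.

Lemma rot4 x : rot (rot (rot (rot x))) = x.
Proof. by case: x => a b; rewrite /rot/= !opprK. Qed.

Lemma rot_linear : linear rot.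
Proof.
move=> c [a b] [a' b']; congr pair => /=.
by rewrite opprD -scalerN.
Qed.

HB.instance Definition _ := GRing.isLinear.Build R (plane R) (plane R) _ rot rot_linear.

Lemma measurable_rot : measurable_fun [set: borel_plane R] (rot : borel_plane R -> borel_plane R).
Proof.
apply/measurable_fun_pairP; split.
  exact: (measurableT_comp (@oppr_measurable R setT) (@measurable_snd _ _ (measurableTypeR R) (measurableTypeR R))).
exact: (@measurable_fst _ _ (measurableTypeR R) (measurableTypeR R)).
Qed.

(** A rotation by a right angle exchanges the sides of a rectangle and reflects one of them,
   and rectangles determine the product measure. *)
Lemma plane_measure_rot (A : set (borel_plane R)) : measurable A ->
  plane_measure (rot @^-1` A) = plane_measure A.
Proof.
move=> mA; apply/esym.
pose m' := pushforward (@plane_measure R) (rot : borel_plane R -> borel_plane R).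
pose M := isMeasurableFun.Build _ _ _ _ _ measurable_rot.
pose J : {mfun borel_plane R >-> borel_plane R} := HB.pack (rot : borel_plane R -> borel_plane R) M.
apply: (@product_measure_unique _ _ _ _ R lebesgue_measure lebesgue_measure
  (pushforward (@plane_measure R) J)) => //.
move=> B C mB mC.
change (plane_measure (rot @^-1` (B `*` C)) = lebesgue_measure B * lebesgue_measure C)%E.
have -> : rot @^-1` (B `*` C) = C `*` (-%R @^-1` B).
  by apply/seteqP; split=> -[a b] /= [].
have mNB : measurable ((-%R : R -> measurableTypeR R) @^-1` B : set (measurableTypeR R)).
  by rewrite -[X in measurable X]setTI; exact: oppr_measurable.
by rewrite /plane_measure product_measure1E// muleC; congr (_ * _)%E; exact: lebesgue_measureN.
Qed.

Let rotm : {mfun borel_plane R >-> borel_plane R} :=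
  HB.pack (rot : borel_plane R -> borel_plane R) (isMeasurableFun.Build _ _ _ _ _ measurable_rot).

Lemma integral_pushforward_rot (f : borel_plane R -> \bar R) :
  (\int[pushforward (@plane_measure R) rotm]_x f x = \int[@plane_measure R]_x f x)%E.
Proof. by apply: eq_measure_integral => B mB _; exact: plane_measure_rot. Qed.

Lemma integral_rot (f : borel_plane R -> \bar R) :
  (@plane_measure R).-integrable setT f ->
  (\int[@plane_measure R]_x f (rot x) = \int[@plane_measure R]_x f x)%E.
Proof.
move=> fi; have mf : measurable_fun setT f by exact: measurable_int fi.
have /integrableP[_ fin] := fi.
have ma : measurable_fun setT (fun x => `|f x|)%E.
  exact: (measurableT_comp (@abse_measurable R setT) mf).
have E := @ge0_integral_pushforward _ _ (borel_plane R) (borel_plane R) R rotm measurable_rot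
  (@plane_measure R) setT (fun x => `|f x|)%E measurableT ma (fun x _ => abse_ge0 (f x)).
have gJ : (@plane_measure R).-integrable (rotm @^-1` setT) (f \o rotm).
  apply/integrableP; split.
    by apply: measurable_funS (measurableT_comp mf measurable_rot).
  by move: E; rewrite integral_pushforward_rot => E; rewrite -[ltLHS]E.
have := @integral_pushforward _ _ (borel_plane R) (borel_plane R) R rotm measurable_rot
  (@plane_measure R) setT f mf gJ measurableT.
by rewrite integral_pushforward_rot preimage_setT => ->.
Qed.

Lemma Rintegral_rot (A : set (plane R)) (g : plane R -> R) :
  measurable (A : set (borel_plane R)) -> (@plane_measure R).-integrable A (EFin \o g) ->
  \int[@plane_measure R]_(x in rot @^-1` A) g (rot x) = \int[@plane_measure R]_(x in A) g x.
Proof.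
move=> mA gi.
have gi' : (@plane_measure R).-integrable setT ((EFin \o g) \_ A).
  by have := gi; rewrite (@integrable_mkcond _ (borel_plane R) R (@plane_measure R) A (EFin \o g)).
have := integral_rot gi' => E.
rewrite /Rintegral [in RHS]integral_mkcond -E [in LHS]integral_mkcond.
congr fine; apply: eq_integral => x _.
Qed.

End rotation.

(** * The divergence theorem below a graph *)

Section C1bar.
Context {R : realType}.
Implicit Types (Omega O : set (plane R)) (f : plane R -> R).

(** Derivatives exist only inside the domain; [f1] and [f2] are the continuous extensions of
   the partial derivatives up to the boundary. *)
Definition C1bar Omega f f1 f2 : Prop :=
  [/\ cont_on (closure Omega) f, cont_on (closure Omega) f1,
      cont_on (closure Omega) f2 &
      forall x, Omega x -> is_derive x (ux R) f (f1 x) /\ is_derive x (uy R) f (f2 x)].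

Lemma is_derive_zero_open {V : normedModType R} (O : set V) (f : V -> R) z w d :
  open O -> (forall y, O y -> f y = 0) -> O z -> is_derive z w f d -> d = 0.
Proof.
move=> oO f0 Oz [_ <-]; have [->|w0] := eqVneq w 0; first exact: derive0.
rewrite (@near_eq_derive _ _ _ f (fun=> 0))//; first exact: derive_cst.
by apply: filterS (open_nbhs_nbhs (conj oO Oz)) => y; exact: f0.
Qed.

Lemma C1bar_zero Omega O f f1 f2 z : C1bar Omega f f1 f2 -> open O ->
  (forall y, O y -> f y = 0) -> O z -> Omega z -> f1 z = 0 /\ f2 z = 0.
Proof.
move=> [_ _ _ D] oO f0 Oz /D[D1 D2]; split.
  exact: is_derive_zero_open oO f0 Oz D1.
exact: is_derive_zero_open oO f0 Oz D2.
Qed.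

Lemma C1bar_continuous Omega f f1 f2 z : open Omega -> C1bar Omega f f1 f2 -> Omega z ->
  {for z, continuous f1} /\ {for z, continuous f2}.
Proof.
move=> oO [_ c1 c2 _] Oz.
have n : nbhs z (closure Omega).
  by apply: filterS (open_nbhs_nbhs (conj oO Oz)); exact: subset_closure.
by split; [exact: cont_on_at c1 n|exact: cont_on_at c2 n].
Qed.

Lemma C1bar_chain Omega f f1 f2 (c1 c2 : R -> R) (s d1 d2 : R) : open Omega ->
  C1bar Omega f f1 f2 -> Omega (c1 s, c2 s) ->
  is_derive s 1 c1 d1 -> is_derive s 1 c2 d2 ->
  is_derive s 1 (fun t => f (c1 t, c2 t)) (f1 (c1 s, c2 s) * d1 + f2 (c1 s, c2 s) * d2).
Proof.
move=> oO Cf Oz D1 D2; have [k1 k2] := C1bar_continuous oO Cf Oz.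
have [_ _ _ D] := Cf.
apply: (@is_derive_chain R f f1 f2 _ c1 c2 s d1 d2) => //.
  by apply: filterS (open_nbhs_nbhs (conj oO Oz)) => y /D[].
by apply: filterS (open_nbhs_nbhs (conj oO Oz)) => y /D[].
Qed.

End C1bar.

Section graph_green.
Context {R : realType}.
Variables (Omega : set (plane R)) (p q d k : R) (h : R -> R).
Notation mu := (@lebesgue_measure R).
Hypotheses (oO : open Omega) (d0 : 0 < d) (k0 : 0 < k).
Hypothesis hOmega : forall x y, `|x - p| < d -> `|y - q| < 4 * k ->
  (Omega (x, y) <-> y < h x).
Hypothesis hq : forall x, `|x - p| < d -> `|h x - q| < k.
Hypothesis dh : forall x, `|x - p| < d -> derivable h x 1.
Hypothesis cdh : forall x, `|x - p| < d -> {for x, continuous ('D_1 h)}.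
Variables (F1 a1 a2 F2 b1 b2 : plane R -> R).
Hypotheses (C1 : C1bar Omega F1 a1 a2) (C2 : C1bar Omega F2 b1 b2).
Let N : set (plane R) := [set z | `|z.1 - p| <= d / 4 /\ `|z.2 - q| <= k].
Hypothesis F1N : forall z, ~ N z -> F1 z = 0.
Hypothesis F2N : forall z, ~ N z -> F2 z = 0.

Let I : set R := `[p - d / 2, p + d / 2]%classic.
Let J : set R := `[q - 3 * k, q + k]%classic.

Let Id (x : R) : I x -> `|x - p| < d.
Proof. by rewrite /I/= in_itv/= => /andP[? ?]; rewrite ltr_norml; move: d0; lra. Qed.

Let below (x s : R) : `|x - p| < d -> 0 < s -> s <= 2 * k -> Omega (x, h x - s).
Proof.
move=> xd s0 sk; have := hq xd => hk.
by apply/hOmega => //; [move: hk; rewrite !ltr_norml; move: k0; lra|rewrite gtrBl].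
Qed.

Let below0 (x s : R) : `|x - p| < d -> 0 <= s -> s <= 2 * k -> closure Omega (x, h x - s).
Proof.
move=> xd; rewrite le_eqVlt => /predU1P[<- _|s0 sk]; last exact/subset_closure/below.
rewrite subr0 => B /nbhs_normP[e /= e0 eB].
pose t := Num.min (e / 2) k.
have t0 : 0 < t by rewrite lt_min k0 divr_gt0.
have te : t <= e / 2 by rewrite ge_min lexx.
have tk : t <= k by rewrite ge_min lexx orbT.
exists (x, h x - t); split; first by apply: below => //; move: tk k0; lra.
apply: eB; rewrite /ball_/= plane_normE/= subrr normr0 opprB addrC subrK gtr0_norm//.
by rewrite gt_max e0; move: te e0; lra.
Qed.

Let closed_N : closed N.
Proof.
have -> : N = `[p - d / 4, p + d / 4]%classic `*` `[q - k, q + k]%classic.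
  by apply/seteqP; split=> -[x y]; rewrite /N/= !in_itv/= !ler_distl => -[? ?]; split.
by apply: compact_closed; [exact: norm_hausdorff|apply: compact_setX; exact: segment_compact].
Qed.

Let D (z : plane R) := a1 z + b2 z.

Let DN z : Omega z -> ~ N z -> D z = 0.
Proof.
move=> Oz Nz; have oN : open (~` N) by rewrite openC; exact: closed_N.
have [e1 _] := C1bar_zero C1 oN F1N Nz Oz.
have [_ e2] := C1bar_zero C2 oN F2N Nz Oz.
by rewrite /D e1 e2 addr0.
Qed.

Let cD : cont_on (closure Omega) D.
Proof. by have [_ c1 _ _] := C1; have [_ _ c2 _] := C2; exact: cont_onD. Qed.

Let inJ (x s : R) : I x -> 0 <= s -> s <= 2 * k -> J (h x - s).
Proof.
move=> /Id/hq; rewrite /J/= in_itv/= ltr_norml => /andP[? ?] ? ?.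
by move: k0; lra.
Qed.

Let inIJ (x y : R) : I x -> J y -> (Omega (x, y) <-> y < h x).
Proof.
move=> Ix; rewrite /J/= in_itv/= => /andP[? ?].
by apply: hOmega; [exact: Id|rewrite ltr_norml; move: k0; lra].
Qed.

Let mO : measurable (Omega : set (borel_plane R)).
Proof. exact: open_measurable_plane. Qed.

Let NR z : N z -> `|z| <= `|p| + d + `|q| + k.
Proof.
case: z => x y [/= xp yq]; rewrite plane_normE/= ge_max.
have := ler_normD (x - p) p; rewrite subrK => h1.
have := ler_normD (y - q) q; rewrite subrK => h2.
by apply/andP; split; move: (normr_ge0 p) (normr_ge0 q) d0 k0 xp yq h1 h2; lra.
Qed.

Lemma graph_integrable : (@plane_measure R).-integrable Omega (EFin \o D).
Proof.
apply: (@cont_on_integrable _ _ (closure Omega) _ (`|p| + d + `|q| + k)) => //.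
- exact: closed_closure.
- exact: subset_closure.
by move=> x Ox xr; apply: DN => // /NR; rewrite leNgt xr.
Qed.

(** The distance below the graph becomes the second coordinate [s]. *)
Let Phi (z : plane R) : plane R := (z.1, h z.1 - z.2).
Let rect : set (plane R) := I `*` `[0, 2 * k]%classic.

Let ch x : `|x - p| < d -> {for x, continuous h}.
Proof. by move=> xd; apply/differentiable_continuous/derivable1_diffP; exact: dh. Qed.

Let cont_fst (g : R -> R) : (forall x, `|x - p| < d -> {for x, continuous g}) ->
  cont_on rect (fun z => g z.1).
Proof.
move=> cg z [Iz _]; apply: cvg_within_filter.
apply: (@continuous_comp _ _ _ fst g z); first exact: cvg_fst.
by apply: cg; exact: Id.
Qed.

Let cPhi : cont_on rect Phi.
Proof.
move=> z Iz; have c1 : cont_on rect (fun z => z.1) by apply: continuous_cont_on => y; exact: cvg_fst.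
have c2 : cont_on rect (fun z => h z.1 - z.2).
  apply: cont_onB; first exact: cont_fst.
  by apply: continuous_cont_on => y; exact: cvg_snd.
exact: (cvg_pair (c1 z Iz) (c2 z Iz)).
Qed.

Let Phi_closure z : rect z -> closure Omega (Phi z).
Proof. by case: z => x s [/= /Id Ix]; rewrite in_itv/= => /andP[? ?]; exact: below0. Qed.

Let cont_Phi (g : plane R -> R) : cont_on (closure Omega) g -> cont_on rect (g \o Phi).
Proof. by move=> cg; apply: cont_on_comp cg; [exact: Phi_closure|exact: cPhi]. Qed.

(** In these coordinates the divergence is [A + B], where [A] is the derivative of [F1] with
   respect to [x], and [B] that of [F1 * h' - F2] with respect to [s]. *)
Let A (z : plane R) := a1 (Phi z) + a2 (Phi z) * 'D_1 h z.1.
Let B (z : plane R) := b2 (Phi z) - a2 (Phi z) * 'D_1 h z.1.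

Let cA : cont_on rect A.
Proof.
have [_ c1 c2 _] := C1.
apply: cont_onD; first exact: cont_Phi.
by apply: cont_onM; [exact: cont_Phi|exact: (cont_fst cdh)].
Qed.

Let cB : cont_on rect B.
Proof.
have [_ _ c1 _] := C1; have [_ _ c2 _] := C2.
apply: cont_onB; first exact: cont_Phi.
by apply: cont_onM; [exact: cont_Phi|exact: (cont_fst cdh)].
Qed.

Let crect : compact rect.
Proof. by apply: compact_setX; exact: segment_compact. Qed.

Let mrect : measurable (rect : set (borel_plane R)).
Proof. by apply: closed_measurable_plane; apply: compact_closed => //; exact: norm_hausdorff. Qed.

Let rect_integrable (g : plane R -> R) : cont_on rect g -> (@plane_measure R).-integrable rect (EFin \o g).
Proof.
move=> cg; have [M [_ HM]] := compact_bounded crect.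
apply: (@cont_on_integrable _ rect rect g (M + 1)) => //.
  by apply: compact_closed => //; exact: norm_hausdorff.
move=> z rz; have := HM (M + 1); rewrite ltrDl ltr01 => /(_ isT z rz) /=.
by move=> zM; rewrite ltNge zM.
Qed.

Let slice1 (g : plane R -> R) (x : R) : cont_on rect g -> I x -> cont_on `[0, 2 * k] (fun s => g (x, s)).
Proof.
move=> cg Ix; apply: (@cont_on_comp _ _ _ _ rect (fun s => (x, s)) g) => //.
move=> s _; apply: cvg_within_filter.
have cx : {for s, continuous (fun y : R => y)} by exact: cvg_id.
exact: (cvg_pair (cvg_cst _) cx).
Qed.

Let slice2 (g : plane R -> R) (s : R) : cont_on rect g -> `[0, 2 * k]%classic s -> cont_on I (fun x => g (x, s)).
Proof.
move=> cg Ix; apply: (@cont_on_comp _ _ _ _ rect (fun x => (x, s)) g) => //.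
move=> x _; apply: cvg_within_filter.
have cx : {for x, continuous (fun y : R => y)} by exact: cvg_id.
exact: (cvg_pair cx (cvg_cst _)).
Qed.

Let pIlt : p - d / 2 < p + d / 2. Proof. by move: d0; lra. Qed.
Let k2 : 0 < 2 * k. Proof. by move: k0; lra. Qed.

Let endI (x y : R) : x = p - d / 2 \/ x = p + d / 2 -> ~ N (x, y).
Proof. by move=> xE [/= + _]; rewrite ler_distl; case: xE => ->; move: d0; lra. Qed.

Let mI : measurable (I : set (measurableTypeR R)).
Proof. exact: measurable_itv. Qed.

Let mK : measurable (`[0, 2 * k]%classic : set (measurableTypeR R)).
Proof. exact: measurable_itv. Qed.

Let A0 : \int[@plane_measure R]_(z in rect) A z = 0.
Proof.
have si x : I x -> mu.-integrable `[0, 2 * k] (fun s => (A (x, s))%:E).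
  by move=> Ix; apply: cont_on_itv_integrable; exact: slice1.
(* the slice [s = 0] is the boundary, where no derivative is available *)
have mK' : measurable (`]0, (2 * k)] : set (measurableTypeR R)) by exact: measurable_itv.
have sub : I `*` `]0, (2 * k)]%classic `<=` rect.
  by move=> [x s] [/= Ix]; rewrite !in_itv/= => /andP[s0 sk]; split=> //; apply/andP; split=> //; exact: ltW.
have iA : (@plane_measure R).-integrable (I `*` `]0, (2 * k)]) (EFin \o A).
  apply: (integrableS mrect _ sub (rect_integrable cA)).
  exact: (measurableX mI mK').
rewrite (Rintegral_prod1 mI mK (rect_integrable cA) si).
transitivity (\int[mu]_(x in I) \int[mu]_(s in `]0, (2 * k)]) A (x, s)).
  apply: eq_Rintegral => x /set_mem Ix; rewrite -Rintegral_itv_obnd_cbnd//.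
  by apply: integrableS (si x Ix) => //; exact: subset_itv_oc_cc.
rewrite -(@Rintegral_prod1 _ _ _ _ R mu mu I `]0, (2 * k)]%classic A)//; last first.
  by move=> x Ix; apply: integrableS (si x Ix) => //; exact: subset_itv_oc_cc.
rewrite (@Rintegral_prod2 _ _ _ _ R mu mu I `]0, (2 * k)]%classic A)//; last first.
  move=> s; rewrite /= in_itv/= => /andP[s0 sk]; apply: cont_on_itv_integrable.
  by apply: slice2 => //; rewrite /= in_itv/=; apply/andP; split=> //; exact: ltW.
rewrite (@eq_Rintegral _ _ _ mu _ (fun=> 0)); first by rewrite Rintegral_cst// mul0r.
move=> s /set_mem; rewrite /= in_itv/= => /andP[s0 sk].
have s01 : `[0, 2 * k]%classic s by rewrite /= in_itv/=; apply/andP; split=> //; exact: ltW.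
have [cF _ _ _] := C1.
have -> : 0 = F1 (p + d / 2, h (p + d / 2) - s) - F1 (p - d / 2, h (p - d / 2) - s).
  by rewrite !F1N ?subr0//; apply: endI; [left|right].
apply: (@Rintegral_ftc R _ _ (fun x => A (x, s)) (fun x => F1 (x, h x - s)) pIlt).
- exact: slice2 cA _.
- by have := slice2 (cont_Phi cF) s01.
move=> x xI; have xd : `|x - p| < d.
  by apply: Id; rewrite /I/= in_itv/=; case/andP: xI => ? ?; apply/andP; split; exact: ltW.
rewrite /A/= -[X in X + _]mulr1.
apply: (@C1bar_chain _ Omega F1 a1 a2 id (fun x => h x - s)) => //.
  exact: below.
rewrite -['D_1 h x]subr0; apply: is_deriveB.
by apply: derivableP; exact: dh.
Qed.

Let B0 : \int[@plane_measure R]_(z in rect) B z =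
  \int[mu]_(x in I) (F1 (x, h x) * - 'D_1 h x + F2 (x, h x) * 1).
Proof.
rewrite (Rintegral_prod1 mI mK (rect_integrable cB)); last first.
  by move=> x Ix; apply: cont_on_itv_integrable; exact: slice1.
apply: eq_Rintegral => x /set_mem Ix.
have [cF1 _ _ _] := C1; have [cF2 _ _ _] := C2; have xd := Id Ix.
pose G s := F1 (x, h x - s) * 'D_1 h x - F2 (x, h x - s).
transitivity (G (2 * k) - G 0); last first.
  have Nk : ~ N (x, h x - 2 * k).
    move=> [_ /=]; have := hq xd; rewrite ltr_norml ler_distl; move: k0; lra.
  by rewrite /G (F1N Nk) (F2N Nk) !subr0; ring.
apply: (@Rintegral_ftc R _ _ (fun s => B (x, s)) G k2).
- exact: slice1 cB _.
- apply: cont_onB.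
    apply: cont_onM; last exact: cont_on_cst.
    by have := slice1 (cont_Phi cF1) Ix.
  by have := slice1 (cont_Phi cF2) Ix.
move=> s /andP[s0 sk].
have OP : Omega (x, h x - s) by apply: below => //; exact: ltW.
have Ds : is_derive s 1 (fun s => h x - s) (-1).
  by rewrite -[-1]sub0r; apply: is_deriveB.
have E1 := C1bar_chain oO C1 (c1 := fun=> x) (c2 := fun s => h x - s) OP (is_derive_cst _ _ _) Ds.
have E2 := C1bar_chain oO C2 (c1 := fun=> x) (c2 := fun s => h x - s) OP (is_derive_cst _ _ _) Ds.
have H := is_deriveB (is_deriveM E1 (is_derive_cst ('D_1 h x) s (1:R))) E2.
apply: (@is_derive_eq _ _ _ _ _ _ _ _ H); rewrite /B/= -![_ *: _]/(_ * _); ring.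
Qed.

(** [A] integrates to 0 because [F1] vanishes at both ends of [I]; the integral of [B] in [s]
   leaves the value at [s = 0], as the lower end is off the support. *)
Lemma graph_green :
  \int[@plane_measure R]_(z in Omega) (a1 z + b2 z) =
  \int[mu]_(x in I) (F1 (x, h x) * - 'D_1 h x + F2 (x, h x) * 1).
Proof.
have mJ : measurable (J : set (measurableTypeR R)) by exact: measurable_itv.
transitivity (\int[@plane_measure R]_(z in Omega `&` (I `*` J)) D z).
  apply: (@Rintegral_support _ _ _ (@plane_measure R) Omega (I `*` J) D).
  move=> [x y] Oz nIJ; apply: DN => // -[/= xp yq]; apply: nIJ; split=> /=.
    by rewrite /I/= in_itv/=; move: xp; rewrite ler_distl => /andP[? ?]; move: d0; lra.
  by rewrite /J/= in_itv/=; move: yq; rewrite ler_distl => /andP[? ?]; move: k0; lra.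
have iD : (@plane_measure R).-integrable (Omega `&` (I `*` J)) (EFin \o D).
  apply: (integrableS mO _ (@subIsetl _ _ _) graph_integrable).
  exact: (measurableI _ _ mO (measurableX mI mJ)).
have cx x : I x -> cont_on `[h x - 2 * k, h x] (fun y => D (x, y)).
  move=> Ix; apply: (@cont_on_comp _ _ _ _ (closure Omega) (fun y => (x, y)) D) => //.
    move=> y; rewrite /= in_itv/= => /andP[y1 y2].
    have := @below0 x (h x - y) (Id Ix).
    by rewrite subr_ge0 y2 subKr => /(_ isT); apply; move: y1; lra.
  move=> y _; apply: cvg_within_filter.
  have cy : {for y, continuous (fun y : R => y)} by exact: cvg_id.
  exact: (cvg_pair (cvg_cst _) cy).
(* in a vertical slice only the part within distance 2k of the graph matters *)
have slab x y : I x -> J y -> ~ `[h x - 2 * k, h x[%classic y -> (D \_ Omega) (x, y) = 0.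
  move=> Ix Jy ny; rewrite patchE; case: ifPn => // /set_mem Oz.
  apply: DN => // -[/= _]; rewrite ler_distl => /andP[y1 y2].
  apply: ny; rewrite /= in_itv/=; move: Oz => /(inIJ Ix Jy) ->; rewrite andbT.
  by have := hq (Id Ix); rewrite ltr_norml; move: y1; lra.
have slabJ x y : I x -> `[h x - 2 * k, h x[%classic y -> J y /\ (D \_ Omega) (x, y) = D (x, y).
  move=> Ix; rewrite /= in_itv/= => /andP[y1 y2].
  have Jy : J y.
    have := @inJ x (h x - y) Ix; rewrite subKr; apply; first by rewrite subr_ge0 ltW.
    by move: y1; lra.
  split=> //; rewrite patchE mem_set//; exact/(inIJ Ix Jy).
have JE x : I x -> J `&` `[h x - 2 * k, h x[%classic = `[h x - 2 * k, h x[%classic.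
  by move=> Ix; apply: setIidr => y /(slabJ x y Ix)[].
have ir : (@plane_measure R).-integrable (I `*` J) (EFin \o (D \_ Omega)).
  have := iD; rewrite -restrict_EFin setIC => /integrable_restrict; apply => //.
  exact: measurableX.
have sl x : I x -> mu.-integrable `[h x - 2 * k, h x[ (fun y => (D (x, y))%:E).
  move=> Ix; apply: integrableS (cont_on_itv_integrable (cx x Ix)); try exact: measurable_itv.
  exact: subset_itv_co_cc.
rewrite setIC Rintegral_mkcondr.
rewrite (Rintegral_prod1 mI mJ ir); last first.
  move=> x Ix.
  have : mu.-integrable (J `&` `[h x - 2 * k, h x[%classic) (fun y => (D (x, y))%:E).
    by rewrite JE//; exact: sl.
  move=> /(integrable_restrict mu (measurable_itv _) mJ); apply: eq_integrable => // y /set_mem Jy.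
  rewrite patchE; case: ifPn => [/set_mem/(slabJ x y Ix)[_ ->]//|/negP ny].
  by rewrite slab// => /mem_set.
transitivity (\int[mu]_(x in I) \int[mu]_(s in `[0, 2 * k]) (A (x, s) + B (x, s))).
  apply: eq_Rintegral => x /set_mem Ix.
  rewrite (@Rintegral_support _ _ _ mu J `[h x - 2 * k, h x[%classic (fun y => (D \_ Omega) (x, y))); last first.
    by move=> y Jy; exact: slab.
  rewrite JE// (@eq_Rintegral _ _ _ mu _ (fun y => D (x, y))); last first.
    by move=> y /set_mem/(slabJ x y Ix)[_ ->].
  rewrite Rintegral_itv_bndo_bndc; last exact: sl.
  rewrite Rintegral_reflect; [|exact: ltW|exact: cx].
  by apply: eq_Rintegral => s _; rewrite /A /B /D/=; ring.
have cAB := cont_onD cA cB.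
rewrite -(@Rintegral_prod1 _ _ _ _ R mu mu I `[0, 2 * k]%classic (fun z => A z + B z))//; last 2 first.
- exact: (rect_integrable cAB).
- by move=> x Ix; apply: cont_on_itv_integrable; exact: slice1 cAB _.
rewrite -/rect -[LHS]/(\int[@plane_measure R]_(z in rect) (A z + B z)) RintegralD//.
- by rewrite A0 B0 add0r.
- exact: rect_integrable.
- exact: rect_integrable.
Qed.

End graph_green.

(** * Integrals along arcs of the boundary *)

Section enorm.
Context {R : realType}.
Implicit Types x : plane R.

Lemma enorm_ge0 x : 0 <= enorm x.
Proof. exact: sqrtr_ge0. Qed.

Lemma sqr_enorm x : enorm x ^+ 2 = x.1 ^+ 2 + x.2 ^+ 2.
Proof. by rewrite sqr_sqrtr// addr_ge0// sqr_ge0. Qed.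

Lemma enorm_gt0 x : x <> 0 -> 0 < enorm x.
Proof.
move=> x0; rewrite lt_neqAle enorm_ge0 andbT; apply/eqP => /esym E; apply: x0.
have := sqr_enorm x; rewrite E expr0n/= => /esym/eqP.
rewrite paddr_eq0 ?sqr_ge0// !sqrf_eq0 => /andP[/eqP h1 /eqP h2].
by case: x h1 h2 {E} => a b /= -> ->.
Qed.

Lemma enorm_rot x : enorm (rot x) = enorm x.
Proof. by rewrite /enorm /rot/= sqrrN addrC. Qed.

Lemma enormZ (c : R) x : 0 <= c -> enorm (c *: x) = c * enorm x.
Proof.
move=> c0; rewrite /enorm -[(c *: x).1]/(c * x.1) -[(c *: x).2]/(c * x.2).
by rewrite !exprMn -mulrDr sqrtrM ?sqr_ge0// sqrtr_sqr ger0_norm.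
Qed.

Lemma enorm_continuous : continuous (@enorm R).
Proof.
move=> x; apply: (@continuous_comp _ _ _ (fun x : plane R => x.1 ^+ 2 + x.2 ^+ 2) Num.sqrt).
  apply: cvgD; rewrite ?expr2.
    by apply: cvgM; exact: cvg_fst.
  by apply: cvgM; exact: cvg_snd.
exact: sqrt_continuous.
Qed.

Lemma norm_le_enorm x : `|x| <= enorm x.
Proof.
rewrite plane_normE ge_max -!(sqrtr_sqr) /enorm.
by apply/andP; split; apply: ler_wsqrtr; rewrite ?lerDl ?lerDr sqr_ge0.
Qed.

Lemma enorm_le_norm x : enorm x <= 2 * `|x|.
Proof.
have h1 : `|x.1| <= `|x| by rewrite plane_normE le_max lexx.
have h2 : `|x.2| <= `|x| by rewrite plane_normE le_max lexx orbT.
have h0 : 0 <= 2 * `|x| by rewrite mulr_ge0.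
rewrite -[leRHS]ger0_norm// -sqrtr_sqr; apply: ler_wsqrtr.
rewrite -[x.1 ^+ 2]real_normK ?num_real// -[x.2 ^+ 2]real_normK ?num_real//.
move: (normr_ge0 x.1) (normr_ge0 x.2) h1 h2; nra.
Qed.

End enorm.

Section arc_integral.
Context {R : realType}.
Notation mu := (@lebesgue_measure R).
Variables (Omega : set (plane R)) (sigma : {measure set (borel_plane R) -> \bar R}).
Hypothesis hsigma : surface_measure Omega sigma.
Variables (gamma : R -> plane R) (a b : R) (U : set R).
Hypotheses (ab : a <= b) (oU : open U) (abU : `[a, b] `<=` U)
  (sgamma : smooth_on U gamma) (igamma : {in `[a, b]%classic &, injective gamma})
  (rgamma : forall s, `[a, b]%classic s -> 'D_1 gamma s <> 0)
  (fgamma : gamma @` `[a, b] `<=` frontier Omega).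

Let w (s : R) := enorm ('D_1 gamma s).

Lemma arc_speed_continuous : cont_on `[a, b] w.
Proof.
move=> s sab; apply: cvg_within_filter.
apply: (@continuous_comp _ _ _ ('D_1 gamma) (@enorm R) s); last exact: enorm_continuous.
apply: smooth_on_continuous (abU sab); exact: smooth_on_derive.
Qed.

Let sub (c d : R) : a <= c -> d <= b -> `[c, d] `<=` `[a, b].
Proof.
move=> ac db s; rewrite /= !in_itv/= => /andP[cs sd].
by rewrite (le_trans ac cs) (le_trans sd db).
Qed.

Lemma arc_length (c d : R) : a <= c -> c <= d -> d <= b ->
  sigma (gamma @` `[c, d]) = (\int[mu]_(s in `[c, d]) w s)%:E.
Proof.
move=> ac cd db; have S := sub ac db; have [_ H] := hsigma.
rewrite (H gamma c d U)//; first last.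
- by apply: subset_trans fgamma; exact: image_subset.
- by move=> s /S; exact: rgamma.
- by move=> x y /set_mem/S/mem_set xs /set_mem/S/mem_set ys; exact: igamma.
- exact: subset_trans abU.
rewrite /Rintegral fineK//; apply: integrable_fin_num => //.
by apply: cont_on_itv_integrable; exact: cont_onS arc_speed_continuous.
Qed.

Let cgamma : cont_on `[a, b] gamma.
Proof. by move=> s sab; apply: cvg_within_filter; exact: smooth_on_continuous sgamma (abU sab). Qed.

Lemma arc_measurable (K : set R) : K `<=` `[a, b] -> compact K ->
  measurable (gamma @` K : set (borel_plane R)).
Proof.
move=> Kab cK; apply: closed_measurable_plane; apply: compact_closed; first exact: norm_hausdorff.
by apply: continuous_compact => //; apply/cont_onP; exact: cont_onS cgamma.
Qed.

Variables (f : plane R -> R) (g : R -> R).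
Hypotheses (cg : cont_on `[a, b] g) (fg : forall s, `[a, b]%classic s -> f (gamma s) = g s).

Let arc_fun_measurable : measurable_fun (gamma @` `[a, b] : set (borel_plane R)) f.
Proof.
apply: (measurability _ (RGenCInfty.measurableE R)) => _ [_ [x ->] <-].
have [W [oW WE]] := cont_on_open cg (@open_lt R x).
have -> : gamma @` `[a, b] `&` f @^-1` `[x, +oo[ = gamma @` (`[a, b] `\` W).
  apply/seteqP; split=> [_ [[s sab <-]]|_ [s [sab nW] <-]].
    rewrite /= in_itv/= andbT fg// => xs; exists s => //; split=> // Ws.
    have : (`[a, b] `&` W) s by split.
    by rewrite -WE => -[_ /=]; rewrite ltNge xs.
  split; first by exists s.
  rewrite /= in_itv/= andbT fg// leNgt; apply/negP => sx; apply: nW.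
  have : (`[a, b] `&` g @^-1` [set y | y < x]) s by split.
  by rewrite WE => -[].
apply: arc_measurable; first exact: subDsetl.
apply: (subclosed_compact _ (@segment_compact _ a b)); last exact: subDsetl.
by apply: closedI; [exact: interval_closed|exact: open_closedC].
Qed.

Let M := sval (cid (cont_on_bounded (@segment_compact _ a b) arc_speed_continuous)).
Let wM s : `[a, b]%classic s -> w s <= M.
Proof.
move=> sab; have := svalP (cid (cont_on_bounded (@segment_compact _ a b) arc_speed_continuous)) s sab.
exact: le_trans (ler_norm _).
Qed.

Let M0 : 0 <= M.
Proof.
have aab : `[a, b]%classic a by rewrite /= in_itv/= lexx.
by apply: le_trans (wM aab); exact: enorm_ge0.
Qed.

Let marc (c d : R) : a <= c -> d <= b -> measurable (gamma @` `[c, d] : set (borel_plane R)).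
Proof. by move=> ac db; apply: arc_measurable; [exact: sub|exact: segment_compact]. Qed.

Lemma arc_integrable : sigma.-integrable (gamma @` `[a, b]) (EFin \o f).
Proof.
have [N HN] := cont_on_bounded (@segment_compact _ a b) cg.
apply: (@integrable_bounded _ (borel_plane R) R sigma (gamma @` `[a, b]) f N) => //.
- exact: marc.
- by rewrite arc_length// ltry.
by move=> _ [s sab <-]; rewrite fg//; exact: HN.
Qed.

Let wi (c d : R) : a <= c -> d <= b -> mu.-integrable `[c, d] (EFin \o w).
Proof.
move=> ac db; apply: cont_on_itv_integrable.
by apply: cont_onS arc_speed_continuous; exact: sub.
Qed.

Let length_le (c d : R) : a <= c -> c <= d -> d <= b -> \int[mu]_(s in `[c, d]) w s <= M * (d - c).
Proof.
move=> ac cd db.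
have -> : M * (d - c) = \int[mu]_(s in `[c, d]) M.
  rewrite Rintegral_cst//= lebesgue_measure_itv/=; congr (_ * _).
  by rewrite lte_fin; case: ltP => // dc; rewrite (le_anti (_ : c <= d <= c)) ?subrr// cd.
apply: le_Rintegral => //; first exact: wi.
  by apply: cont_on_itv_integrable; exact: cont_on_cst.
by move=> s /(sub ac db); exact: wM.
Qed.

(** Half-open arcs add up without overlap. *)
Let oarc (c d : R) := gamma @` `]c, d].

Let oarcE (c d : R) : a <= c -> c <= d -> d <= b -> oarc c d = gamma @` `[c, d] `\` gamma @` `[c, c].
Proof.
move=> ac cd db; have S := sub ac db.
have cab : `[a, b]%classic c by apply: S; rewrite /= in_itv/= lexx.
apply/seteqP; split=> [_ [s scd <-]|_ [[s scd <-] ns]].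
  have scd' : `[c, d]%classic s by exact: subset_itv_oc_cc.
  split; first by exists s.
  move=> [r rc E]; move: rc; rewrite /= in_itv/= => /le_anti E'.
  have sc := igamma (mem_set (S _ scd')) (mem_set cab).
  by move: scd; rewrite /= in_itv/= sc ?ltxx// -E E'.
exists s => //; move: scd; rewrite /= !in_itv/= => /andP[cs ->]; rewrite andbT.
rewrite lt_neqAle cs andbT; apply/eqP => E; apply: ns; exists s => //.
by rewrite E /= in_itv/= lexx.
Qed.

Let moarc (c d : R) : a <= c -> c <= d -> d <= b -> measurable (oarc c d : set (borel_plane R)).
Proof.
move=> ac cd db; rewrite oarcE//; apply: measurableD; apply: marc => //.
exact: le_trans db.
Qed.

Let point0 (c : R) : a <= c -> c <= b -> sigma (gamma @` `[c, c]) = 0%E.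
Proof. by move=> ac cb; rewrite arc_length// set_itv1 Rintegral_set1. Qed.

Let oarc_length (c d : R) : a <= c -> c <= d -> d <= b ->
  sigma (oarc c d) = (\int[mu]_(s in `[c, d]) w s)%:E.
Proof.
move=> ac cd db; have cb := le_trans cd db; rewrite oarcE//.
have fin : (sigma (gamma @` `[c, d]) < +oo)%E by rewrite arc_length// ltry.
rewrite (measureD (marc ac db) (marc ac cb) fin) setIidr.
  by rewrite [X in (_ - X)%E]point0// sube0; exact: arc_length.
apply: image_subset => s; rewrite /= !in_itv/= => /le_anti <-.
by rewrite lexx.
Qed.

(** Both integrals over a short arc are nearly a value of [g] times its length; hence their
   difference [H], as a function of the end point, has derivative 0. *)
Let H (c : R) := \int[sigma]_(z in oarc a c) f z - \int[mu]_(s in `[a, c]) (g s * w s).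

Let cgw : cont_on `[a, b] (fun s => g s * w s).
Proof. exact: cont_onM cg arc_speed_continuous. Qed.

Let oarc_integrable (c d : R) : a <= c -> c <= d -> d <= b -> sigma.-integrable (oarc c d) (EFin \o f).
Proof.
move=> ac cd db; apply: integrableS arc_integrable; [exact: marc|exact: moarc|].
by apply: image_subset; apply: subset_trans (sub ac db); exact: subset_itv_oc_cc.
Qed.

Let gwi (c d : R) : a <= c -> d <= b -> mu.-integrable `[c, d] (EFin \o (fun s => g s * w s)).
Proof. by move=> ac db; apply: cont_on_itv_integrable; apply: cont_onS cgw; exact: sub. Qed.

Let H_incr (c d r e : R) : a <= c -> c <= d -> d <= b ->
  (forall s, `[c, d]%classic s -> `|g s - r| <= e) -> `|H d - H c| <= 2 * e * M * (d - c).
Proof.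
move=> ac cd db gr; have ad := le_trans ac cd; have cb := le_trans cd db.
have S := sub ac db.
have e0 : 0 <= e.
  apply: le_trans (gr c _); first exact: normr_ge0.
  by rewrite /= in_itv/= lexx.
have E1 : \int[sigma]_(z in oarc a d) f z =
    \int[sigma]_(z in oarc a c) f z + \int[sigma]_(z in oarc c d) f z.
  have -> : oarc a d = oarc a c `|` oarc c d.
    rewrite /oarc -image_setU; congr (_ @` _).
    by apply/seteqP; split=> s; rewrite /= !in_itv/=; [case: (leP s c) => h; [left|right]|case];
      move=> *; lra.
  rewrite Rintegral_setU//.
  - exact: moarc.
  - exact: moarc.
  - have -> : oarc a c `|` oarc c d = oarc a d.
      rewrite /oarc -image_setU; congr (_ @` _).
      by apply/seteqP; split=> s; rewrite /= !in_itv/=; [case|case: (leP s c) => h; [left|right]];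
        move=> *; lra.
    exact: oarc_integrable.
  apply/disj_setPS => z [[s sac <-]] [t tcd E].
  move: sac tcd; rewrite /= !in_itv/= => /andP[as_ sc] /andP[ct td].
  have st : t = s.
    by apply: igamma => //; apply/mem_set; rewrite /= in_itv/=; apply/andP; split; lra.
  by move: ct; rewrite st ltNge sc.
have E2 : \int[mu]_(s in `[a, d]) (g s * w s) =
    \int[mu]_(s in `[a, c]) (g s * w s) + \int[mu]_(s in `[c, d]) (g s * w s).
  have := @Rintegral_itvB R (fun s => g s * w s) (BLeft a) (BRight d) c (gwi (lexx _) db).
  rewrite !bnd_simp => /(_ ac cd); rewrite Rintegral_itv_obnd_cbnd//; last first.
    by apply: integrableS (gwi ac db) => //; exact: subset_itv_oc_cc.
  by move=> <-; rewrite addrC subrK.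
pose L := \int[mu]_(s in `[c, d]) w s.
have L0 : 0 <= L by apply: Rintegral_ge0 => s _; exact: enorm_ge0.
have LM : L <= M * (d - c) by exact: length_le.
have LE : L = fine (sigma (oarc c d)) by rewrite oarc_length.
have mo := moarc ac cd db.
have fin : (sigma (oarc c d) < +oo)%E by rewrite oarc_length// ltry.
have ci (x : R) : sigma.-integrable (oarc c d) (EFin \o (fun=> x)).
  exact: (@integrable_bounded _ (borel_plane R) R sigma (oarc c d) (fun=> x) `|x|).
have B1 : `|\int[sigma]_(z in oarc c d) f z - r * L| <= e * L.
  have -> : \int[sigma]_(z in oarc c d) f z - r * L = \int[sigma]_(z in oarc c d) (f z - r).
    by rewrite RintegralB// ?Rintegral_cst ?LE//; exact: oarc_integrable.
  have fri : sigma.-integrable (oarc c d) (EFin \o (fun z => f z - r)).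
    by have := integrableB mo (oarc_integrable ac cd db) (ci r).
  apply: le_trans (le_normr_Rintegral mo fri) _.
  have -> : e * L = \int[sigma]_(z in oarc c d) e by rewrite Rintegral_cst// LE.
  apply: le_Rintegral => //.
    by have := integrable_norm fri.
  move=> _ [s scd <-]; have scd' : `[c, d]%classic s by exact: subset_itv_oc_cc.
  by rewrite fg; [exact: gr|exact: S].
have B2 : `|\int[mu]_(s in `[c, d]) (g s * w s) - r * L| <= e * L.
  have i1 := gwi ac db; have i2 := wi ac db.
  have mI : measurable (`[c, d]%classic : set (measurableTypeR R)) by exact: measurable_itv.
  have cr : cont_on `[c, d] (fun s => (g s - r) * w s).
    apply: cont_onM; last exact: cont_onS arc_speed_continuous.
    by apply: cont_onB; [exact: cont_onS cg|exact: cont_on_cst].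
  have -> : \int[mu]_(s in `[c, d]) (g s * w s) - r * L = \int[mu]_(s in `[c, d]) ((g s - r) * w s).
    rewrite /L -RintegralZl// -RintegralB//; last first.
      by have := integrableZl mI r i2.
    by apply: eq_Rintegral => s _; rewrite mulrBl.
  have i3 := cont_on_itv_integrable cr.
  apply: le_trans (le_normr_Rintegral mI i3) _.
  rewrite /L -RintegralZl//; apply: le_Rintegral => //.
  - by have := integrable_norm i3.
  - by have := integrableZl mI e i2.
  move=> s scd; rewrite normrM [`|w s|]ger0_norm ?enorm_ge0//.
  by rewrite ler_wpM2r ?enorm_ge0//; exact: gr.
rewrite /H E1 E2 [X in `|X|](_ : _ = (\int[sigma]_(z in oarc c d) f z - r * L) -
   (\int[mu]_(s in `[c, d]) (g s * w s) - r * L)); last by ring.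
apply: le_trans (ler_normB _ _) _; apply: le_trans (lerD B1 B2) _.
have : e * L <= e * (M * (d - c)) by rewrite ler_wpM2l.
by lra.
Qed.

Lemma arc_integral :
  \int[sigma]_(z in gamma @` `[a, b]) f z = \int[mu]_(s in `[a, b]) (g s * enorm ('D_1 gamma s)).
Proof.
have [G HG] := cont_on_bounded (@segment_compact _ a b) cg.
have Ha : H a = 0.
  rewrite /H set_itv1 Rintegral_set1 subr0 /oarc.
  have -> : `]a, a]%classic = set0 :> set R by rewrite set_itv_ge// bnd_simp ltxx.
  by rewrite image_set0 Rintegral_set0.
have Lip (c d : R) : a <= c -> c <= d -> d <= b -> `|H d - H c| <= 2 * G * M * (d - c).
  move=> ac cd db; apply: (@H_incr c d 0 G) => // s /(sub ac db) sab.
  by rewrite subr0; exact: HG.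
have aab : `[a, b]%classic a by rewrite /= in_itv/= lexx.
have G0 : 0 <= G by apply: le_trans (HG a aab).
have Hb : H b = 0.
  have [||c _] := @MVT_segment R H (fun=> 0) a b ab; last first.
  - by rewrite mul0r Ha subr0.
  - apply/cont_onP => c cab; apply/cvgrPdist_le => e e0; rewrite /within/=.
    have C0 : 0 < 2 * G * M + 1 by rewrite ltr_wpDl// !mulr_ge0.
    apply/nbhs_normP; exists (e / (2 * G * M + 1)); first by rewrite /= divr_gt0.
    move=> d /=; rewrite ltr_pdivlMr// => cde dab.
    move: cab dab; rewrite /= !in_itv/= => /andP[ac cb] /andP[ad db].
    apply: le_trans (ltW cde); rewrite mulrC.
    apply: (@le_trans _ _ (2 * G * M * `|c - d|)); last by rewrite ler_wpM2r// lerDl.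
    have [cd|dc] := leP c d; first by rewrite distrC [`|c - d|]distrC (ger0_norm (x := d - c)) ?subr_ge0//; exact: Lip.
    by rewrite (gtr0_norm (x := c - d)) ?subr_gt0//; apply: Lip => //; exact: ltW.
  move=> c; rewrite in_itv/= => /andP[ac cb].
  apply: is_derive_eps => e e0.
  have C0 : 0 < 2 * M + 1 by rewrite ltr_wpDl// mulr_ge0.
  have cab : nbhs c `[a, b]%classic.
    by apply: filterS (near_in_itvoo _); [exact: subset_itv_oo_cc|rewrite in_itv/= ac].
  have gc : {for c, continuous g} by exact: cont_on_at cg cab.
  have e20 : 0 < e / (2 * M + 1) by rewrite divr_gt0.
  have n1 := @cvgr_dist_le _ _ _ _ _ _ _ gc _ e20.
  have : \forall y \near c, `[a, b]%classic y /\ `|g c - g y| <= e / (2 * M + 1).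
    by near=> y; split; [near: y|near: y; exact: n1].
  move=> /nbhs_normP[d /= d0 Hd]; exists d => // t t0 td.
  have near_c s : `|s - c| <= `|t| -> `[a, b]%classic s /\ `|g s - g c| <= e / (2 * M + 1).
    move=> st; have [] := Hd s; last by rewrite distrC.
    by rewrite /ball_/= distrC (le_lt_trans st).
  rewrite subr0 normrM normfV ltr_pdivrMr ?normr_gt0//.
  have lt1 : 2 * (e / (2 * M + 1)) * M * `|t| < e * `|t|.
    rewrite ltr_pM2r ?normr_gt0//.
    rewrite [ltLHS](_ : _ = e * (2 * M / (2 * M + 1))); last by ring.
    by rewrite gtr_pMr// ltr_pdivrMr// mul1r ltrDl.
  apply: le_lt_trans lt1.
  have [ct_ab _] : `[a, b]%classic (c + t) /\ `|g (c + t) - g c| <= e / (2 * M + 1).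
    by apply: near_c; rewrite addrAC subrr add0r.
  move: ct_ab; rewrite /= in_itv/= => /andP[act ctb].
  have [t1|t1] := ltP 0 t.
    have -> : `|t| = c + t - c by rewrite addrAC subrr add0r gtr0_norm.
    apply: H_incr => //; [exact: ltW|by rewrite lerDl ltW|].
    move=> s; rewrite /= in_itv/= => /andP[cs st]; apply: (proj2 (near_c s _)).
    by rewrite ger0_norm ?subr_ge0// (gtr0_norm t1); lra.
  have -> : `|t| = c - (c + t) by rewrite opprD addNKr ler0_norm.
  rewrite distrC; apply: H_incr => //; [by rewrite gerDl|exact: ltW|].
  move=> s; rewrite /= in_itv/= => /andP[cs st]; apply: (proj2 (near_c s _)).
  by rewrite ler0_norm ?subr_le0// (ler0_norm t1); lra.
have : \int[sigma]_(z in oarc a b) f z = \int[mu]_(s in `[a, b]) (g s * w s).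
  by apply/eqP; rewrite -subr_eq0; apply/eqP.
rewrite -/(w _) => <-.
have E : gamma @` `[a, b] = oarc a b `|` gamma @` `[a, a].
  rewrite oarcE// setUC setDUK//; apply: image_subset => s.
  by rewrite /= !in_itv/= => /le_anti <-; rewrite lexx.
rewrite E Rintegral_setU//.
- rewrite [X in _ + X](_ : _ = 0) ?addr0//.
  rewrite /Rintegral null_set_integral//; last exact: point0.
  + exact: marc.
  + have aa : gamma @` `[a, a] `<=` gamma @` `[a, b] by apply: image_subset; exact: sub.
    exact: measurable_int (integrableS (marc (lexx a) (lexx b)) (marc (lexx a) ab) aa arc_integrable).
- exact: moarc.
- exact: marc.
- by rewrite -E; exact: arc_integrable.
by apply/disj_setPS; rewrite oarcE// => z [[_ ?]].
Unshelve. all: by end_near. Qed.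

End arc_integral.

(** * Boundary charts *)

Section charts.
Context {R : realType}.
Notation mu := (@lebesgue_measure R).
Implicit Types (Omega N : set (plane R)).

(** A boundary arc near which the divergence theorem holds in parameter form.  The domain
   lies on the side of [(g2', - g1')], so that [(- g2', g1')] is the outward direction.
   The end points of the arc are off [N]: there its normal need not be known. *)
Definition green_chart Omega N : Prop :=
  exists (g1 g2 : R -> R) (a b : R) (U : set R),
  [/\ [/\ a <= b, open U & `[a, b] `<=` U],
      (forall n, Ck n U g1) /\ (forall n, Ck n U g2),
      [/\ forall s t, `[a, b]%classic s -> `[a, b]%classic t ->
            g1 s = g1 t -> g2 s = g2 t -> s = t,
          forall s, `[a, b]%classic s -> ('D_1 g1 s, 'D_1 g2 s) <> 0,
          forall s, `[a, b]%classic s -> frontier Omega (g1 s, g2 s) &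
          forall z, frontier Omega z -> N z -> exists2 s, a < s < b & z = (g1 s, g2 s)],
      forall s, a < s < b ->
        \forall e \near 0^'+, Omega (g1 s + e * 'D_1 g2 s, g2 s - e * 'D_1 g1 s) &
      forall F1 a1 a2 F2 b1 b2, C1bar Omega F1 a1 a2 -> C1bar Omega F2 b1 b2 ->
        (forall z, ~ N z -> F1 z = 0 /\ F2 z = 0) ->
        \int[@plane_measure R]_(z in Omega) (a1 z + b2 z) =
        \int[mu]_(s in `[a, b])
          (F1 (g1 s, g2 s) * - 'D_1 g2 s + F2 (g1 s, g2 s) * 'D_1 g1 s)].

Lemma frontier_open Omega z : open Omega -> frontier Omega z -> closure Omega z /\ ~ Omega z.
Proof. by move=> oO [cz]; rewrite (interior_id Omega).1. Qed.

Lemma open_frontier Omega z : open Omega -> closure Omega z -> ~ Omega z -> frontier Omega z.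
Proof. by move=> oO cz nz; split => //; rewrite (interior_id Omega).1. Qed.

Lemma closure_continuous {T T' : topologicalType} (f : T -> T') (A : set T) (B : set T') x :
  {for x, continuous f} -> (forall y, A y -> B (f y)) -> closure A x -> closure B (f x).
Proof.
move=> cf AB Ax W nW; have [y [Ay Wy]] := Ax _ (cf _ nW).
by exists (f y); split => //; exact: AB.
Qed.

Lemma frontier_defining Omega (U : set (plane R)) (rho : plane R -> R) z :
  open Omega -> open U -> U z -> smooth_on U rho -> (forall y, U y -> (Omega y <-> rho y < 0)) ->
  frontier Omega z -> rho z = 0.
Proof.
move=> oO oU Uz srho OU /(frontier_open oO)[cz nz].
apply/eqP; rewrite eq_le; apply/andP; split; last first.
  by rewrite leNgt; apply/negP => /(OU z Uz).
rewrite leNgt; apply/negP => rz.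
have cr := smooth_on_continuous srho Uz.
have nU : nbhs z (U `&` [set y | 0 < rho y]).
  by apply: filterI; [exact: open_nbhs_nbhs|exact: (cvgr_gt _ cr _ rz)].
have [y [Oy [Uy /= ry]]] := cz _ nU.
by have := (OU y Uy).1 Oy; rewrite ltNge (ltW ry).
Qed.

Lemma derive_pos_right (g : R -> R) (c : R) : is_derive (0 : R) (1 : R) g c -> 0 < c -> g 0 = 0 ->
  \forall e \near 0^'+, 0 < g e.
Proof.
move=> [D Dc] c0 g0.
have C : (fun h : R => h^-1 *: ((g \o shift 0) (h *: (1 : R)) - g 0)) @ 0^' --> c.
  by rewrite -Dc; exact: D.
have := cvgr_gt _ C _ c0.
move=> H.
have {}H : \forall e \near (0 : R), e != 0 -> 0 < e^-1 *: ((g \o shift 0) (e *: (1 : R)) - g 0).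
  exact: H.
have : \forall e \near (0 : R), 0 < e -> 0 < g e.
  apply: filterS H => e H e0; have := H (lt0r_neq0 e0).
  rewrite /= g0 subr0 addr0 [e *: 1]mulr1 => H1.
  have : 0 < e^-1 * g e by [].
  by rewrite pmulr_rgt0// invr_gt0.
by [].
Qed.

Lemma near_0right (P : R -> Prop) : (\forall e \near (0 : R), P e) -> \forall e \near 0^'+, P e.
Proof. by move=> H; apply: cvg_at_right_filter (cvg_id) _ H. Qed.

(** The domain lies below the graph supplied by the implicit function theorem. *)
Lemma graph_chart Omega (U : set (plane R)) (rho : plane R -> R) z :
  open Omega -> open U -> U z -> smooth_on U rho -> (forall y, U y -> (Omega y <-> rho y < 0)) ->
  frontier Omega z -> 0 < 'D_(uy R) rho z ->
  exists N, nbhs z N /\ green_chart Omega N.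
Proof.
case: z => p q oO oU Uz srho OU fz dr0.
have r0 := frontier_defining oO oU Uz srho OU fz.
have [d [k [h [[d0 k0] UB Hh sgn Ch]]]] := implicit_function oU Uz srho r0 dr0.
have hOmega x y : `|x - p| < d -> `|y - q| < 4 * k -> (Omega (x, y) <-> y < h x).
  by move=> xd yk; rewrite (OU _ (UB _ _ xd yk)); exact: (sgn x y xd yk).1.
have hq x : `|x - p| < d -> `|h x - q| < k by move=> /Hh[].
have dh x : `|x - p| < d -> derivable h x 1 by move=> xd; have [+ _] := Ch 1%N; exact.
have cdh x : `|x - p| < d -> {for x, continuous ('D_1 h)}.
  by move=> xd; have [_ +] := Ch 1%N; exact.
have ch x : `|x - p| < d -> {for x, continuous h} by move=> xd; exact: (Ch 0%N).
have k4 y : `|y - q| < k -> `|y - q| < 4 * k by move=> yk; apply: lt_trans yk _; move: k0; lra.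
have oI : open [set x | `|x - p| < d].
  have -> : [set x | `|x - p| < d] = ball p d.
    by apply/seteqP; split=> x; rewrite -ball_normE/= distrC.
  exact: ball_open.
pose N : set (plane R) := [set z | `|z.1 - p| <= d / 4 /\ `|z.2 - q| <= k].
have Dh s : `|s - p| < d -> 'D_1 (fun s : R => s) s = 1 :> R by move=> _; exact: derive_id.
have id1 : 'D_1 (fun s : R => s) = (fun=> 1) :> (R -> R) by apply/funext => s; exact: derive_id.
exists N; split.
  apply/(@nbhs_normP R (plane R)); exists (Num.min (d / 4) k); first by rewrite /= lt_min divr_gt0.
  move=> [x y]; rewrite /ball_/= plane_normE/= gt_max !lt_min => /andP[/andP[h1 _] /andP[_ h2]].
  by split; rewrite /= distrC ltW.
have ab s : `[p - d / 2, p + d / 2]%classic s -> `|s - p| < d.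
  by rewrite /= in_itv/= => /andP[? ?]; rewrite ltr_norml; move: d0; lra.
exists (fun s => s), h, (p - d / 2), (p + d / 2), [set x | `|x - p| < d]; split.
- by split=> //; move: d0; lra.
- split=> // n; case: n => [|n] /=; first by move=> x _; exact: cvg_id.
  split; first by move=> x _; exact: derivable_id.
  by rewrite id1; exact: Ck_cst.
- split.
  + by move=> s t _ _.
  + move=> s _ /(congr1 fst) /= H; have := derive_id s (1 : R); rewrite H => /esym/eqP.
    by rewrite oner_eq0.
  + move=> s /ab sd; apply: open_frontier => //; last first.
      by move=> Os; have := (hOmega s (h s) sd (k4 _ (hq s sd))).1 Os; rewrite ltxx.
    move=> B /nbhs_normP[e /= e0 eB].
    pose t := Num.min (e / 2) k.
    have t0 : 0 < t by rewrite lt_min k0 divr_gt0.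
    have te : t <= e / 2 by rewrite ge_min lexx.
    have tk : t <= k by rewrite ge_min lexx orbT.
    exists (s, h s - t); split.
      apply/hOmega => //; last by rewrite gtrBl.
      by have := hq s sd; rewrite !ltr_norml; move: tk t0 k0; lra.
    apply: eB; rewrite /ball_/= plane_normE/= subrr normr0 subKr gtr0_norm//.
    by rewrite gt_max e0; move: te e0; lra.
  move=> [x y] fxy [/= xp yq].
  have xd : `|x - p| < d by apply: le_lt_trans xp _; move: d0; lra.
  have yk : `|y - q| < 4 * k by apply: le_lt_trans yq _; move: k0; lra.
  exists x; first by move: xp; rewrite ler_distl => /andP[? ?]; move: d0; lra.
  have r1 := frontier_defining oO oU (UB x y xd yk) srho OU fxy.
  have [s1 s2] := sgn x y xd yk.
  congr pair; apply/eqP; rewrite eq_le; apply/andP; split; rewrite leNgt; apply/negP.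
    by move=> /s2; rewrite r1 ltxx.
  by move=> /s1; rewrite r1 ltxx.
- move=> s sab; have sd : `|s - p| < d.
    by apply: ab; rewrite /= in_itv/=; case/andP: sab => /ltW -> /ltW ->.
  rewrite derive_id; set l := 'D_1 h s.
  (* the height of the graph above the point moved inwards *)
  pose g (e : R) := h (s + e * l) - h s + e.
  have Dl : is_derive (0 : R) 1 (fun e : R => s + e * l) l.
    have H := is_deriveD (is_derive_cst s (0 : R) (1 : R)) (is_deriveM (is_derive_id (0:R) (1:R)) (is_derive_cst l (0 : R) (1:R))).
    apply: (@is_derive_eq _ _ _ _ _ _ _ _ H); rewrite -![_ *: _]/(_ * _). rewrite /cst; ring.
  have Dhs : is_derive (s + 0 * l) 1 h l by rewrite mul0r addr0; apply: derivableP; exact: dh.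
  have Dg : is_derive (0 : R) 1 g (l * l + 1).
    have H1 : is_derive (0 : R) 1 (fun e : R => h (s + e * l)) (l * l).
      apply: (@is_derive1_comp _ h (fun e : R => s + e * l) 0 l l Dhs Dl).
    have H := is_deriveD (is_deriveB H1 (is_derive_cst (h s) (0 : R) (1 : R))) (is_derive_id (0:R) (1:R)).
    by apply: (@is_derive_eq _ _ _ _ _ _ _ _ H); rewrite subr0.
  have gp : 0 < l * l + 1 by rewrite ltr_wpDl// -expr2 sqr_ge0.
  have g0 : g 0 = 0 by rewrite /g mul0r !addr0 subrr.
  have n1 := derive_pos_right Dg gp g0.
  have n2 : \forall e \near 0^'+, `|s + e * l - p| < d.
    apply: near_0right; have c : {for 0, continuous (fun e : R => s + e * l)}.
      by apply/differentiable_continuous/derivable1_diffP; have [] := Dl.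
    have := c [set x | `|x - p| < d]; apply; apply: open_nbhs_nbhs; split => //=.
    by rewrite mul0r addr0.
  have n3 : \forall e \near 0^'+, `|h s - e - q| < 4 * k.
    near=> e; rewrite addrAC (le_lt_trans (ler_normB _ _))//.
    have e0 : 0 < e by [].
    have ek : e < k by near: e; exact: nbhs_right_lt.
    by rewrite (gtr0_norm e0); have := hq s sd; move: ek; lra.
  near=> e; rewrite mulr1; apply/hOmega.
  + by near: e; exact: n2.
  + by near: e; exact: n3.
  have : 0 < g e by near: e; exact: n1.
  by rewrite /g; lra.
move=> F1 a1 a2 F2 b1 b2 C1 C2 F0.
rewrite (@graph_green _ Omega p q d k h oO d0 k0 hOmega hq dh cdh F1 a1 a2 F2 b1 b2 C1 C2).
- by apply: eq_Rintegral => s _; rewrite derive_id.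
- by move=> z Nz; have [] := F0 z Nz.
- by move=> z Nz; have [] := F0 z Nz.
Unshelve. all: by end_near. Qed.

End charts.

Section div_integrable.
Context {R : realType}.

Lemma div_integrable (Omega : set (plane R)) F1 a1 a2 F2 b1 b2 r :
  open Omega -> C1bar Omega F1 a1 a2 -> C1bar Omega F2 b1 b2 ->
  (forall z, ~ box r z -> F1 z = 0 /\ F2 z = 0) ->
  (@plane_measure R).-integrable Omega (EFin \o (fun z => a1 z + b2 z)).
Proof.
move=> oO C1 C2 F0; have [_ c1 _ _] := C1; have [_ _ c2 _] := C2.
apply: (@cont_on_integrable _ _ (closure Omega) (fun z => a1 z + b2 z) r) => //.
- exact: open_measurable_plane.
- exact: closed_closure.
- exact: subset_closure.
- exact: cont_onD.
move=> x Ox xr; have oB : open (~` @box R r) by rewrite openC; exact: closed_box.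
have nx : (~` @box R r) x by rewrite /box/= leNgt xr.
have [-> _] := C1bar_zero C1 oB (fun y ny => (F0 y ny).1) nx Ox.
have [_ ->] := C1bar_zero C2 oB (fun y ny => (F0 y ny).2) nx Ox.
by rewrite addr0.
Qed.

End div_integrable.

#[local] Arguments rot {R} x : simpl never.

Section rotated_charts.
Context {R : realType}.
Implicit Types (Omega N : set (plane R)).

Let unrot (x : plane R) : plane R := rot (rot (rot x)).

Let rotK x : rot (unrot x) = x. Proof. exact: rot4. Qed.
Let unrotK x : unrot (rot x) = x. Proof. exact: rot4. Qed.

Let unrot_continuous : continuous unrot.
Proof.
move=> x; have c2 : {for x, continuous (rot \o rot : plane R -> plane R)}.
  exact: (continuous_comp (@rot_continuous R x) (@rot_continuous R (rot x))).
exact: (continuous_comp c2 (@rot_continuous R (rot (rot x)))).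
Qed.

Lemma rotDZ (h : R) w x : rot (h *: w + x) = h *: rot w + rot x.
Proof. by rewrite linearD; congr (_ + _); exact: (linearZ_LR rot). Qed.

Lemma derive_rot (f : plane R -> R) x w : 'D_w (f \o rot) x = 'D_(rot w) f (rot x).
Proof.
rewrite /derive; suff -> : (fun h : R => h^-1 *: (((f \o rot) \o shift x) (h *: w) - (f \o rot) x)) =
  (fun h : R => h^-1 *: ((f \o shift (rot x)) (h *: rot w) - f (rot x))) by [].
by apply/funext => h; rewrite /comp /shift rotDZ.
Qed.

Lemma derivable_rot (f : plane R -> R) x w : derivable f (rot x) (rot w) ->
  derivable (f \o rot) x w.
Proof.
rewrite /derivable; suff -> : (fun h : R => h^-1 *: (((f \o rot) \o shift x) (h *: w) - (f \o rot) x)) =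
  (fun h : R => h^-1 *: ((f \o shift (rot x)) (h *: rot w) - f (rot x))) by [].
by apply/funext => h; rewrite /comp /shift rotDZ.
Qed.

Lemma is_derive_rot (f : plane R -> R) x w d : is_derive (rot x) (rot w) f d ->
  is_derive x w (f \o rot) d.
Proof. by move=> [D <-]; split; [exact: derivable_rot|exact: derive_rot]. Qed.

Lemma smooth_on_rot (U : set (plane R)) (f : plane R -> R) : smooth_on U f ->
  smooth_on (rot @^-1` U) (f \o rot).
Proof.
move=> sf s z Uz.
have E : Defs.iterD s (f \o rot) = Defs.iterD (map rot s) f \o rot.
  elim: s => [//|w s IH]; apply/funext => x /=.
  by rewrite IH; exact: derive_rot.
rewrite E; have [D C] := sf (map rot s) (rot z) Uz; split.
  by move=> w; apply: derivable_rot; exact: D.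
by apply: (@continuous_comp _ _ _ rot); [exact: rot_continuous|exact: C].
Qed.

Lemma rot_ux : rot (ux R) = uy R. Proof. by rewrite /rot/= oppr0. Qed.
Lemma rot_uy : rot (uy R) = - ux R. Proof. by congr pair; rewrite /= oppr0. Qed.

Lemma C1bar_rot Omega f f1 f2 : open Omega -> C1bar Omega f f1 f2 ->
  C1bar (rot @^-1` Omega) (f \o rot) (f2 \o rot) (fun x => - f1 (rot x)).
Proof.
move=> oO C; have [c c1 c2 D] := C.
have cr g : cont_on (closure Omega) g -> cont_on (closure (rot @^-1` Omega)) (g \o rot : plane R -> R).
  move=> cg; apply: cont_on_comp cg.
    by move=> x; apply: (closure_continuous (@rot_continuous R x)).
  by apply: continuous_cont_on; exact: rot_continuous.
split; [exact: cr|exact: cr|by apply: cont_onN; exact: cr|].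
move=> x Ox; split.
  by apply: is_derive_rot; rewrite rot_ux; have [] := D _ Ox.
apply: is_derive_rot; rewrite rot_uy.
have [k1 k2] := C1bar_continuous oO C Ox.
have [|| df _] := @C1_differentiable R f f1 f2 (rot x) _ _ k1 k2.
- by apply: filterS (open_nbhs_nbhs (conj oO Ox)) => y /D[].
- by apply: filterS (open_nbhs_nbhs (conj oO Ox)) => y /D[].
have [_ <-] := (D _ Ox).1.
apply: DeriveDef; first exact: diff_derivable.
by rewrite !deriveE// linearN.
Qed.

Lemma open_rot Omega : open Omega -> open (rot @^-1` Omega).
Proof. exact: (open_comp (f := @rot R) (fun x _ => @rot_continuous R x)). Qed.

Lemma frontier_rot Omega z : open Omega ->
  frontier (rot @^-1` Omega) z <-> frontier Omega (rot z).
Proof.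
move=> oO; have oO' := open_rot oO; split=> /(frontier_open _)[]// cz nz; apply: open_frontier => //.
  exact: (closure_continuous (@rot_continuous R z) _ cz).
rewrite -[z]unrotK; apply: (closure_continuous (@unrot_continuous (rot z)) _ cz).
by move=> y Oy; rewrite /preimage/= rotK.
Qed.

(** The arc and the field are turned back together; flux and divergence do not change. *)
Lemma rotate_chart Omega N r : open Omega -> N `<=` box r -> green_chart (rot @^-1` Omega) N ->
  green_chart Omega (unrot @^-1` N).
Proof.
move=> oO Nr [g1 [g2 [a [b [U [[ab oU abU] [C1 C2] [inj reg fr onN] out green]]]]]].
have D2 s : `[a, b]%classic s -> 'D_1 (fun s => - g2 s) s = - 'D_1 g2 s.
  by move=> sab; rewrite deriveN//; have [+ _] := C2 1%N; apply; exact: abU.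
exists (fun s => - g2 s), g1, a, b, U; split => //.
- split=> // n; apply: (@eq_Ck _ _ _ (fun s => -1 * g2 s)) => //; first by move=> x _; rewrite mulN1r.
  by apply: CkM => //; exact: Ck_cst.
- split.
  + by move=> s t sab tab /oppr_inj E2 E1; exact: inj.
  + move=> s sab; rewrite D2// => -[/eqP]; rewrite oppr_eq0 => /eqP E2 E1.
    by apply: (reg s sab); rewrite E1 E2.
  + by move=> s /fr/(frontier_rot _ oO).
  move=> z fz Nz; have fz' : frontier (rot @^-1` Omega) (unrot z) by apply/frontier_rot => //; rewrite rotK.
  have [s sab E] := onN _ fz' Nz; exists s => //.
  by rewrite -[z]rotK E.
- move=> s sab; have sab' : `[a, b]%classic s.
    by rewrite /= in_itv/=; case/andP: sab => ? ?; apply/andP; split; exact: ltW.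
  apply: filterS (out s sab) => e Oe; rewrite D2//.
  rewrite [X in Omega X](_ : _ = rot (g1 s + e * 'D_1 g2 s, g2 s - e * 'D_1 g1 s))//.
  by rewrite /rot/=; congr pair; ring.
move=> F1 a1 a2 F2 b1 b2 E1 E2 F0.
have G1 := C1bar_rot oO E1.
have G2 := C1bar_rot oO E2.
have G1N : C1bar (rot @^-1` Omega) (fun x => - F1 (rot x)) (fun x => - a2 (rot x)) (fun x => a1 (rot x)).
  have [c c1 c2 D] := G1; split; [exact: cont_onN|exact: cont_onN| |].
    by have := cont_onN c2; apply: eq_cont_on => x _; rewrite opprK.
  move=> x /D[d1 d2]; split; first exact: is_deriveN d1.
  by rewrite -[a1 _]opprK; exact: is_deriveN d2.
have := green _ _ _ _ _ _ G2 G1N.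
have F0' z : ~ N z -> (F2 \o rot) z = 0 /\ - F1 (rot z) = 0.
  move=> Nz; have [|-> /= ->] := F0 (rot z); last by rewrite oppr0.
  by rewrite /preimage/= unrotK.
move=> /(_ F0') H.
have iO : (@plane_measure R).-integrable Omega (EFin \o (fun z => a1 z + b2 z)).
  apply: (div_integrable oO E1 E2 (r := r)) => z nz; apply: F0 => Nz; apply: nz.
  have := Nr _ Nz; rewrite /unrot /box/= !plane_normE/= !normrN => h.
  by rewrite maxC.
rewrite -(Rintegral_rot _ iO); last exact: open_measurable_plane.
transitivity (\int[@plane_measure R]_(z in rot @^-1` Omega) ((b2 \o rot) z + a1 (rot z))).
  by apply: eq_Rintegral => z _; rewrite /= addrC.
rewrite H; apply: eq_Rintegral => s /set_mem sab.
by rewrite D2// /=; ring.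
Qed.

(** A boundary chart exists as soon as the defining function has positive derivative
   in the direction [w]; this property of [w] is stable under rotation. *)
Let chart_direction (w : plane R) : Prop := forall Omega U (rho : plane R -> R) z,
  open Omega -> open U -> U z -> smooth_on U rho ->
  (forall y, U y -> (Omega y <-> rho y < 0)) -> frontier Omega z -> 0 < 'D_w rho z ->
  exists N, [/\ nbhs z N, exists r, N `<=` box r & green_chart Omega N].

Let chart_direction_uy : chart_direction (uy R).
Proof.
move=> Omega U rho z oO oU Uz sr OU fz dz.
have [N [nN [g1 [g2 [a [b [U' [C0 C [inj reg fr onN] out green]]]]]]]] :=
  graph_chart oO oU Uz sr OU fz dz.
exists (N `&` box (`|z| + 1)); split; last first.
- exists g1, g2, a, b, U'; split => //.
    by split=> // y fy [Ny _]; exact: onN.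
  move=> F1 a1 a2 F2 b1 b2 C1 C2 F0; apply: (green _ _ _ _ _ _ C1 C2) => y Ny.
  by apply: F0 => -[].
- by exists (`|z| + 1); exact: subIsetr.
apply: filterI => //; apply/(@nbhs_normP R (plane R)); exists 1 => //= y; rewrite /ball_/box/= => yz.
rewrite -[y](subrK z) (le_trans (ler_normD _ _))// addrC lerD2l distrC.
exact: ltW.
Qed.

Let chart_direction_rot w : chart_direction w -> chart_direction (rot w).
Proof.
move=> H Omega U rho z oO oU Uz sr OU fz dz.
have [| | | | | | | N [nN [r Nr] gN]] := H (rot @^-1` Omega) (rot @^-1` U) (rho \o rot) (unrot z).
- exact: open_rot.
- exact: open_rot.
- by rewrite /preimage/= rotK.
- exact: smooth_on_rot.
- by move=> y Uy; exact: OU.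
- by apply/frontier_rot => //; rewrite rotK.
- by rewrite derive_rot rotK.
exists (unrot @^-1` N); split.
- exact: unrot_continuous.
- exists r => y Ny; have := Nr _ Ny; rewrite /unrot /box/= !plane_normE/= !normrN => h.
  by rewrite maxC.
exact: rotate_chart Nr gN.
Qed.

Lemma smooth_on_differentiable (U : set (plane R)) (rho : plane R -> R) z :
  open U -> U z -> smooth_on U rho -> differentiable rho z.
Proof.
move=> oU Uz sr.
have [|||| //] := @C1_differentiable R rho ('D_(ux R) rho) ('D_(uy R) rho) z.
- by apply: filterS (open_nbhs_nbhs (conj oU Uz)) => y Uy; exact: smooth_on_is_derive sr Uy.
- by apply: filterS (open_nbhs_nbhs (conj oU Uz)) => y Uy; exact: smooth_on_is_derive sr Uy.
- by apply: smooth_on_continuous Uz; exact: smooth_on_derive.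
- by apply: smooth_on_continuous Uz; exact: smooth_on_derive.
Qed.

(** A nonzero gradient has a nonzero component; the rotations of the vertical direction are
   the four axis directions. *)
Lemma chart_of_defining Omega (U : set (plane R)) (rho : plane R -> R) z :
  open Omega -> open U -> U z -> smooth_on U rho -> (forall y, U y -> (Omega y <-> rho y < 0)) ->
  frontier Omega z -> gradient rho z <> 0 ->
  exists N, [/\ nbhs z N, exists r, N `<=` box r & green_chart Omega N].
Proof.
move=> oO oU Uz sr OU fz gr.
have df := smooth_on_differentiable oU Uz sr.
have DN w : 'D_(- w) rho z = - 'D_w rho z by rewrite !deriveE// linearN.
have H1 := chart_direction_rot chart_direction_uy; have H2 := chart_direction_rot H1.
have H3 := chart_direction_rot H2.
have rotN x : rot (- x) = - rot x by exact: (linearN rot).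
rewrite rot_uy in H1 H2 H3; rewrite rotN rot_ux in H2 H3; rewrite rotN rot_uy opprK in H3.
have [dy|dy|dy] := ltgtP 0 ('D_(uy R) rho z).
- exact: (chart_direction_uy oO oU Uz sr OU fz dy).
- by apply: (H2 _ _ _ _ oO oU Uz sr OU fz); rewrite DN oppr_gt0.
have [dx|dx|dx] := ltgtP 0 ('D_(ux R) rho z).
- exact: (H3 _ _ _ _ oO oU Uz sr OU fz dx).
- by apply: (H1 _ _ _ _ oO oU Uz sr OU fz); rewrite DN oppr_gt0.
by exfalso; apply: gr; rewrite /gradient -dx -dy.
Qed.

End rotated_charts.

(** * The divergence theorem, locally *)

Section local_green.
Context {R : realType}.
Notation mu := (@lebesgue_measure R).
Notation area := (@plane_measure R).
Variables (Omega : set (plane R)) (nu : plane R -> plane R)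
  (sigma : {measure set (borel_plane R) -> \bar R}).
Hypotheses (oO : open Omega) (hnu : outward_unit_normal Omega nu)
  (hsigma : surface_measure Omega sigma).
Implicit Types N : set (plane R).

Lemma measurable_frontier : measurable (frontier Omega : set (borel_plane R)).
Proof.
apply: measurableD; first by apply: closed_measurable_plane; exact: closed_closure.
by apply: open_measurable_plane; exact: open_interior.
Qed.

(** On a boundary chart the outward unit normal is the rotated unit tangent: the
   gradient of a defining function is orthogonal to the tangent, and points away from
   the side on which the domain lies. *)
Lemma chart_normal (g1 g2 : R -> R) (s u v : R) rho :
  let z := (g1 s, g2 s) in
  is_derive s 1 g1 u -> is_derive s 1 g2 v -> (u, v) <> 0 ->
  (\forall t \near s, frontier Omega (g1 t, g2 t)) ->
  (\forall e \near 0^'+, Omega (g1 s + e * v, g2 s - e * u)) ->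
  local_defining_function Omega z rho ->
  (enorm (gradient rho z))^-1 *: gradient rho z = (enorm (u, v))^-1 *: rot (u, v).
Proof.
move=> z Du Dv uv0 fr out [U [[oU Uz] sr OU gr]].
have fz : frontier Omega z by exact: nbhs_singleton fr.
pose A := 'D_(ux R) rho z; pose B := 'D_(uy R) rho z.
have grE : gradient rho z = (A, B) by [].
have nU : \forall y \near z, U y by exact: open_nbhs_nbhs.
have d1 : \forall y \near z, is_derive y (ux R) rho ('D_(ux R) rho y).
  by apply: filterS nU => y Uy; exact: smooth_on_is_derive sr Uy.
have d2 : \forall y \near z, is_derive y (uy R) rho ('D_(uy R) rho y).
  by apply: filterS nU => y Uy; exact: smooth_on_is_derive sr Uy.
have c1 : {for z, continuous ('D_(ux R) rho)}.
  by apply: smooth_on_continuous Uz; exact: smooth_on_derive.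
have c2 : {for z, continuous ('D_(uy R) rho)}.
  by apply: smooth_on_continuous Uz; exact: smooth_on_derive.
have cg1 : {for s, continuous g1} by apply/differentiable_continuous/derivable1_diffP; have [] := Du.
have cg2 : {for s, continuous g2} by apply/differentiable_continuous/derivable1_diffP; have [] := Dv.
have T : A * u + B * v = 0.
  have [_ <-] := is_derive_chain (erefl z) d1 d2 c1 c2 Du Dv.
  rewrite (@near_eq_derive _ _ _ _ (fun=> 0))//; first exact: derive_cst.
  have cz : {for s, continuous (fun t => (g1 t, g2 t))} by exact: (cvg_pair cg1 cg2).
  near=> t; apply: (frontier_defining oO oU _ sr OU).
    by near: t; exact: (cz U nU).
  by near: t.
have m0 : 0 <= B * u - A * v.
  rewrite leNgt; apply/negP => m0.
  have Du' : is_derive (0 : R) 1 (fun e : R => g1 s + e * v) v.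
    have H := is_deriveD (is_derive_cst (g1 s) (0 : R) (1 : R)) (is_deriveM (is_derive_id (0:R) (1:R)) (is_derive_cst v (0 : R) (1:R))).
    by apply: (@is_derive_eq _ _ _ _ _ _ _ _ H); rewrite -![_ *: _]/(_ * _) /cst; ring.
  have Dv' : is_derive (0 : R) 1 (fun e : R => g2 s - e * u) (- u).
    have H := is_deriveB (is_derive_cst (g2 s) (0 : R) (1 : R)) (is_deriveM (is_derive_id (0:R) (1:R)) (is_derive_cst u (0 : R) (1:R))).
    by apply: (@is_derive_eq _ _ _ _ _ _ _ _ H); rewrite -![_ *: _]/(_ * _) /cst; ring.
  have z0 : (g1 s + 0 * v, g2 s - 0 * u) = z by rewrite !mul0r addr0 subr0.
  have := is_derive_chain (c1 := fun e => g1 s + e * v) (c2 := fun e => g2 s - e * u) (s := 0)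
    z0 d1 d2 c1 c2 Du' Dv'.
  rewrite -/A -/B => H.
  have r0 : rho (g1 s + 0 * v, g2 s - 0 * u) = 0.
    by rewrite z0; exact: (frontier_defining oO oU Uz sr OU fz).
  have p0 : 0 < A * v + B * - u by move: m0; lra.
  have n1 := derive_pos_right H p0 r0.
  have ce : {for 0, continuous (fun e : R => (g1 s + e * v, g2 s - e * u))}.
    have k1 : {for 0, continuous (fun e : R => g1 s + e * v)}.
      by apply/differentiable_continuous/derivable1_diffP; have [] := Du'.
    have k2 : {for 0, continuous (fun e : R => g2 s - e * u)}.
      by apply/differentiable_continuous/derivable1_diffP; have [] := Dv'.
    exact: (cvg_pair k1 k2).
  have n2 : \forall e \near 0^'+, U (g1 s + e * v, g2 s - e * u).
    by apply: near_0right; apply: (ce U); rewrite z0.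
  have [e [[Oe re] Ue]] := filter_ex (filterI (filterI out n1) n2).
  by have := (OU _ Ue).1 Oe; rewrite ltNge ltW.
have uv2 : 0 < u ^+ 2 + v ^+ 2.
  by rewrite -(sqr_enorm (u, v)) exprn_gt0// enorm_gt0.
pose c := (B * u - A * v) / (u ^+ 2 + v ^+ 2).
have uv2n : u ^+ 2 + v ^+ 2 != 0 by rewrite gt_eqF.
have AE : A = c * - v.
  apply: (mulIf uv2n); rewrite /c mulrAC divfK//.
  rewrite [LHS](_ : _ = (A * u + B * v) * u - (B * u - A * v) * v); last by ring.
  by rewrite T; ring.
have BE : B = c * u.
  apply: (mulIf uv2n); rewrite /c mulrAC divfK//.
  rewrite [LHS](_ : _ = (A * u + B * v) * v + (B * u - A * v) * u); last by ring.
  by rewrite T; ring.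
have GE : gradient rho z = c *: rot (u, v) by rewrite grE AE BE.
have c0 : 0 <= c by rewrite divr_ge0// ltW.
have cn : c != 0 by apply/eqP => ce; apply: gr; rewrite GE ce scale0r.
rewrite GE enormZ// enorm_rot scalerA invfM mulrC mulrA mulfV// mul1r//.
Unshelve. all: by end_near. Qed.

(** Integrability of both sides is included, so that the identities for the pieces of a
   partition can be added. *)
Definition green_for (F1 F2 D : plane R -> R) : Prop :=
  [/\ area.-integrable Omega (EFin \o D),
      sigma.-integrable (frontier Omega) (EFin \o (fun z => F1 z * (nu z).1 + F2 z * (nu z).2)) &
      \int[area]_(z in Omega) D z =
      \int[sigma]_(z in frontier Omega) (F1 z * (nu z).1 + F2 z * (nu z).2)].

Definition locally_green N : Prop := forall F1 a1 a2 F2 b1 b2,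
  C1bar Omega F1 a1 a2 -> C1bar Omega F2 b1 b2 ->
  (forall z, ~ N z -> F1 z = 0 /\ F2 z = 0) -> green_for F1 F2 (fun z => a1 z + b2 z).

Let mO : measurable (Omega : set (borel_plane R)). Proof. exact: open_measurable_plane. Qed.

(** The flux density along the arc is the parameter integrand divided by the speed.  That the
   boundary piece has finite length is kept for the sigma-finiteness of [sigma]. *)
Lemma chart_locally_green N r : N `<=` box r -> green_chart Omega N ->
  locally_green N /\ exists A, [/\ measurable (A : set (borel_plane R)),
    frontier Omega `&` N `<=` A & (sigma A < +oo)%E].
Proof.
move=> Nr [g1 [g2 [a [b [U [[ab oU abU] [C1 C2] [inj reg fr onN] out green]]]]]].
pose gamma s : plane R := (g1 s, g2 s).
have sgamma : smooth_on U gamma by exact: Ck_smooth_on.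
have D1 s : U s -> is_derive s 1 g1 ('D_1 g1 s).
  by move=> Us; apply: derivableP; have [+ _] := C1 1%N; exact.
have D2 s : U s -> is_derive s 1 g2 ('D_1 g2 s).
  by move=> Us; apply: derivableP; have [+ _] := C2 1%N; exact.
have Dg s : U s -> 'D_1 gamma s = ('D_1 g1 s, 'D_1 g2 s).
  by move=> Us; have [_] := is_derive_pair (D1 s Us) (D2 s Us).
have igamma : {in `[a, b]%classic &, injective gamma}.
  by move=> s t /set_mem sab /set_mem tab [E1 E2]; exact: inj.
have rgamma s : `[a, b]%classic s -> 'D_1 gamma s <> 0.
  by move=> sab; rewrite Dg; [exact: reg|exact: abU].
have fgamma : gamma @` `[a, b] `<=` frontier Omega by move=> _ [s sab <-]; exact: fr.
have mA : measurable (gamma @` `[a, b] : set (borel_plane R)).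
  exact: (arc_measurable abU sgamma (subset_refl _) (@segment_compact _ a b)).
split; last first.
  exists (gamma @` `[a, b]); split => //.
    move=> z [fz Nz]; have [s /andP[? ?] ->] := onN z fz Nz; exists s => //.
    by rewrite /= in_itv/=; apply/andP; split; exact: ltW.
  by rewrite (arc_length hsigma oU abU sgamma igamma rgamma fgamma (lexx a) ab (lexx b)) ltry.
move=> F1 a1 a2 F2 b1 b2 E1 E2 F0.
pose f z := F1 z * (nu z).1 + F2 z * (nu z).2.
pose k s := F1 (gamma s) * - 'D_1 g2 s + F2 (gamma s) * 'D_1 g1 s.
pose g s := k s / enorm ('D_1 gamma s).
have en0 s : `[a, b]%classic s -> enorm ('D_1 gamma s) != 0.
  by move=> sab; rewrite gt_eqF// enorm_gt0//; exact: rgamma.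
have endN s : `[a, b]%classic s -> ~ (a < s < b) -> ~ N (gamma s).
  move=> sab ns Ns; have [t tab [e1 e2]] := onN _ (fr s sab) Ns.
  have tab' : `[a, b]%classic t.
    by rewrite /= in_itv/=; case/andP: tab => ? ?; apply/andP; split; exact: ltW.
  by apply: ns; rewrite (inj s t sab tab' e1 e2).
have fg s : `[a, b]%classic s -> f (gamma s) = g s.
  move=> sab; have Us := abU _ sab.
  have [sin|sout] := pselect (a < s < b); last first.
    by have [e1 e2] := F0 _ (endN s sab sout); rewrite /f /g /k e1 e2 !mul0r addr0 mul0r.
  have [rho [dr nuE]] := hnu (fr s sab).
  have nfr : \forall t \near s, frontier Omega (g1 t, g2 t).
    have : \forall t \near s, t \in `]a, b[ by apply: near_in_itvoo; rewrite in_itv.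
    by apply: filterS => t tab; apply: fr; exact: subset_itv_oo_cc.
  have uv0 : ('D_1 g1 s, 'D_1 g2 s) <> 0 by exact: reg.
  have := chart_normal (D1 s Us) (D2 s Us) uv0 nfr (out s sin) dr.
  rewrite -nuE /f => ->; rewrite /g /k Dg//.
  set e := (enorm _)^-1.
  rewrite -[(e *: rot _).1]/(e * - 'D_1 g2 s) -[(e *: rot _).2]/(e * 'D_1 g1 s).
  by rewrite /gamma; ring.
have [cF1 _ _ _] := E1; have [cF2 _ _ _] := E2.
have cgamma : cont_on `[a, b] gamma.
  by move=> s sab; apply: cvg_within_filter; exact: smooth_on_continuous sgamma (abU _ sab).
have clgamma s : `[a, b]%classic s -> closure Omega (gamma s) by move=> /fr/(frontier_open oO)[].
have cD1 : cont_on `[a, b] ('D_1 g1).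
  by move=> s sab; apply: cvg_within_filter; have [_ +] := C1 1%N; apply; exact: abU.
have cD2 : cont_on `[a, b] ('D_1 g2).
  by move=> s sab; apply: cvg_within_filter; have [_ +] := C2 1%N; apply; exact: abU.
have ck : cont_on `[a, b] k.
  apply: cont_onD; apply: cont_onM => //.
  - exact: (cont_on_comp clgamma cgamma cF1).
  - exact: cont_onN.
  - exact: (cont_on_comp clgamma cgamma cF2).
have cg : cont_on `[a, b] g.
  move=> s sab; apply: cvgM; first exact: ck.
  by apply: cvgV; [exact: en0|exact: (arc_speed_continuous abU sgamma)].
have fi : sigma.-integrable (gamma @` `[a, b]) (EFin \o f).
  exact: (arc_integrable hsigma ab oU abU sgamma igamma rgamma fgamma cg fg).
have f0 z : frontier Omega z -> ~ (gamma @` `[a, b]) z -> f z = 0.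
  move=> fz nz; have [|e1 e2] := F0 z; last by rewrite /f e1 e2 !mul0r addr0.
  move=> Nz; apply: nz; have [s sab ->] := onN z fz Nz; exists s => //.
  by rewrite /= in_itv/=; case/andP: sab => ? ?; apply/andP; split; exact: ltW.
have fA : frontier Omega `&` gamma @` `[a, b] = gamma @` `[a, b] by exact: setIidr.
split.
- by apply: (div_integrable oO E1 E2 (r := r)) => z nz; apply: F0 => /Nr.
- have : sigma.-integrable (frontier Omega `&` gamma @` `[a, b]) (EFin \o f) by rewrite fA.
  move=> /(integrable_restrict sigma mA measurable_frontier).
  apply: eq_integrable => //; first exact: measurable_frontier.
  move=> z /set_mem fz; rewrite patchE; case: ifPn => //= /negP nz.
  by rewrite -/(f z) f0// => /mem_set.
rewrite (green _ _ _ _ _ _ E1 E2 F0).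
rewrite (@Rintegral_support _ _ _ sigma (frontier Omega) (gamma @` `[a, b]) f f0) fA.
rewrite (arc_integral hsigma ab oU abU sgamma igamma rgamma fgamma cg fg).
by apply: eq_Rintegral => s /set_mem sab; rewrite /g divfK//; exact: en0.
Qed.

Lemma green_for0 (F1 F2 D : plane R -> R) : (forall z, Omega z -> D z = 0) ->
  (forall z, frontier Omega z -> F1 z = 0 /\ F2 z = 0) -> green_for F1 F2 D.
Proof.
move=> D0 F0.
have E1 : {in Omega, D =1 fun=> 0} by move=> z /set_mem; exact: D0.
have E2 : {in frontier Omega, (fun z => F1 z * (nu z).1 + F2 z * (nu z).2) =1 fun=> 0}.
  by move=> z /set_mem/F0[-> ->]; rewrite !mul0r addr0.
split.
- apply: (@eq_integrable _ _ _ _ _ _ (cst 0%E)) => //; last exact: integrable0.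
  by move=> z zO /=; rewrite E1.
- apply: (@eq_integrable _ _ _ _ _ _ (cst 0%E)) => //; last exact: integrable0.
    exact: measurable_frontier.
  by move=> z zO /=; rewrite E2.
rewrite (@eq_Rintegral _ _ _ area Omega (fun=> 0) D E1).
rewrite (@eq_Rintegral _ _ _ sigma (frontier Omega) (fun=> 0) _ E2).
by rewrite !Rintegral_cst ?mul0r//; exact: measurable_frontier.
Qed.

Lemma outside_locally_green : locally_green (~` closure Omega).
Proof.
move=> F1 a1 a2 F2 b1 b2 C1 C2 F0; apply: green_for0 => z.
  move=> Oz; have H y : Omega y -> F1 y = 0 /\ F2 y = 0.
    by move=> Oy; apply: F0; apply; exact: subset_closure.
  have [-> _] := C1bar_zero C1 oO (fun y Oy => (H y Oy).1) Oz Oz.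
  by have [_ ->] := C1bar_zero C2 oO (fun y Oy => (H y Oy).2) Oz Oz; rewrite addr0.
by move=> /(frontier_open oO)[cz _]; apply: F0; apply.
Qed.

End local_green.

(** * Cutoff functions *)

Section cutoff.
Context {R : realType}.

Lemma is_derive_near (g f : R -> R) (x d : R) : (\forall y \near x, f y = g y) ->
  is_derive x 1 g d -> is_derive x 1 f d.
Proof.
move=> fg [D <-]; apply: DeriveDef; last exact: near_eq_derive.
by apply: near_eq_derivable D => //; apply: filterS fg => y ->.
Qed.

(** The transition from 0 to 1 is built from squared positive parts: cut-offs are only
   differentiated once, and this derivative is explicit. *)
Definition sqpos (u : R) : R := Num.max 0 u ^+ 2.
Definition dsqpos (u : R) : R := 2 * Num.max 0 u.

Lemma is_derive_sqpos (u : R) : is_derive u 1 sqpos (dsqpos u).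
Proof.
have [u0|u0|u0] := ltgtP u 0.
- rewrite /dsqpos max_l ?ltW// mulr0.
  apply: (@is_derive_near (fun=> 0)) (is_derive_cst _ _ _).
  have : \forall y \near u, y < 0 by exact: lt_nbhsl.
  by apply: filterS => y y0; rewrite /sqpos max_l ?ltW// expr0n.
- rewrite /dsqpos max_r ?ltW//.
  have D : is_derive u 1 (fun y : R => y * y) (2 * u).
    have H := is_deriveM (is_derive_id u (1 : R)) (is_derive_id u (1:R)).
    by apply: (@is_derive_eq _ _ _ _ _ _ _ _ H); rewrite -![_ *: _]/(_ * _); ring.
  apply: is_derive_near D.
  have : \forall y \near u, 0 < y by exact: lt_nbhsr.
  by apply: filterS => y y0; rewrite /sqpos max_r ?ltW// expr2.
rewrite u0 /dsqpos maxxx mulr0; apply: is_derive_eps => e e0.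
exists e => // t t0 te; rewrite add0r subr0 /sqpos maxxx expr0n subr0.
have [tp|tn] := leP 0 t.
  by rewrite expr2 mulfK.
by rewrite expr0n mul0r normr0.
Qed.

Lemma dsqpos_continuous : continuous dsqpos.
Proof.
move=> u; apply: cvgM; first exact: cvg_cst.
by apply: continuous_max; [exact: cvg_cst|exact: cvg_id].
Qed.

Definition step (u : R) : R := 1 - sqpos (1 - sqpos u).
Definition dstep (u : R) : R := dsqpos (1 - sqpos u) * dsqpos u.

Lemma is_derive_step (u : R) : is_derive u 1 step (dstep u).
Proof.
have H1 := is_deriveB (is_derive_cst (1 : R) u (1 : R)) (is_derive_sqpos u).
have H2 := @is_derive1_comp _ sqpos (fun u => 1 - sqpos u) u _ _ (is_derive_sqpos _) H1.
have H := is_deriveB (is_derive_cst (1 : R) u (1 : R)) H2.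
by apply: (@is_derive_eq _ _ _ _ _ _ _ _ H); rewrite /dstep; ring.
Qed.

Lemma step_continuous : continuous step.
Proof. by move=> u; apply/differentiable_continuous/derivable1_diffP; have [] := is_derive_step u. Qed.

Lemma dstep_continuous : continuous dstep.
Proof.
move=> u; apply: cvgM; last exact: dsqpos_continuous.
have c : {for u, continuous (fun u => 1 - sqpos u)}.
  apply: cvgB; first exact: cvg_cst.
  by apply/differentiable_continuous/derivable1_diffP; have [] := is_derive_sqpos u.
exact: (@continuous_comp _ _ _ (fun u => 1 - sqpos u) dsqpos u c (@dsqpos_continuous _)).
Qed.

Lemma sqpos_ge0 u : 0 <= sqpos u. Proof. exact: sqr_ge0. Qed.

Lemma sqpos1 u : 1 <= u -> 1 <= sqpos u.
Proof. by move=> u1; rewrite /sqpos max_r ?(le_trans ler01)// exprn_ege1. Qed.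

Lemma step0 u : u <= 0 -> step u = 0.
Proof. by move=> u0; rewrite /step /sqpos (max_l u0) expr0n subr0 max_r// expr1n subrr. Qed.

Lemma step1 u : 1 <= u -> step u = 1.
Proof. by move=> /sqpos1 u1; rewrite /step {1}/sqpos max_l ?expr0n ?subr0// subr_le0. Qed.

Lemma dstep0 u : u <= 0 -> dstep u = 0.
Proof. by move=> u0; rewrite /dstep {2}/dsqpos (max_l u0) mulr0 mulr0. Qed.

Lemma dstep1 u : 1 <= u -> dstep u = 0.
Proof. by move=> /sqpos1 u1; rewrite /dstep {1}/dsqpos max_l ?mulr0 ?mul0r// subr_le0. Qed.

Lemma step_itv u : 0 <= step u <= 1.
Proof.
have h : 0 <= Num.max 0 (1 - sqpos u) <= 1.
  by rewrite le_max lexx /= ge_max ler01 /= gerBl sqpos_ge0.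
have : 0 <= sqpos (1 - sqpos u) <= 1.
  by rewrite sqpos_ge0 /= /sqpos; case/andP: h => h0 h1; rewrite exprn_ile1.
by rewrite /step; lra.
Qed.

Lemma dstep_itv u : 0 <= dstep u <= 4.
Proof.
have [u1|u1] := leP 1 u; first by rewrite dstep1// lexx /=.
have h : 0 <= Num.max 0 (1 - sqpos u) <= 1.
  by rewrite le_max lexx /= ge_max ler01 /= gerBl sqpos_ge0.
have h' : 0 <= Num.max 0 u <= 1 by rewrite le_max lexx /= ge_max ler01 /= ltW.
by rewrite /dstep /dsqpos; move: h h'; nra.
Qed.

(** [cutoff c r] is of class C^1, with value 1 on the disc of radius r around c and 0 off
   the disc of radius sqrt 2 * r. *)
Definition cutarg (c : plane R) (r : R) (x : plane R) : R :=
  2 - ((x.1 - c.1) ^+ 2 + (x.2 - c.2) ^+ 2) / r ^+ 2.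
Definition cutoff c r x : R := step (cutarg c r x).
Definition dcutoff1 c r x : R := dstep (cutarg c r x) * (- (2 * (x.1 - c.1)) / r ^+ 2).
Definition dcutoff2 c r x : R := dstep (cutarg c r x) * (- (2 * (x.2 - c.2)) / r ^+ 2).

Lemma cutarg_continuous c r : continuous (cutarg c r).
Proof.
move=> x; apply: cvgB; first exact: cvg_cst.
apply: cvgM; last exact: cvg_cst.
by apply: cvgD; rewrite ?expr2; apply: cvgM; apply: cvgB; try exact: cvg_cst;
  by [exact: cvg_fst|exact: cvg_snd].
Qed.

Lemma cutoff_C1bar c r (Omega : set (plane R)) :
  C1bar Omega (cutoff c r) (dcutoff1 c r) (dcutoff2 c r).
Proof.
have cs : continuous (cutoff c r).
  by move=> x; exact: (@continuous_comp _ _ _ (cutarg c r) step x (@cutarg_continuous c r x) (@step_continuous _)).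
have cd : continuous (dstep \o cutarg c r).
  by move=> x; exact: (@continuous_comp _ _ _ (cutarg c r) dstep x (@cutarg_continuous c r x) (@dstep_continuous _)).
split; try (apply: continuous_cont_on => x //).
- apply: cvgM; first exact: cd.
  apply: cvgM; last exact: cvg_cst.
  apply: cvgN; apply: cvgM; first exact: cvg_cst.
  by apply: cvgB; [exact: cvg_fst|exact: cvg_cst].
- apply: cvgM; first exact: cd.
  apply: cvgM; last exact: cvg_cst.
  apply: cvgN; apply: cvgM; first exact: cvg_cst.
  by apply: cvgB; [exact: cvg_snd|exact: cvg_cst].
move=> x _.
have Dq (u v w : R) : is_derive u 1 (fun t : R => 2 - ((t - v) ^+ 2 + w) / r ^+ 2) (- (2 * (u - v)) / r ^+ 2).
  have H1 := is_deriveB (is_derive_id u (1 : R)) (is_derive_cst v u (1:R)).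
  have H2 := is_deriveM H1 H1.
  have H3 := is_deriveM (is_deriveD H2 (is_derive_cst w u (1 : R))) (is_derive_cst ((r ^+ 2)^-1) u (1 : R)).
  have H := is_deriveB (is_derive_cst (2 : R) u (1 : R)) H3.
  have E : (fun t : R => 2 - ((t - v) ^+ 2 + w) / r ^+ 2) =
     cst 2 - ((id - cst v) * (id - cst v) + cst w) * cst ((r ^+ 2)^-1).
    by apply/funext => t; rewrite !fctE expr2.
  rewrite E; apply: (@is_derive_eq _ _ _ _ _ _ _ _ H).
  by rewrite -![_ *: _]/(_ * _) !fctE /cst; ring.
split.
- rewrite -[x]addr0 -(scale0r (ux R)); apply/is_derive_line.
  have -> : (fun h => cutoff c r (x + h *: ux R)) =
     step \o (fun h => 2 - ((h - (c.1 - x.1)) ^+ 2 + (x.2 - c.2) ^+ 2) / r ^+ 2).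
    apply/funext => h; rewrite /cutoff /cutarg plane_stepx /=; congr step.
    by congr (2 - (_ ^+ 2 + _) / _); ring.
  have H := @is_derive1_comp _ step _ 0 _ _ (is_derive_step _) (Dq 0 (c.1 - x.1) ((x.2 - c.2) ^+ 2)).
  apply: (@is_derive_eq _ _ _ _ _ _ _ _ H).
  rewrite scale0r addr0 /dcutoff1 /cutarg.
  by rewrite (_ : 0 - (c.1 - x.1) = x.1 - c.1)//; ring.
- rewrite -[x]addr0 -(scale0r (uy R)); apply/is_derive_line.
  have -> : (fun h => cutoff c r (x + h *: uy R)) =
     step \o (fun h => 2 - ((h - (c.2 - x.2)) ^+ 2 + (x.1 - c.1) ^+ 2) / r ^+ 2).
    apply/funext => h; rewrite /cutoff /cutarg plane_stepy /=; congr step.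
    by congr (2 - _ / _); ring.
  have H := @is_derive1_comp _ step _ 0 _ _ (is_derive_step _) (Dq 0 (c.2 - x.2) ((x.1 - c.1) ^+ 2)).
  apply: (@is_derive_eq _ _ _ _ _ _ _ _ H).
  rewrite scale0r addr0 /dcutoff2 /cutarg.
  rewrite (_ : 0 - (c.2 - x.2) = x.2 - c.2); last by ring.
  by rewrite [in dstep _](addrC ((x.2 - c.2) ^+ 2)).
Qed.

Lemma cutoff_in c r x : 0 < r -> (x.1 - c.1) ^+ 2 + (x.2 - c.2) ^+ 2 <= r ^+ 2 ->
  [/\ cutoff c r x = 1, dcutoff1 c r x = 0 & dcutoff2 c r x = 0].
Proof.
move=> r0 h; have h1 : 1 <= cutarg c r x.
  rewrite /cutarg lerBrDr -lerBrDl (_ : 2 - 1 = 1); last by ring.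
  by rewrite ler_pdivrMr ?exprn_gt0// mul1r.
by rewrite /cutoff /dcutoff1 /dcutoff2 step1// dstep1// !mul0r.
Qed.

Lemma cutoff_out c r x : 0 < r -> 2 * r ^+ 2 <= (x.1 - c.1) ^+ 2 + (x.2 - c.2) ^+ 2 ->
  [/\ cutoff c r x = 0, dcutoff1 c r x = 0 & dcutoff2 c r x = 0].
Proof.
move=> r0 h; have h1 : cutarg c r x <= 0.
  by rewrite /cutarg subr_le0 ler_pdivlMr ?exprn_gt0.
by rewrite /cutoff /dcutoff1 /dcutoff2 step0// dstep0// !mul0r.
Qed.

Lemma cutoff_itv c r x : 0 <= cutoff c r x <= 1.
Proof. exact: step_itv. Qed.

(** On the support [dstep] is at most 4 and the argument has gradient at most
   [2 * sqrt 2 / r]; the square of the product is [128 / r ^+ 2]. *)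
Lemma dcutoff_le c r x : 0 < r -> dcutoff1 c r x ^+ 2 + dcutoff2 c r x ^+ 2 <= 128 / r ^+ 2.
Proof.
move=> r0; have r2 : 0 < r ^+ 2 by rewrite exprn_gt0.
have [h|h] := leP (2 * r ^+ 2) ((x.1 - c.1) ^+ 2 + (x.2 - c.2) ^+ 2).
  by have [_ -> ->] := cutoff_out r0 h; rewrite !expr0n addr0 divr_ge0// ltW.
have := dstep_itv (cutarg c r x); rewrite /dcutoff1 /dcutoff2.
set d := dstep _; set X := x.1 - c.1 in h *; set Y := x.2 - c.2 in h * => /andP[d0 d4].
have -> : (d * (- (2 * X) / r ^+ 2)) ^+ 2 + (d * (- (2 * Y) / r ^+ 2)) ^+ 2 =
  4 * d ^+ 2 * ((X ^+ 2 + Y ^+ 2) / r ^+ 2) / r ^+ 2 by field; rewrite gt_eqF.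
rewrite ler_pM2r ?invr_gt0//.
have h2 : (X ^+ 2 + Y ^+ 2) / r ^+ 2 <= 2 by rewrite ler_pdivrMr// ltW.
have h3 : 0 <= (X ^+ 2 + Y ^+ 2) / r ^+ 2 by rewrite divr_ge0 ?addr_ge0 ?sqr_ge0// ltW.
have d16 : d ^+ 2 <= 16 by nra.
have d20 : 0 <= d ^+ 2 by exact: sqr_ge0.
by nra.
Qed.

End cutoff.

(** * The divergence theorem *)

Section C1bar_algebra.
Context {R : realType}.
Variable Omega : set (plane R).
Implicit Types f g : plane R -> R.

Lemma C1barD f f1 f2 g g1 g2 : C1bar Omega f f1 f2 -> C1bar Omega g g1 g2 ->
  C1bar Omega (fun x => f x + g x) (fun x => f1 x + g1 x) (fun x => f2 x + g2 x).
Proof.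
move=> [cf cf1 cf2 Df] [cg cg1 cg2 Dg]; split; try exact: cont_onD.
move=> x Ox; have [d1 d2] := Df x Ox; have [e1 e2] := Dg x Ox.
by split; exact: is_deriveD.
Qed.

Lemma C1barN f f1 f2 : C1bar Omega f f1 f2 ->
  C1bar Omega (fun x => - f x) (fun x => - f1 x) (fun x => - f2 x).
Proof.
move=> [cf cf1 cf2 Df]; split; try exact: cont_onN.
by move=> x Ox; have [d1 d2] := Df x Ox; split; exact: is_deriveN.
Qed.

Lemma C1barM f f1 f2 g g1 g2 : C1bar Omega f f1 f2 -> C1bar Omega g g1 g2 ->
  C1bar Omega (fun x => f x * g x) (fun x => f1 x * g x + f x * g1 x)
    (fun x => f2 x * g x + f x * g2 x).
Proof.
move=> [cf cf1 cf2 Df] [cg cg1 cg2 Dg]; split; try by [exact: cont_onM|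
  apply: cont_onD; exact: cont_onM].
move=> x Ox; have [d1 d2] := Df x Ox; have [e1 e2] := Dg x Ox.
have h (w : plane R) a b : is_derive x w f a -> is_derive x w g b ->
    is_derive x w (fun x => f x * g x) (a * g x + f x * b).
  move=> ha hb; have H := is_deriveM ha hb.
  by apply: (@is_derive_eq _ _ _ _ _ _ _ _ H); rewrite -![_ *: _]/(_ * _); ring.
by split; exact: h.
Qed.

Lemma C1bar_cst (c : R) : C1bar Omega (fun=> c) (fun=> 0) (fun=> 0).
Proof. by split; try exact: cont_on_cst; move=> x _; split; exact: is_derive_cst. Qed.

End C1bar_algebra.

Section global_green.
Context {R : realType}.
Notation mu := (@lebesgue_measure R).
Notation area := (@plane_measure R).
Variables (Omega : set (plane R)) (nu : plane R -> plane R)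
  (sigma : {measure set (borel_plane R) -> \bar R}).
Hypotheses (oO : open Omega) (hnu : outward_unit_normal Omega nu)
  (hsigma : surface_measure Omega sigma) (smO : smooth_boundary Omega).

Let mO : measurable (Omega : set (borel_plane R)). Proof. exact: open_measurable_plane. Qed.

(** A field supported in a square inside the domain has no flux through the sides. *)
Lemma interior_locally_green z : Omega z -> exists N, nbhs z N /\ N `<=` Omega /\
  locally_green Omega nu sigma N.
Proof.
case: z => p q Oz; have /(@nbhs_normP R (plane R))[e /= e0 eO] := open_nbhs_nbhs (conj oO Oz).
pose r := e / 4; have r0 : 0 < r by rewrite divr_gt0.
have re : r * 4 = e by rewrite /r divfK.
pose N : set (plane R) := [set z | `|z.1 - p| <= r /\ `|z.2 - q| <= r].
pose I := `[p - 2 * r, p + 2 * r]%classic : set R.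
pose J := `[q - 2 * r, q + 2 * r]%classic : set R.
have IJO : I `*` J `<=` Omega.
  move=> [x y] [/=]; rewrite /I /J /= !in_itv/= => hx hy; apply: eO.
  by rewrite /ball_/= plane_normE/= gt_max !ltr_distl; move: hx hy r0 re; lra.
have NIJ : N `<=` I `*` J.
  by move=> [x y] [/= hx hy]; split; rewrite /I /J /= in_itv/=; move: hx hy;
    rewrite !ler_distl; move: r0; lra.
exists N; split.
  apply/(@nbhs_normP R (plane R)); exists r => //= -[x y]; rewrite /ball_/= plane_normE/= gt_max.
  by move=> /andP[hx hy]; split; rewrite /= distrC ltW.
split; first exact: subset_trans IJO.
move=> F1 a1 a2 F2 b1 b2 C1 C2 F0.
have closedN : closed N.
  have -> : N = `[p - r, p + r]%classic `*` `[q - r, q + r]%classic.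
    by apply/seteqP; split=> -[x y]; rewrite /N/= !in_itv/= !ler_distl => -[? ?]; split.
  by apply: compact_closed; [exact: norm_hausdorff|apply: compact_setX; exact: segment_compact].
have oN : open (~` N) by rewrite openC.
have D0 z : Omega z -> ~ N z -> a1 z = 0 /\ b2 z = 0.
  move=> Oz' nz; have [-> _] := C1bar_zero C1 oN (fun y ny => (F0 y ny).1) nz Oz'.
  by have [_ ->] := C1bar_zero C2 oN (fun y ny => (F0 y ny).2) nz Oz'.
have iD : area.-integrable Omega (EFin \o (fun z => a1 z + b2 z)).
  apply: (div_integrable oO C1 C2 (r := `|p| + `|q| + r)) => -[x y] nz; apply: F0 => -[/= hx hy].
  apply: nz; rewrite /box/= plane_normE/= ge_max.
  have := ler_normD (x - p) p; rewrite subrK => h1.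
  have := ler_normD (y - q) q; rewrite subrK => h2.
  by apply/andP; split; move: (normr_ge0 p) (normr_ge0 q) r0 hx hy h1 h2; lra.
have fr0 z : frontier Omega z -> F1 z = 0 /\ F2 z = 0.
  by move=> /(frontier_open oO)[_ nz]; apply: F0 => /NIJ/IJO.
have [i1 i2 i3] := @green_for0 _ Omega nu sigma oO F1 F2 (fun=> 0) (fun _ _ => erefl) fr0.
split=> //; rewrite -i3 Rintegral_cst// mul0r.
rewrite (@Rintegral_support _ _ _ area Omega (I `*` J)); last first.
  move=> z Oz' nz; have [|-> ->] := D0 z Oz'; last by rewrite addr0.
  by move=> /NIJ.
rewrite setIidr//.
have mI : measurable (I : set (measurableTypeR R)) by exact: measurable_itv.
have mJ : measurable (J : set (measurableTypeR R)) by exact: measurable_itv.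
have cIJ f : cont_on (closure Omega) f -> cont_on (I `*` J) (f : plane R -> R).
  by apply: cont_onS => z /IJO; exact: subset_closure.
have rect_int f : cont_on (closure Omega) f -> area.-integrable (I `*` J) (EFin \o f).
  move=> /cIJ cf; have cK : compact (I `*` J) by apply: compact_setX; exact: segment_compact.
  have [M [_ HM]] := compact_bounded cK.
  apply: (@cont_on_integrable _ (I `*` J) (I `*` J) f (M + 1)) => //.
  - exact: measurableX.
  - by apply: compact_closed => //; exact: norm_hausdorff.
  move=> z rz; have := HM (M + 1); rewrite ltrDl ltr01 => /(_ isT z rz) /=.
  by move=> zM; rewrite ltNge zM.
have sl1 f x : cont_on (closure Omega) f -> I x -> cont_on J (fun y => f (x, y) : R).
  move=> /cIJ cf Ix; apply: (@cont_on_comp _ _ _ _ (I `*` J) (fun y => (x, y)) f) => //.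
  move=> s _; apply: cvg_within_filter.
  have cx : {for s, continuous (fun y : R => y)} by exact: cvg_id.
  exact: (cvg_pair (cvg_cst _) cx).
have sl2 f y : cont_on (closure Omega) f -> J y -> cont_on I (fun x => f (x, y) : R).
  move=> /cIJ cf Jy; apply: (@cont_on_comp _ _ _ _ (I `*` J) (fun x => (x, y)) f) => //.
  move=> s _; apply: cvg_within_filter.
  have cx : {for s, continuous (fun y : R => y)} by exact: cvg_id.
  exact: (cvg_pair cx (cvg_cst _)).
have [cF1 ca1 _ DF1] := C1; have [cF2 _ cb2 DF2] := C2.
have mIJ : measurable (I `*` J : set (borel_plane R)) by exact: measurableX.
rewrite RintegralD//; [|exact: rect_int|exact: rect_int].
have plt c : c - 2 * r < c + 2 * r by move: r0; lra.
have -> : \int[area]_(z in I `*` J) a1 z = 0.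
  rewrite (Rintegral_prod2 mI mJ (rect_int _ ca1)); last first.
    by move=> y Jy; apply: cont_on_itv_integrable; exact: sl2.
  rewrite (@eq_Rintegral _ _ _ mu _ (fun=> 0)); first by rewrite Rintegral_cst// mul0r.
  move=> y /set_mem Jy.
  have -> : 0 = F1 (p + 2 * r, y) - F1 (p - 2 * r, y).
    by rewrite !(F0 _ _).1 ?subr0// => -[/=]; rewrite ler_distl; move: r0; lra.
  apply: (@Rintegral_ftc R _ _ (fun x => a1 (x, y)) (fun x => F1 (x, y)) (plt p)).
  - exact: sl2.
  - exact: sl2.
  move=> x xI; have Oxy : Omega (x, y).
    by apply: IJO; split=> //; rewrite /I/= in_itv/=; case/andP: xI => ? ?; apply/andP; split; exact: ltW.
  have := (DF1 _ Oxy).1; have -> : (x, y) = (0, y) + x *: ux R by rewrite plane_stepx/= add0r.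
  move=> /is_derive_line; congr is_derive; apply/funext => t.
  by rewrite plane_stepx/= add0r.
rewrite add0r (Rintegral_prod1 mI mJ (rect_int _ cb2)); last first.
  by move=> x Ix; apply: cont_on_itv_integrable; exact: sl1.
rewrite (@eq_Rintegral _ _ _ mu _ (fun=> 0)); first by rewrite Rintegral_cst// mul0r.
move=> x /set_mem Ix.
have -> : 0 = F2 (x, q + 2 * r) - F2 (x, q - 2 * r).
  by rewrite !(F0 _ _).2 ?subr0// => -[/= _]; rewrite ler_distl; move: r0; lra.
apply: (@Rintegral_ftc R _ _ (fun y => b2 (x, y)) (fun y => F2 (x, y)) (plt q)).
- exact: sl1.
- exact: sl1.
move=> y yJ; have Oxy : Omega (x, y).
  by apply: IJO; split=> //; rewrite /J/= in_itv/=; case/andP: yJ => ? ?; apply/andP; split; exact: ltW.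
have := (DF2 _ Oxy).2; have -> : (x, y) = (x, 0) + y *: uy R by rewrite plane_stepy/= add0r.
move=> /is_derive_line; congr is_derive; apply/funext => t.
by rewrite plane_stepy/= add0r.
Qed.

Lemma everywhere_locally_green (z : plane R) : exists N, nbhs z N /\ locally_green Omega nu sigma N /\
  exists A, [/\ measurable (A : set (borel_plane R)), frontier Omega `&` N `<=` A & (sigma A < +oo)%E].
Proof.
have [cz|nz] := pselect (closure Omega z); last first.
  exists (~` closure Omega); split.
    by apply: open_nbhs_nbhs; split=> //; rewrite openC; exact: closed_closure.
  split; first exact: outside_locally_green.
  exists set0; split; [exact: measurable0| |by rewrite measure0].
  by move=> x [/(frontier_open oO)[]].
have [Oz|nOz] := pselect (Omega z).
  have [N [nN [NO gN]]] := interior_locally_green Oz; exists N; split=> //; split=> //.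
  exists set0; split; [exact: measurable0| |by rewrite measure0].
  by move=> x [/(frontier_open oO)[_ nx] /NO].
have fz := open_frontier oO cz nOz.
have [rho [U [[oU Uz] sr OU gr]]] := smO fz.
have [N [nN [r Nr] gN]] := chart_of_defining oO oU Uz sr OU fz gr.
by exists N; split=> //; exact: (chart_locally_green oO hnu hsigma Nr gN).
Qed.

Let nb (z : plane R) : set (plane R) := sval (cid (everywhere_locally_green z)).
Let nb_nbhs (z : plane R) : nbhs z (nb z). Proof. by have [] := svalP (cid (everywhere_locally_green z)). Qed.
Let nb_green z : locally_green Omega nu sigma (nb z).
Proof. by have [_ []] := svalP (cid (everywhere_locally_green z)). Qed.
Let nb_fin z : exists A, [/\ measurable (A : set (borel_plane R)), frontier Omega `&` nb z `<=` A & (sigma A < +oo)%E].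
Proof. by have [_ []] := svalP (cid (everywhere_locally_green z)). Qed.

Let disc (c : plane R) (r : R) : set (plane R) :=
  [set x | (x.1 - c.1) ^+ 2 + (x.2 - c.2) ^+ 2 < r ^+ 2].

Let radius_ex (z : plane R) : exists r : R, 0 < r /\
  forall x, (x.1 - z.1) ^+ 2 + (x.2 - z.2) ^+ 2 < 2 * r ^+ 2 -> nb z x.
Proof.
have /(@nbhs_normP R (plane R))[e /= e0 eN] := nb_nbhs z.
exists (e / 2); split; first by rewrite divr_gt0.
move=> x h; apply: eN; rewrite /ball_/= plane_normE/= gt_max.
have h2 : (x.1 - z.1) ^+ 2 + (x.2 - z.2) ^+ 2 < e ^+ 2.
  apply: lt_le_trans h _; rewrite expr_div_n; move: (sqr_ge0 e); lra.
have sq (a : R) : a ^+ 2 < e ^+ 2 -> `|a| < e.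
  by move=> ae; rewrite -(@ltr_pXn2r _ 2)// ?nnegrE ?(ltW e0)// real_normK ?num_real.
apply/andP; split; rewrite distrC; apply: sq; apply: le_lt_trans h2.
  by rewrite lerDl sqr_ge0.
by rewrite lerDr sqr_ge0.
Qed.

Let radius (z : plane R) : R := sval (cid (radius_ex z)).
Let radius_gt0 z : 0 < radius z. Proof. by have [] := svalP (cid (radius_ex z)). Qed.
Let radius_nb z x : (x.1 - z.1) ^+ 2 + (x.2 - z.2) ^+ 2 < 2 * radius z ^+ 2 -> nb z x.
Proof. by have [_] := svalP (cid (radius_ex z)); exact. Qed.

Let box_cover r : exists l : seq (plane R), forall x, box r x ->
  exists2 c, c \in l & disc c (radius c) x.
Proof.
pose pplane : ptopologicalType := HB.pack (plane R).
have E : @compact (plane R) = @cover_compact (plane R) by exact: (@compact_cover pplane).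
have cK : @cover_compact (plane R) (box r) by rewrite -E; exact: compact_box.
case: (cK (plane R) setT (fun c => disc c (radius c))).
- move=> c _; have cq : continuous (fun x : plane R => (x.1 - c.1) ^+ 2 + (x.2 - c.2) ^+ 2).
    move=> x; apply: cvgD; rewrite ?expr2; apply: cvgM; apply: cvgB; try exact: cvg_cst;
      by [exact: cvg_fst|exact: cvg_snd].
  exact: (open_comp (f := fun x : plane R => (x.1 - c.1) ^+ 2 + (x.2 - c.2) ^+ 2) (D := [set y | y < radius c ^+ 2]) (fun x _ => cq x) (@open_lt R _)).
- move=> x _; exists x => //=; rewrite /disc/= !subrr !expr0n addr0 exprn_gt0//.
move=> D' _ cov; exists (finmap.enum_fset D') => x /cov[c cD xc].
by exists c.
Qed.

Lemma green_forD F1 F2 D G1 G2 E : green_for Omega nu sigma F1 F2 D ->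
  green_for Omega nu sigma G1 G2 E ->
  green_for Omega nu sigma (fun x => F1 x + G1 x) (fun x => F2 x + G2 x) (fun x => D x + E x).
Proof.
move=> [i1 j1 e1] [i2 j2 e2].
have mF := measurable_frontier Omega.
have FE : (fun z => (F1 z + G1 z) * (nu z).1 + (F2 z + G2 z) * (nu z).2) =
    (fun z => (F1 z * (nu z).1 + F2 z * (nu z).2) + (G1 z * (nu z).1 + G2 z * (nu z).2)).
  by apply/funext => z; ring.
rewrite /green_for FE; split.
- by have := integrableD mO i1 i2.
- by have := integrableD mF j1 j2.
have R1 := RintegralD mO i1 i2; have R2 := RintegralD mF j1 j2.
by rewrite [LHS]R1 [RHS]R2 [X in X + _ = _]e1 [X in _ + X = _]e2.
Qed.

(** Localisation: near the first disc of the cover the field is [cutoff * F]; the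
   rest [(1 - cutoff) * F] lives on the remaining discs. *)
Let green_list (l : seq (plane R)) F1 a1 a2 F2 b1 b2 :
  C1bar Omega F1 a1 a2 -> C1bar Omega F2 b1 b2 ->
  (forall x, (forall c, c \in l -> ~ disc c (radius c) x) -> F1 x = 0 /\ F2 x = 0) ->
  green_for Omega nu sigma F1 F2 (fun x => a1 x + b2 x).
Proof.
elim: l F1 a1 a2 F2 b1 b2 => [|c l IH] F1 a1 a2 F2 b1 b2 C1 C2 F0.
  have H x : F1 x = 0 /\ F2 x = 0 by apply: F0.
  apply: green_for0 => // x Ox.
  have [-> _] := C1bar_zero C1 oO (fun y _ => (H y).1) Ox Ox.
  by have [_ ->] := C1bar_zero C2 oO (fun y _ => (H y).2) Ox Ox; rewrite addr0.
have Cc := cutoff_C1bar c (radius c) Omega.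
have Ck := C1barD (C1bar_cst Omega 1) (C1barN Cc).
have H1 z : ~ nb c z -> cutoff c (radius c) z * F1 z = 0 /\ cutoff c (radius c) z * F2 z = 0.
  move=> nx; have [|-> _ _] := @cutoff_out _ c (radius c) z (radius_gt0 c); last by rewrite !mul0r.
  by rewrite leNgt; apply/negP => /radius_nb.
have H2 x : (forall c, c \in l -> ~ disc c (radius c) x) ->
    (1 + - cutoff c (radius c) x) * F1 x = 0 /\ (1 + - cutoff c (radius c) x) * F2 x = 0.
  move=> nx; have [xc|nxc] := pselect (disc c (radius c) x).
    have [-> _ _] := cutoff_in (radius_gt0 c) (ltW xc).
    by rewrite subrr !mul0r.
  have [|-> ->] := F0 x; last by rewrite !mulr0.
  by move=> c'; rewrite inE => /predU1P[->//|c'l]; exact: nx.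
have G1 := nb_green (C1barM Cc C1) (C1barM Cc C2) H1.
have G2 := IH _ _ _ _ _ _ (C1barM Ck C1) (C1barM Ck C2) H2.
have := green_forD G1 G2.
have -> : (fun x => cutoff c (radius c) x * F1 x + (1 + - cutoff c (radius c) x) * F1 x) = F1.
  by apply/funext => x; ring.
have -> : (fun x => cutoff c (radius c) x * F2 x + (1 + - cutoff c (radius c) x) * F2 x) = F2.
  by apply/funext => x; ring.
congr green_for; apply/funext => x; ring.
Qed.

(** The domain may be unbounded: finitely many discs cover the support of the field. *)
Theorem divergence_theorem F1 a1 a2 F2 b1 b2 r :
  C1bar Omega F1 a1 a2 -> C1bar Omega F2 b1 b2 ->
  (forall x, ~ box r x -> F1 x = 0 /\ F2 x = 0) ->
  green_for Omega nu sigma F1 F2 (fun x => a1 x + b2 x).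
Proof.
move=> C1 C2 F0; have [l Hl] := box_cover r.
apply: (green_list C1 C2 (l := l)) => x nx; apply: F0 => /Hl[c cl xc].
exact: nx cl xc.
Qed.

Lemma surface_measure_box r : (sigma (frontier Omega `&` box r) < +oo)%E.
Proof.
have mF := measurable_frontier Omega.
have [l Hl] := box_cover r.
have [A [mA HA fA]] : exists A, [/\ measurable (A : set (borel_plane R)),
    (forall x c, frontier Omega x -> c \in l -> disc c (radius c) x -> A x) & (sigma A < +oo)%E].
  elim: l {Hl} => [|c l [A [mA HA fA]]].
    by exists set0; split; [exact: measurable0| |rewrite measure0].
  have [B [mB HB fB]] := nb_fin c.
  exists (A `|` B); split.
  - exact: measurableU.
  - move=> x c' fx; rewrite inE => /predU1P[->|c'l] xc; last by left; exact: HA xc.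
    right; apply: HB; split=> //; apply: radius_nb.
    by apply: lt_le_trans xc _; rewrite ler_peMl ?sqr_ge0// ler1n.
  by apply: le_lt_trans (measureU2 _ mA mB) _; rewrite lte_add_pinfty.
apply: le_lt_trans fA; apply: le_measure; rewrite ?inE//.
  by apply: measurableI => //; exact: measurable_box.
by move=> x [fx /Hl[c cl xc]]; exact: HA fx cl xc.
Qed.

(** Fubini's theorem on the product of the boundary with a time interval rests on this. *)
Lemma surface_measure_sigma_finite : sigma_finite setT sigma.
Proof.
have mF := measurable_frontier Omega.
have mB r : measurable (box r : set (borel_plane R)) by exact: measurable_box.
exists (fun n => (~` frontier Omega) `|` (frontier Omega `&` box n%:R)).
  apply/seteqP; split=> // x _.
  have [fx|nfx] := pselect (frontier Omega x); last by exists 0%N => //; left.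
  exists (Num.truncn `|x|).+1 => //; right; split=> //.
  by rewrite /box/= ltW// truncnS_gt.
move=> n; split.
  by apply: measurableU; [exact: measurableC|exact: measurableI].
apply: le_lt_trans (measureU2 _ _ _) _.
- exact: measurableC.
- exact: measurableI.
have [s0 _] := hsigma; rewrite [X in (X + _)%E]s0 add0e; exact: surface_measure_box.
Qed.

End global_green.

(** * The vorticity equation *)

Section derive_transfer.
Context {R : realType} {V W : normedModType R}.

Lemma is_derive_open (O : set V) (f g : V -> W) z w d : open O ->
  (forall y, O y -> f y = g y) -> O z -> is_derive z w f d -> is_derive z w g d.
Proof.
move=> oO fg Oz [D <-]; have [->|w0] := eqVneq w 0.
  by rewrite derive0; exact: is_derive0.
have n : \forall y \near z, f y = g y by apply: filterS (open_nbhs_nbhs (conj oO Oz)).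
apply: DeriveDef; first exact: near_eq_derivable D.
apply: near_eq_derive => //; by apply: filterS n => y ->.
Qed.

End derive_transfer.

Section slices.
Context {R : realType}.
Implicit Types (f : spacetime R -> R) (x : plane R) (s : R).

Lemma is_derive_space_slice f x s (w : plane R) d :
  is_derive (x, s) (w, 0) f d -> is_derive x w (fun y => f (y, s)) d.
Proof.
have E : (fun h : R => h^-1 *: (((fun y => f (y, s)) \o shift x) (h *: w) - f (x, s))) =
  (fun h : R => h^-1 *: ((f \o shift (x, s)) (h *: (w, 0)) - f (x, s))).
  apply/funext => h /=; congr (_ *: (f _ - _)).
  by rewrite -[RHS]/(h *: w + x, h * 0 + s) mulr0 add0r.
by move=> [D v]; split; [move: D|move: v]; rewrite /derivable /derive E.
Qed.

Lemma is_derive_time_slice f x s d :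
  is_derive (x, s) (et R) f d -> is_derive s 1 (fun r => f (x, r)) d.
Proof.
have E : (fun h : R => h^-1 *: (((fun r => f (x, r)) \o shift s) (h *: (1 : R)) - f (x, s))) =
  (fun h : R => h^-1 *: ((f \o shift (x, s)) (h *: et R) - f (x, s))).
  apply/funext => h /=; congr (_ *: (f _ - _)).
  case: x => x1 x2; rewrite -[RHS]/((h * 0 + x1, h * 0 + x2), h * 1 + s) mulr0 !add0r.
  by [].
by move=> [D v]; split; [move: D|move: v]; rewrite /derivable /derive E.
Qed.

End slices.

Section solution.
Context {R : realType}.
Variables (Omega : set (plane R)) (T : R) (v : spacetime R -> plane R)
  (p : spacetime R -> R).
Hypotheses (oO : open Omega) (T0 : 0 < T).
Hypothesis hv : smooth_bounded_solution Omega T (fun=> 0) v p.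

Let I : set (spacetime R) := Omega `*` `]0, T[.
Let Q : set (spacetime R) := closure Omega `*` `[0, T[.

Let IQ : I `<=` Q.
Proof.
move=> [x s] [/= Ox]; rewrite in_itv/= => /andP[s0 sT]; split; first exact: subset_closure.
by rewrite /= in_itv/= sT andbT ltW.
Qed.

Let oI : open I.
Proof.
rewrite openE => -[x s] [/= Ox Ts]; exists (Omega, `]0, T[%classic) => //; split=> /=.
  exact: open_nbhs_nbhs.
by apply: open_nbhs_nbhs; split=> //; exact: interval_open.
Qed.

Let ext_ex (l : seq (spacetime R)) : exists g : spacetime R -> plane R,
  [/\ cont_on Q g, {in I, g =1 Defs.iterD l v} & l = [::] -> g = v].
Proof.
have [_ cv H] := sol_smooth hv; case: l => [|w l].
  by exists v; split=> //; exact/cont_onP.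
by have [g [/cont_onP cg gE]] := H (w :: l); exists g.
Qed.

(** [ext l] extends the iterated derivative of the velocity along [l] continuously to
   the closed domain and to the initial time. *)
Definition ext (l : seq (spacetime R)) : spacetime R -> plane R := sval (cid (ext_ex l)).
Definition ext1 l z : R := (ext l z).1.
Definition ext2 l z : R := (ext l z).2.

Lemma ext_cont l : cont_on Q (ext l).
Proof. by have [] := svalP (cid (ext_ex l)). Qed.
Lemma extE l z : I z -> ext l z = Defs.iterD l v z.
Proof. by move=> Iz; have [_ E _] := svalP (cid (ext_ex l)); exact/E/mem_set. Qed.
Lemma ext_nil : ext [::] = v.
Proof. by have [_ _] := svalP (cid (ext_ex [::])); apply. Qed.

Lemma ext1_cont l : cont_on Q (ext1 l).
Proof. by move=> z Qz; have H := @ext_cont l z Qz; apply: (@cvg_comp _ _ _ (ext l) fst _ _ _ H); exact: cvg_fst. Qed.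
Lemma ext2_cont l : cont_on Q (ext2 l).
Proof. by move=> z Qz; have H := @ext_cont l z Qz; apply: (@cvg_comp _ _ _ (ext l) snd _ _ _ H); exact: cvg_snd. Qed.

Lemma ext_is_derive l z w : I z -> is_derive z w (ext l) (ext (w :: l) z).
Proof.
move=> Iz; rewrite [ext (w :: l) z]extE//=; apply: (is_derive_open oI (f := Defs.iterD l v)) => //.
  by move=> y Iy; rewrite extE.
by have [sm _ _] := sol_smooth hv; apply: derivableP; have [+ _] := sm l z Iz.
Qed.

Lemma ext1_is_derive l z w : I z -> is_derive z w (ext1 l) (ext1 (w :: l) z).
Proof. by move=> Iz; exact: is_derive_fst (ext_is_derive l w Iz). Qed.
Lemma ext2_is_derive l z w : I z -> is_derive z w (ext2 l) (ext2 (w :: l) z).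
Proof. by move=> Iz; exact: is_derive_snd (ext_is_derive l w Iz). Qed.

Let near_I (P : spacetime R -> Prop) z : I z -> (forall y, I y -> P y) -> \forall y \near z, P y.
Proof. by move=> Iz h; apply: filterS (open_nbhs_nbhs (conj oI Iz)). Qed.

Lemma cont_at f z : cont_on Q f -> I z -> {for z, continuous (f : spacetime R -> R)}.
Proof. by move=> cf Iz; apply: cont_on_at cf _; apply: filterS IQ _; exact: open_nbhs_nbhs. Qed.

Lemma ext1_swap l z u w : I z -> ext1 (u :: w :: l) z = ext1 (w :: u :: l) z.
Proof.
move=> Iz; apply: (@clairaut _ _ (ext1 l) (ext1 (w :: l)) (ext1 (u :: l))
  (ext1 (u :: w :: l)) (ext1 (w :: u :: l)) w u z).
- by apply: near_I => // y Iy; exact: ext1_is_derive.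
- by apply: near_I => // y Iy; exact: ext1_is_derive.
- by apply: near_I => // y Iy; exact: ext1_is_derive.
- by apply: near_I => // y Iy; exact: ext1_is_derive.
- by apply: cont_at => //; exact: ext1_cont.
- by apply: cont_at => //; exact: ext1_cont.
Qed.

Lemma ext2_swap l z u w : I z -> ext2 (u :: w :: l) z = ext2 (w :: u :: l) z.
Proof.
move=> Iz; apply: (@clairaut _ _ (ext2 l) (ext2 (w :: l)) (ext2 (u :: l))
  (ext2 (u :: w :: l)) (ext2 (w :: u :: l)) w u z).
- by apply: near_I => // y Iy; exact: ext2_is_derive.
- by apply: near_I => // y Iy; exact: ext2_is_derive.
- by apply: near_I => // y Iy; exact: ext2_is_derive.
- by apply: near_I => // y Iy; exact: ext2_is_derive.
- by apply: cont_at => //; exact: ext2_cont.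
- by apply: cont_at => //; exact: ext2_cont.
Qed.

Let derive_unique (f g : spacetime R -> R) z w a b : (forall y, I y -> f y = g y) -> I z ->
  is_derive z w f a -> is_derive z w g b -> a = b.
Proof.
move=> fg Iz Df [_ <-]; have := is_derive_open oI fg Iz Df.
by move=> [_ <-].
Qed.

Lemma ext1_swap_in c l z u w : I z -> ext1 (c :: u :: w :: l) z = ext1 (c :: w :: u :: l) z.
Proof.
move=> Iz; apply: (derive_unique (w := c) _ Iz); last exact: ext1_is_derive.
  by move=> y Iy; exact: ext1_swap.
exact: ext1_is_derive.
Qed.

Lemma ext2_swap_in c l z u w : I z -> ext2 (c :: u :: w :: l) z = ext2 (c :: w :: u :: l) z.
Proof.
move=> Iz; apply: (derive_unique (w := c) _ Iz); last exact: ext2_is_derive.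
  by move=> y Iy; exact: ext2_swap.
exact: ext2_is_derive.
Qed.

Notation E1 := (e1 R).
Notation E2 := (e2 R).
Notation Et := (et R).

Lemma ext_div z : I z -> ext1 [:: E1] z + ext2 [:: E2] z = 0.
Proof. by move=> Iz; rewrite /ext1 /ext2 !extE//=; exact: (sol_divergence hv Iz). Qed.

Lemma ext_div_derive w z : I z -> ext1 [:: w; E1] z + ext2 [:: w; E2] z = 0.
Proof.
move=> Iz; have D := is_deriveD (ext1_is_derive [:: E1] w Iz) (ext2_is_derive [:: E2] w Iz).
apply: (derive_unique (w := w) _ Iz D (is_derive_cst 0 z w)).
by move=> y Iy; exact: ext_div.
Qed.

Let q1 z := - (ext1 [:: Et] z - (ext1 [:: E1; E1] z + ext1 [:: E2; E2] z)
  + (ext1 [::] z * ext1 [:: E1] z + ext2 [::] z * ext1 [:: E2] z)).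
Let q2 z := - (ext2 [:: Et] z - (ext2 [:: E1; E1] z + ext2 [:: E2; E2] z)
  + (ext1 [::] z * ext2 [:: E1] z + ext2 [::] z * ext2 [:: E2] z)).

Let momentum z : I z -> 'D_E1 p z = q1 z /\ 'D_E2 p z = q2 z.
Proof.
move=> Iz; have H := sol_momentum hv Iz.
rewrite /q1 /q2 /ext1 /ext2 !extE//=.
have H1 := congr1 fst H; have H2 := congr1 snd H.
split; apply/eqP; rewrite eq_sym -subr_eq0 -oppr_eq0 opprB opprK addrC; apply/eqP.
  exact: H1.
exact: H2.
Qed.

(** The first derivatives of the pressure along the axes are thus differentiable, which is
   what Clairaut's theorem needs to eliminate the pressure. *)
Lemma pressure_gradient z : I z -> is_derive z E1 p (q1 z) /\ is_derive z E2 p (q2 z).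
Proof.
move=> Iz; have [<- <-] := momentum Iz; have [d1 d2] := sol_pressure hv Iz.
by split; exact: derivableP.
Qed.

Let dq1 w z := - (ext1 [:: w; Et] z - (ext1 [:: w; E1; E1] z + ext1 [:: w; E2; E2] z)
  + ((ext1 [:: w] z * ext1 [:: E1] z + ext1 [::] z * ext1 [:: w; E1] z)
    + (ext2 [:: w] z * ext1 [:: E2] z + ext2 [::] z * ext1 [:: w; E2] z))).
Let dq2 w z := - (ext2 [:: w; Et] z - (ext2 [:: w; E1; E1] z + ext2 [:: w; E2; E2] z)
  + ((ext1 [:: w] z * ext2 [:: E1] z + ext1 [::] z * ext2 [:: w; E1] z)
    + (ext2 [:: w] z * ext2 [:: E2] z + ext2 [::] z * ext2 [:: w; E2] z))).

Let is_deriveMR (f g : spacetime R -> R) z w a b : is_derive z w f a -> is_derive z w g b ->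
  is_derive z w (fun y => f y * g y) (a * g z + f z * b).
Proof.
move=> ha hb; have H := is_deriveM ha hb.
by apply: (@is_derive_eq _ _ _ _ _ _ _ _ H); rewrite -![_ *: _]/(_ * _); ring.
Qed.

Let q1_derive w z : I z -> is_derive z w q1 (dq1 w z).
Proof.
move=> Iz; apply: is_deriveN; apply: is_deriveD.
  apply: is_deriveB; first exact: ext1_is_derive.
  by apply: is_deriveD; exact: ext1_is_derive.
by apply: is_deriveD; apply: is_deriveMR; try exact: ext1_is_derive; exact: ext2_is_derive.
Qed.

Let q2_derive w z : I z -> is_derive z w q2 (dq2 w z).
Proof.
move=> Iz; apply: is_deriveN; apply: is_deriveD.
  apply: is_deriveB; first exact: ext2_is_derive.
  by apply: is_deriveD; exact: ext2_is_derive.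
by apply: is_deriveD; apply: is_deriveMR; try exact: ext1_is_derive; exact: ext2_is_derive.
Qed.

Let curl_pressure z : I z -> dq1 E2 z = dq2 E1 z.
Proof.
move=> Iz; apply: (@clairaut _ _ p q1 q2 (dq1 E2) (dq2 E1) E1 E2 z).
- by apply: near_I => // y /pressure_gradient[].
- by apply: near_I => // y /pressure_gradient[].
- by apply: near_I => // y; exact: q1_derive.
- by apply: near_I => // y; exact: q2_derive.
- apply: cont_at => //; apply: cont_onN; apply: cont_onD.
    apply: cont_onB; first exact: ext1_cont.
    by apply: cont_onD; exact: ext1_cont.
  by apply: cont_onD; apply: cont_onD; apply: cont_onM; try exact: ext1_cont; exact: ext2_cont.
- apply: cont_at => //; apply: cont_onN; apply: cont_onD.
    apply: cont_onB; first exact: ext2_cont.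
    by apply: cont_onD; exact: ext2_cont.
  by apply: cont_onD; apply: cont_onD; apply: cont_onM; try exact: ext1_cont; exact: ext2_cont.
Qed.

(** Through the extensions [vort l] is continuous up to the boundary and to the initial time,
   for every list [l] of directions of derivation. *)
Definition vort l z : R := ext2 (rcons l E1) z - ext1 (rcons l E2) z.

Lemma vort_cont l : cont_on Q (vort l).
Proof. by apply: cont_onB; [exact: ext2_cont|exact: ext1_cont]. Qed.

Lemma vort_is_derive l z w : I z -> is_derive z w (vort l) (vort (w :: l) z).
Proof. by move=> Iz; apply: is_deriveB; [exact: ext2_is_derive|exact: ext1_is_derive]. Qed.

Lemma vortE z : I z -> vort [::] z = omega v z.
Proof. by move=> Iz; rewrite /vort /ext1 /ext2 !extE. Qed.

Lemma vort_deriveE w z : I z -> vort [:: w] z = 'D_w (omega v) z.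
Proof.
move=> Iz; have := is_derive_open oI vortE Iz (vort_is_derive [::] w Iz).
by move=> [_ <-].
Qed.

(** The curl of the momentum equation.  In the plane there is no stretching term, as it is a
   multiple of the divergence. *)
Lemma vorticity_equation z : I z ->
  vort [:: Et] z = vort [:: E1; E1] z + vort [:: E2; E2] z
    - (ext1 [::] z * vort [:: E1] z + ext2 [::] z * vort [:: E2] z).
Proof.
move=> Iz; have C := curl_pressure Iz; have D := ext_div Iz.
have s1 : ext2 [:: E1; Et] z = ext2 [:: Et; E1] z by exact: ext2_swap.
have s2 : ext1 [:: E2; Et] z = ext1 [:: Et; E2] z by exact: ext1_swap.
have s3 : ext2 [:: E1; E2; E2] z = ext2 [:: E2; E2; E1] z by rewrite ext2_swap// ext2_swap_in.
have s4 : ext1 [:: E2; E1; E1] z = ext1 [:: E1; E1; E2] z by rewrite ext1_swap// ext1_swap_in.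
have s5 : ext2 [:: E1; E2] z = ext2 [:: E2; E1] z by exact: ext2_swap.
have s6 : ext1 [:: E2; E1] z = ext1 [:: E1; E2] z by exact: ext1_swap.
move: C; rewrite /dq1 /dq2 /vort /= s1 s2 s3 s4 s5 s6 => C.
have Dn : ext2 [:: E2] z = - ext1 [:: E1] z by apply/eqP; rewrite eq_sym -subr_eq0 -opprD oppr_eq0 D.
move: C; rewrite Dn => C.
apply/eqP; rewrite -subr_eq0; apply/eqP.
move/eqP: C; rewrite -subr_eq0 => /eqP C.
by rewrite -[RHS]C; ring.
Qed.

(** No vorticity at the initial time: otherwise the velocity would keep a difference
   quotient away from 0 as the time decreases to 0. *)
Let init_derive (w : plane R) x : Omega x -> ext [:: (w, 0)] (x, 0) = 0.
Proof.
move=> Ox.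
have key (f g : spacetime R -> R) : cont_on Q f -> cont_on Q g ->
    (forall y, Omega y -> f (y, 0) = 0) ->
    (forall z, I z -> is_derive z (w, 0) f (g z)) -> g (x, 0) = 0.
  move=> cf cg f0 D; apply/eqP; apply: contraT => g0.
  pose a := `|g (x, 0)|; have a0 : 0 < a by rewrite normr_gt0.
  have Q0 y : Omega y -> Q (y, 0).
    by move=> Oy; split => /=; [exact: subset_closure|rewrite in_itv/= lexx].
  have a2 : 0 < a / 2 by rewrite divr_gt0.
  have := @cvgr_dist_lt _ _ _ _ _ _ _ (cg _ (Q0 x Ox)) _ a2.
  move=> H; have {}H : \forall z \near (x, (0 : R)), Q z -> `|g (x, 0) - g z| < a / 2 by exact: H.
  have [d1 /= d10 Hd1] := (@nbhs_normP R (spacetime R) _ _).1 H.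
  have [d2 /= d20 Hd2] := (@nbhs_normP R (plane R) _ _).1 (open_nbhs_nbhs (conj oO Ox)).
  pose d := Num.min (Num.min d1 d2) T; have d0 : 0 < d by rewrite !lt_min d10 d20.
  have dT : d <= T by rewrite ge_min lexx orbT.
  have dd1 : d <= d1 by rewrite !ge_min lexx.
  have dd2 : d <= d2 by rewrite !ge_min lexx orbT.
  pose h := d / (2 * (1 + `|w|)).
  have w1 : 0 < 1 + `|w| by rewrite ltr_pwDl.
  have h0 : 0 < h by rewrite divr_gt0// mulr_gt0.
  have hw c : 0 <= c <= h -> `|x - (x + c *: w)| < d.
    move=> /andP[c0 ch]; rewrite opprD addNKr normrN normrZ ger0_norm//.
    apply: (@le_lt_trans _ _ (h * (1 + `|w|))).
      by rewrite mulrDr mulr1 ler_wpDl ?(ltW h0)// ler_wpM2r.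
    rewrite /h invfM mulrA -mulrA mulVf ?gt_eqF// mulr1.
    by rewrite ltr_pdivrMr// ltr_pMr// ltr1n.
  have Ow c : 0 <= c <= h -> Omega (x + c *: w).
    by move=> ch; apply: Hd2; rewrite /ball_/=; exact: lt_le_trans (hw c ch) dd2.
  have bound s : 0 < s < d -> h * (a / 2) <= `|f (x + h *: w, s) - f (x, s)|.
    move=> /andP[s0 sd].
    have Is c : 0 <= c <= h -> I (x + c *: w, s).
      by move=> ch; split; [exact: Ow|rewrite /= in_itv/= s0 (lt_le_trans sd)].
    have [||c ch E] := @mvt_line R _ (fun y => f (y, s)) (fun y => g (y, s)) x w 0 h.
    - exact: ltW.
    - by move=> c ch; apply: is_derive_space_slice; exact/D/Is.
    move: E; rewrite scale0r addr0 subr0 => ->; rewrite normrM [`|h|]gtr0_norm// mulrC.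
    rewrite ler_wpM2r ?(ltW h0)//.
    have : `|g (x, 0) - g (x + c *: w, s)| < a / 2.
      apply: Hd1; last by apply: IQ; exact: Is.
      rewrite /ball_/= -[X in `|X|]/(x - (x + c *: w), 0 - s) [`|_|]/(Num.max _ _) gt_max.
      rewrite (lt_le_trans (hw c ch) dd1) /= sub0r normrN gtr0_norm//.
      exact: lt_le_trans dd1.
    have := ler_normB (g (x, 0)) (g (x, 0) - g (x + c *: w, s)).
    by rewrite subKr => h1 h2; have := lerB_dist (g (x, 0)) (g (x + c *: w, s)); rewrite -/a; lra.
  have lim y : Omega y -> \forall s \near (0 : R), 0 < s -> s < T -> `|f (y, s)| < h * (a / 2) / 2.
    move=> Oy; have e0 : 0 < h * (a / 2) / 2 by rewrite !divr_gt0// mulr_gt0// divr_gt0.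
    have := @cvgr_dist_lt _ _ _ _ _ _ _ (cf _ (Q0 y Oy)) _ e0.
    move=> H'; have {}H' : \forall z \near (y, (0 : R)), Q z -> `|f (y, 0) - f z| < h * (a / 2) / 2 by exact: H'.
    have c : {for (0 : R), continuous (fun s : R => (y, s))}.
      have c1 : {for (0:R), continuous (fun s : R => s)} by exact: cvg_id.
      exact: (cvg_pair (cvg_cst _) c1).
    have n0 : \forall s \near (0 : R), Q (y, s) -> `|f (y, 0) - f (y, s)| < h * (a / 2) / 2.
      exact: (c _ H').
    apply: filterS n0 => s Hs s0 sT; have := Hs _; rewrite f0// sub0r normrN; apply.
    by split; [exact: subset_closure|rewrite /= in_itv/=; apply/andP; split=> //; exact: ltW].
  have n1 := lim x Ox.
  have Oxh : Omega (x + h *: w) by apply: Ow; rewrite (ltW h0) lexx.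
  have n2 := lim _ Oxh.
  have : \forall s \near (0 : R)^'+, False.
    near=> s.
    have s0 : 0 < s by [].
    have sd : s < d by near: s; exact: nbhs_right_lt.
    have sT : s < T by exact: lt_le_trans sd dT.
    have b1 : `|f (x, s)| < h * (a / 2) / 2.
      by apply: (near (near_0right n1) s).
    have b2 : `|f (x + h *: w, s)| < h * (a / 2) / 2.
      by apply: (near (near_0right n2) s).
    have := bound s; rewrite s0 sd => /(_ isT).
    by have := ler_normB (f (x + h *: w, s)) (f (x, s)); lra.
  by move=> /filter_ex[].
have v0 y : Omega y -> v (y, 0) = 0 by move=> Oy; exact: (sol_initial hv Oy).
have k1 : ext1 [:: (w, 0)] (x, 0) = 0.
  apply: (key (ext1 [::])); [exact: ext1_cont|exact: ext1_cont| |].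
    by move=> y Oy; rewrite /ext1 ext_nil v0.
  by move=> z Iz; exact: ext1_is_derive.
have k2 : ext2 [:: (w, 0)] (x, 0) = 0.
  apply: (key (ext2 [::])); [exact: ext2_cont|exact: ext2_cont| |].
    by move=> y Oy; rewrite /ext2 ext_nil v0.
  by move=> z Iz; exact: ext2_is_derive.
by rewrite [LHS]surjective_pairing -/(ext1 _ _) -/(ext2 _ _) k1 k2.
Unshelve. all: by end_near. Qed.

Lemma vort_initial x : Omega x -> vort [::] (x, 0) = 0.
Proof.
by move=> Ox; rewrite /vort /ext1 /ext2 /= (init_derive (ux R) Ox) (init_derive (uy R) Ox) subrr.
Qed.

Lemma space_slice_C1bar (f f1 f2 : spacetime R -> R) s : 0 < s < T ->
  cont_on Q f -> cont_on Q f1 -> cont_on Q f2 ->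
  (forall z, I z -> is_derive z E1 f (f1 z) /\ is_derive z E2 f (f2 z)) ->
  C1bar Omega (fun x => f (x, s)) (fun x => f1 (x, s)) (fun x => f2 (x, s)).
Proof.
move=> /andP[s0 sT] cf cf1 cf2 D.
have c (g : spacetime R -> R) : cont_on Q g -> cont_on (closure Omega) (fun x => g (x, s)).
  move=> cg; apply: (@cont_on_comp _ _ _ _ Q (fun x => (x, s)) g) => //.
    by move=> x Ox; split=> //=; rewrite in_itv/= sT andbT; exact: ltW.
  move=> x _; apply: cvg_within_filter.
  have cx : {for x, continuous (fun y : plane R => y)} by exact: cvg_id.
  exact: (cvg_pair cx (cvg_cst _)).
split; [exact: c|exact: c|exact: c|].
move=> x Ox; have Ixs : I (x, s) by split=> //=; rewrite in_itv/= s0.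
by have [d1 d2] := D _ Ixs; split; exact: is_derive_space_slice.
Qed.

Lemma trace_ext (f : spacetime R -> R) (g : spacetime R -> R) x s : 0 < s < T ->
  closure Omega x -> cont_on Q g -> (forall z, I z -> f z = g z) ->
  trace Omega f (x, s) = g (x, s).
Proof.
move=> /andP[s0 sT] cx cg fg; rewrite /trace /=.
have Qxs : Q (x, s) by split=> //=; rewrite in_itv/= sT andbT; exact: ltW.
have PF : ProperFilter (within Omega (nbhs x)) by exact: within_nbhs_proper.
apply/cvg_lim => //.
have cs : (fun y => g (y, s)) @ within Omega (nbhs x) --> g (x, s).
  have cgs : cont_on (closure Omega) (fun x => g (x, s)).
    apply: (@cont_on_comp _ _ _ _ Q (fun x => (x, s)) g) => //.
      by move=> y Oy; split=> //=; rewrite in_itv/= sT andbT; exact: ltW.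
    move=> y _; apply: cvg_within_filter.
    have cy : {for y, continuous (fun y : plane R => y)} by exact: cvg_id.
    exact: (cvg_pair cy (cvg_cst _)).
  apply: cvg_trans (cgs x cx); apply: cvg_app.
  by apply: within_subset; exact: subset_closure.
apply: cvg_trans cs; apply: near_eq_cvg; near=> y.
apply/esym/fg; split; last by rewrite /= in_itv/= s0.
by near: y; exact: withinT.
Unshelve. all: by end_near. Qed.

End solution.

(** * Integration in space-time *)

Section measure_tools.
Context {d : measure_display} {T : measurableType d} {R : realType}.
Variable m : {measure set T -> \bar R}.

Lemma Rintegral_ge_const (A B : set T) (f : T -> R) (k : R) :
  measurable A -> measurable B -> B `<=` A -> m.-integrable A (EFin \o f) ->
  (m B < +oo)%E -> (forall x, A x -> 0 <= f x) -> (forall x, B x -> k <= f x) ->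
  k * fine (m B) <= \int[m]_(x in A) f x.
Proof.
move=> mA mB BA fi Bfin f0 fk.
have fB : m.-integrable B (EFin \o f) by exact: integrableS fi.
apply: (@le_trans _ _ (\int[m]_(x in B) f x)).
  rewrite -Rintegral_cst//; apply: le_Rintegral => //.
  exact: (@integrable_bounded _ _ _ _ _ (fun=> k) `|k|).
have -> : \int[m]_(x in B) f x = \int[m]_(x in A) (f \_ B) x.
  by rewrite -Rintegral_mkcondr setIidr.
apply: le_Rintegral => //.
  rewrite -restrict_EFin; apply/(integrable_restrict m mB mA).
  by rewrite setIidr.
move=> x Ax; rewrite patchE; case: ifPn => // _; exact: f0.
Qed.

End measure_tools.

Section sigma_finite_alias.
Context {d : measure_display} {T : measurableType d} {R : realType}.
Variables (m : {measure set T -> \bar R}) (H : sigma_finite setT m).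

(** The measure [m] itself, on which instance inference finds its sigma-finiteness. *)
Definition sigma_finite_copy of sigma_finite setT m : set T -> \bar R := m.
HB.instance Definition _ := Measure.on (sigma_finite_copy H).
Let copy_sigma_finite : sigma_finite setT (sigma_finite_copy H).
Proof. exact: H. Qed.
HB.instance Definition _ := @Measure_isSigmaFinite.Build _ _ _
  (sigma_finite_copy H) copy_sigma_finite.

End sigma_finite_alias.

Section prod2.
Context {d1 d2 : measure_display} {T1 : measurableType d1} {T2 : measurableType d2}.
Context {R : realType}.
Variables (m1 : {sigma_finite_measure set T1 -> \bar R})
  (m2 : {sigma_finite_measure set T2 -> \bar R}).

Lemma integral_prod2 (X : set T1) (Y : set T2) (f : T1 * T2 -> \bar R) :
  measurable X -> measurable Y -> (m1 \x m2)%E.-integrable (X `*` Y) f ->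
  (\int[m1 \x m2]_(z in X `*` Y) f z = \int[m2]_(y in Y) \int[m1]_(x in X) f (x, y))%E.
Proof.
move=> mX mY fint.
have gint : (m1 \x m2)%E.-integrable setT (f \_ (X `*` Y)).
  by rewrite -(integrable_mkcond f)//; exact: measurableX.
rewrite [LHS]integral_mkcond -(integral21_prod_meas1 gint) [RHS]integral_mkcond.
apply: eq_integral => y _; rewrite /fubini_G patchE; case: ifPn => [/set_mem Yy|/negP nY].
  rewrite [RHS]integral_mkcond; apply: eq_integral => x _; rewrite !patchE.
  case: ifPn => [/set_mem[/= Xx _]|/negP nXY]; first by rewrite mem_set.
  rewrite ifF//; apply/negP => /set_mem Xx; apply: nXY; exact/mem_set.
apply: integral0_eq => x _; rewrite patchE ifF//.
by apply/negP => /set_mem[/= _ Yy]; apply: nY; exact/mem_set.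
Qed.

End prod2.

(** * Constants on connected sets and cut-offs at the origin *)

Section connected_constant.
Context {R : realType}.

Lemma constant_on_segment {V : normedModType R} (f : V -> R) z w (h : R) :
  (forall c : R, `|c| <= `|h| -> is_derive (z + c *: w) w f 0) -> f (z + h *: w) = f z.
Proof.
move=> D; apply/eqP; rewrite -subr_eq0.
have [h0|h0] := leP 0 h.
  have [c ch|c _] := @mvt_line R V f (fun=> 0) z w 0 h h0.
    by apply: D; case/andP: ch => c0 ch; rewrite !ger0_norm.
  by rewrite scale0r addr0 mul0r => ->.
have [c ch|c _] := @mvt_line R V f (fun=> 0) z w h 0 (ltW h0).
  by apply: D; case/andP: ch => hc c0; rewrite !ler0_norm ?lerN2// ltW.
by rewrite scale0r addr0 mul0r -opprB oppr_eq0 => ->.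
Qed.

(** The function is constant on squares, by the mean value theorem along their sides, so that
   its level sets are open and closed. *)
Lemma connected_constant (Omega : set (plane R)) (f : plane R -> R) : open Omega ->
  connected Omega ->
  (forall x, Omega x -> is_derive x (ux R) f 0 /\ is_derive x (uy R) f 0) ->
  forall x y, Omega x -> Omega y -> f y = f x.
Proof.
move=> oO cO D x y Ox Oy.
have loc z : Omega z -> exists2 d : R, 0 < d &
    forall y, `|z - y| < d -> Omega y /\ f y = f z.
  move=> Oz; have [d /= d0 dO] := (@nbhs_normP R (plane R) _ _).1 (open_nbhs_nbhs (conj oO Oz)).
  exists d => // w; rewrite plane_normE gt_max => /andP[/= w1 w2].
  have In a b : `|z.1 - a| < d -> `|z.2 - b| < d -> Omega (a, b).
    by move=> za zb; apply: dO; rewrite /ball_/= plane_normE gt_max; apply/andP.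
  split; first by case: w w1 w2 => a b; exact: In.
  have E1 : f (w.1, z.2) = f z.
    have := @constant_on_segment _ f z (ux R) (w.1 - z.1); rewrite plane_stepx subrKC; apply.
    move=> c cw; rewrite plane_stepx; apply: (D _ _).1; apply: In; last by rewrite subrr normr0.
    by rewrite opprD addNKr normrN (le_lt_trans cw)// distrC.
  rewrite -E1; have := @constant_on_segment _ f (w.1, z.2) (uy R) (w.2 - z.2).
  rewrite plane_stepy/= subrKC -surjective_pairing; apply.
  move=> c cw; rewrite plane_stepy/=; apply: (D _ _).2; apply: In => //.
  by rewrite opprD addNKr normrN (le_lt_trans cw)// distrC.
have op (P : R -> Prop) : open [set z | Omega z /\ P (f z)].
  rewrite openE => z [Oz Pz]; apply/(@nbhs_normP R (plane R)).
  have [d d0 H] := loc z Oz; exists d => // w /= /H[Ow E]; split=> //.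
  by rewrite /mkset E.
suff E : [set z | Omega z /\ f z = f x] = Omega.
  by move: Oy; rewrite -E => -[].
apply: cO; first by exists x.
  exists [set z | Omega z /\ f z = f x]; first exact: (op (fun c => c = f x)).
  by apply/seteqP; split=> z; [move=> []|move=> [_ []]].
exists (~` [set z | Omega z /\ f z <> f x]).
  by apply: open_closedC; exact: (op (fun c => c <> f x)).
apply/seteqP; split=> z [Oz H]; split=> //; first by move=> [_]; apply.
by apply: contrapT => fz; apply: H.
Qed.

End connected_constant.

Section cutoff_at_origin.
Context {R : realType}.
Implicit Types (x : plane R) (r : R).

Definition bump r x : R := cutoff (0, 0) r x.
Definition dbump1 r x : R := dcutoff1 (0, 0) r x.
Definition dbump2 r x : R := dcutoff2 (0, 0) r x.

Lemma bump_C1bar r Omega : C1bar Omega (bump r) (dbump1 r) (dbump2 r).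
Proof. exact: cutoff_C1bar. Qed.

Lemma bump_itv r x : 0 <= bump r x <= 1.
Proof. exact: cutoff_itv. Qed.

Lemma bump_in r x : 0 < r -> enorm x <= r -> [/\ bump r x = 1, dbump1 r x = 0 & dbump2 r x = 0].
Proof.
move=> r0 xr; apply: cutoff_in => //=; rewrite !subr0 -sqr_enorm.
by rewrite ler_sqr ?nnegrE ?enorm_ge0// ltW.
Qed.

Lemma bump_out r x : 0 < r -> 2 * r <= enorm x ->
  [/\ bump r x = 0, dbump1 r x = 0 & dbump2 r x = 0].
Proof.
move=> r0 xr; apply: cutoff_out => //=; rewrite !subr0 -sqr_enorm.
have : (2 * r) ^+ 2 <= enorm x ^+ 2.
  by rewrite ler_sqr ?nnegrE ?enorm_ge0// mulr_ge0// ltW.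
by have := sqr_ge0 r; rewrite exprMn; lra.
Qed.

Lemma bump_box r x : 0 < r -> ~ box (2 * r) x ->
  [/\ bump r x = 0, dbump1 r x = 0 & dbump2 r x = 0].
Proof.
move=> r0 /negP; rewrite -ltNge => xr; apply: bump_out => //.
by apply: ltW; apply: lt_le_trans xr _; exact: norm_le_enorm.
Qed.

Lemma dbump_le r x : 0 < r -> dbump1 r x ^+ 2 + dbump2 r x ^+ 2 <= 128 / r ^+ 2.
Proof. exact: dcutoff_le. Qed.

End cutoff_at_origin.

Section eq_green.
Context {R : realType}.
Variables (Omega : set (plane R)) (nu : plane R -> plane R)
  (sigma : {measure set (borel_plane R) -> \bar R}).

Lemma green_for_eq F1 F2 D D' G : open Omega -> green_for Omega nu sigma F1 F2 D ->
  (forall z, Omega z -> D z = D' z) ->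
  (forall z, frontier Omega z -> F1 z * (nu z).1 + F2 z * (nu z).2 = G z) ->
  [/\ (@plane_measure R).-integrable Omega (EFin \o D'),
      sigma.-integrable (frontier Omega) (EFin \o G) &
      \int[@plane_measure R]_(z in Omega) D' z = \int[sigma]_(z in frontier Omega) G z].
Proof.
move=> oO [iD iF E] ED EF.
have mO : measurable (Omega : set (borel_plane R)) by exact: open_measurable_plane.
have mF := measurable_frontier Omega.
split.
- by apply: eq_integrable iD => // z /set_mem Oz /=; rewrite ED.
- by apply: eq_integrable iF => // z /set_mem Oz /=; rewrite EF.
transitivity (\int[@plane_measure R]_(z in Omega) D z).
  by apply: eq_Rintegral => z /set_mem /ED.
by rewrite E; apply: eq_Rintegral => z /set_mem /EF.
Qed.

End eq_green.

Section cutoff_errors.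
Context {R : realFieldType}.

(** Young's inequality absorbs the mixed term in half of the gradient term.  Here [i] is the
   inverse of the cut-off radius, [128 * i ^+ 2] the bound for the gradient of the cut-off,
   and [w ^+ 2 <= e * i] the decay of the vorticity. *)
Lemma cutoff_error (b b1 b2 w w1 w2 wt v1 v2 e M i : R) :
  0 <= b <= 1 -> 0 <= i <= 1 -> 0 <= e -> 0 <= M -> b1 ^+ 2 + b2 ^+ 2 <= 128 * i ^+ 2 ->
  v1 ^+ 2 + v2 ^+ 2 <= M ^+ 2 -> w ^+ 2 <= e * i ->
  2^-1 * (b ^+ 2 * (w1 ^+ 2 + w2 ^+ 2)) + b ^+ 2 * (w * wt) - e * (256 + 12 * M) * i ^+ 2 <=
  b ^+ 2 * (w1 ^+ 2 + w2 ^+ 2) + b ^+ 2 * (w * wt)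
  + 2 * b * (b1 * (w * w1) + b2 * (w * w2)) - w ^+ 2 * b * (b1 * v1 + b2 * v2).
Proof.
move=> /andP[b0 bl] /andP[i0 i1] e0 M0 hb hv hw.
have young (y z : R) : - (2^-1 * y ^+ 2) - 2 * z ^+ 2 <= 2 * (y * z).
  by have := sqr_ge0 (y + 2 * z); rewrite (_ : (y + 2 * z) ^+ 2 = y ^+ 2 + 4 * (y * z) + 4 * z ^+ 2); [lra|ring].
have y1 := young (b * w1) (b1 * w); have y2 := young (b * w2) (b2 * w).
have hgw : (b1 ^+ 2 + b2 ^+ 2) * w ^+ 2 <= 128 * e * i ^+ 2.
  apply: (le_trans (ler_pM _ _ hb hw)); rewrite ?addr_ge0 ?sqr_ge0//.
  rewrite (_ : 128 * i ^+ 2 * (e * i) = 128 * e * i ^+ 2 * i); last by ring.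
  by rewrite ler_piMr// !mulr_ge0// exprn_ge0.
have cs : `|b1 * v1 + b2 * v2| <= 12 * M * i.
  rewrite -ler_sqr ?nnegrE ?normr_ge0 ?mulr_ge0// real_normK ?num_real//.
  apply: (@le_trans _ _ ((b1 ^+ 2 + b2 ^+ 2) * (v1 ^+ 2 + v2 ^+ 2))).
    have := sqr_ge0 (b1 * v2 - b2 * v1).
    rewrite (_ : (b1 * v1 + b2 * v2) ^+ 2 = (b1 ^+ 2 + b2 ^+ 2) * (v1 ^+ 2 + v2 ^+ 2) - (b1 * v2 - b2 * v1) ^+ 2); last by ring.
    by move=> ?; lra.
  apply: (le_trans (ler_pM _ _ hb hv)); rewrite ?addr_ge0 ?sqr_ge0//.
  rewrite (_ : (12 * M * i) ^+ 2 = 144 * i ^+ 2 * M ^+ 2); last by ring.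
  by rewrite ler_wpM2r ?sqr_ge0// ler_wpM2r ?sqr_ge0// ler_nat.
have drift : w ^+ 2 * b * (b1 * v1 + b2 * v2) <= 12 * e * M * i ^+ 2.
  apply: (@le_trans _ _ (w ^+ 2 * `|b1 * v1 + b2 * v2|)).
    rewrite -mulrA ler_wpM2l ?sqr_ge0//.
    apply: (le_trans (ler_norm _)); rewrite normrM ger0_norm// ler_piMl//.
  apply: (le_trans (ler_pM _ _ hw cs)); rewrite ?sqr_ge0//.
  by rewrite (_ : e * i * (12 * M * i) = 12 * e * M * i ^+ 2) //; ring.
have -> : b ^+ 2 * (w1 ^+ 2 + w2 ^+ 2) = (b * w1) ^+ 2 + (b * w2) ^+ 2 by ring.
have -> : 2 * b * (b1 * (w * w1) + b2 * (w * w2)) = 2 * (b * w1 * (b1 * w)) + 2 * (b * w2 * (b2 * w)) by ring.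
have E : (b1 ^+ 2 + b2 ^+ 2) * w ^+ 2 = (b1 * w) ^+ 2 + (b2 * w) ^+ 2 by ring.
rewrite E in hgw.
have -> : e * (256 + 12 * M) * i ^+ 2 = 2 * (128 * e * i ^+ 2) + 12 * e * M * i ^+ 2 by ring.
lra.
Qed.
End cutoff_errors.

Section square.
Context {R : realType}.

Lemma lebesgue_itv_centered (a d : R) : 0 < d ->
  @lebesgue_measure R `]a - d, a + d[%classic = (2 * d)%:E.
Proof.
move=> d0; rewrite lebesgue_measure_itv/= lte_fin ltrD2l gtrN// -EFinD; congr EFin; ring.
Qed.

Lemma plane_measure_square (x : plane R) (d : R) : 0 < d ->
  let C := `]x.1 - d, x.1 + d[%classic `*` `]x.2 - d, x.2 + d[%classic in
  measurable (C : set (borel_plane R)) /\ @plane_measure R C = ((2 * d) ^+ 2)%:E.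
Proof.
move=> d0 C.
have mI (a b : R) : measurable (`]a, b[%classic : set (measurableTypeR R)) by exact: measurable_itv.
split; first exact: measurableX.
by rewrite /plane_measure /C product_measure1E//= !lebesgue_itv_centered.
Qed.

End square.

(** * The energy balance of the vorticity *)

Section energy.
Context {R : realType}.
Variables (Omega : set (plane R)) (T t : R) (nu : plane R -> plane R)
  (sigma : {measure set (borel_plane R) -> \bar R})
  (v : spacetime R -> plane R) (p : spacetime R -> R).
Hypotheses (oO : open Omega) (smO : smooth_boundary Omega)
  (hnu : outward_unit_normal Omega nu) (hsigma : surface_measure Omega sigma).
Hypothesis hv : smooth_bounded_solution Omega T (fun=> 0) v p.
Hypothesis ht : 0 < t < T.

Notation area := (@plane_measure R).
Notation lambda := (@lebesgue_measure R).
Notation E1 := (e1 R).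
Notation E2 := (e2 R).
Notation Et := (et R).

Let w := vort hv [::].
Let w1 := vort hv [:: E1].
Let w2 := vort hv [:: E2].
Let wt := vort hv [:: Et].
Let v1 := ext1 hv [::].
Let v2 := ext2 hv [::].

(** The divergence of [psi^2 (w grad w - w^2 v / 2)], with [psi] the cut-off and [w] the
   vorticity, after the Laplacian of [w] is eliminated by the vorticity equation.  On the
   boundary [v] vanishes, and the flux of the field is [psi^2] times the vorticity flux. *)
Definition energy_density r (z : spacetime R) : R :=
  bump r z.1 ^+ 2 * (w1 z ^+ 2 + w2 z ^+ 2) + bump r z.1 ^+ 2 * (w z * wt z)
  + 2 * bump r z.1 * (dbump1 r z.1 * (w z * w1 z) + dbump2 r z.1 * (w z * w2 z))
  - w z ^+ 2 * bump r z.1 * (dbump1 r z.1 * v1 z + dbump2 r z.1 * v2 z).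

Let Q : set (spacetime R) := closure Omega `*` `[0, T[.

Lemma energy_slice r s : 0 < r -> 0 < s < T ->
  [/\ area.-integrable Omega (EFin \o (fun x => energy_density r (x, s))),
      sigma.-integrable (frontier Omega)
        (EFin \o (fun x => bump r x ^+ 2 * vorticity_flux Omega nu v (x, s))) &
      \int[area]_(x in Omega) energy_density r (x, s) =
      \int[sigma]_(x in frontier Omega) (bump r x ^+ 2 * vorticity_flux Omega nu v (x, s))].
Proof.
move=> r0 sT; have [s0 sT'] := andP sT.
have Cw : C1bar Omega (fun x => w (x, s)) (fun x => w1 (x, s)) (fun x => w2 (x, s)).
  apply: (space_slice_C1bar (f := w) (f1 := w1) (f2 := w2) sT); try exact: vort_cont.
  by move=> z Iz; split; exact: vort_is_derive.
have Cw1 : C1bar Omega (fun x => w1 (x, s)) (fun x => vort hv [:: E1; E1] (x, s))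
    (fun x => vort hv [:: E2; E1] (x, s)).
  apply: (space_slice_C1bar (f := w1) sT); try exact: vort_cont.
  by move=> z Iz; split; exact: vort_is_derive.
have Cw2 : C1bar Omega (fun x => w2 (x, s)) (fun x => vort hv [:: E1; E2] (x, s))
    (fun x => vort hv [:: E2; E2] (x, s)).
  apply: (space_slice_C1bar (f := w2) sT); try exact: vort_cont.
  by move=> z Iz; split; exact: vort_is_derive.
have Cv1 : C1bar Omega (fun x => v1 (x, s)) (fun x => ext1 hv [:: E1] (x, s))
    (fun x => ext1 hv [:: E2] (x, s)).
  apply: (space_slice_C1bar (f := v1) sT); try exact: ext1_cont.
  by move=> z Iz; split; exact: ext1_is_derive.
have Cv2 : C1bar Omega (fun x => v2 (x, s)) (fun x => ext2 hv [:: E1] (x, s))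
    (fun x => ext2 hv [:: E2] (x, s)).
  apply: (space_slice_C1bar (f := v2) sT); try exact: ext2_cont.
  by move=> z Iz; split; exact: ext2_is_derive.
have Cb2 := C1barM (bump_C1bar r Omega) (bump_C1bar r Omega).
have Chalf := C1bar_cst Omega (2^-1 : R).
have F (u u1 u2 y y1 y2 : plane R -> R) Cu Cy := C1barM Cb2 (C1barD (@C1barM _ _ _ _ _ u u1 u2 Cw Cu)
  (C1barN (C1barM Chalf (C1barM (C1barM Cw Cw) (Cy : C1bar Omega y y1 y2))))).
have := divergence_theorem oO hnu hsigma smO (F _ _ _ _ _ _ Cw1 Cv1) (F _ _ _ _ _ _ Cw2 Cv2) (r := 2 * r).
move=> /(_ _)/green_for_eq; apply => //.
- by move=> x /(bump_box r0)[-> _ _]; rewrite !mul0r.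
- move=> x Ox; have Iz : (Omega `*` `]0, T[) (x, s) by split=> //=; rewrite in_itv.
  have Eq := vorticity_equation oO hv Iz; have D := ext_div hv Iz.
  have D' : ext2 hv [:: E2] (x, s) = - ext1 hv [:: E1] (x, s).
    by apply/eqP; rewrite eq_sym -subr_eq0 -opprD oppr_eq0 D.
  have Eq' : vort hv [:: E2; E2] (x, s) = wt (x, s) - vort hv [:: E1; E1] (x, s)
      + (v1 (x, s) * w1 (x, s) + v2 (x, s) * w2 (x, s)).
    rewrite /wt Eq -/v1 -/v2 -/w1 -/w2; move: (v1 _) (v2 _) (w1 _) (w2 _) (vort hv _ _) => ? ? ? ? ?; ring.
  move: Eq' D'; rewrite /energy_density/=.
  move: (w (x, s)) (w1 (x, s)) (w2 (x, s)) (wt (x, s)) (v1 (x, s)) (v2 (x, s)).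
  move: (bump r x) (dbump1 r x) (dbump2 r x) (ext1 hv [:: E1] (x, s)) (ext2 hv [:: E2] (x, s)).
  move: (vort hv [:: E1; E1] (x, s)) (vort hv [:: E2; E2] (x, s)).
  move=> x11 x22 b b1 b2 a1 a2 y y1 y2 yt u1 u2 -> ->; by field.
- move=> x Fx; have [cx _] := frontier_open oO Fx.
  have v0 := sol_no_slip hv Fx sT.
  have v10 : v1 (x, s) = 0 by rewrite /v1 /ext1 ext_nil v0.
  have v20 : v2 (x, s) = 0 by rewrite /v2 /ext2 ext_nil v0.
  have t1 : trace Omega ('D_E1 (omega v)) (x, s) = w1 (x, s).
    apply: (trace_ext sT cx (@vort_cont _ _ _ _ _ hv [:: E1])) => z Iz.
    by rewrite -(vort_deriveE oO hv).
  have t2 : trace Omega ('D_E2 (omega v)) (x, s) = w2 (x, s).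
    apply: (trace_ext sT cx (@vort_cont _ _ _ _ _ hv [:: E2])) => z Iz.
    by rewrite -(vort_deriveE oO hv).
  have t0 : trace Omega (omega v) (x, s) = w (x, s).
    apply: (trace_ext sT cx (@vort_cont _ _ _ _ _ hv [::])) => z Iz.
    by rewrite -(vortE hv).
  have fl : vorticity_flux Omega nu v (x, s) =
      (w1 (x, s) * (nu x).1 + w2 (x, s) * (nu x).2) * w (x, s).
    exact: (congr2 *%R (congr2 +%R (congr2 *%R t1 erefl) (congr2 *%R t2 erefl)) t0).
  rewrite fl; move: v10 v20.
  move: (w (x, s)) (w1 (x, s)) (w2 (x, s)) (v1 (x, s)) (v2 (x, s)) (bump r x).
  by move=> ? ? ? ? ? ? -> ->; ring.
Qed.

Let bump_cont r : [/\ cont_on Q (fun z => bump r z.1), cont_on Q (fun z => dbump1 r z.1)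
  & cont_on Q (fun z => dbump2 r z.1)].
Proof.
have [c c1 c2 _] := bump_C1bar r (setT : set (plane R)).
have H (f : plane R -> R) : cont_on (closure setT) f -> cont_on Q (fun z => f z.1).
  move=> cf; apply: (@cont_on_comp _ _ _ Q (closure setT) fst f) => //.
    by move=> z _; exact: subset_closure.
  by apply: continuous_cont_on => z; exact: cvg_fst.
by split; exact: H.
Qed.

Lemma energy_density_cont r : cont_on Q (energy_density r).
Proof.
have [cb cb1 cb2] := bump_cont r.
have [cw cw1 cw2 cwt] : [/\ cont_on Q w, cont_on Q w1, cont_on Q w2 & cont_on Q wt].
  by split; exact: vort_cont.
have cv1 : cont_on Q v1 by exact: ext1_cont.
have cv2 : cont_on Q v2 by exact: ext2_cont.
have c2 : cont_on Q (fun=> 2 : R) by exact: cont_on_cst.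
apply: cont_onB.
  apply: cont_onD.
    apply: cont_onD; apply: cont_onM; try exact: cont_on_sqr.
      by apply: cont_onD; exact: cont_on_sqr.
    exact: cont_onM.
  apply: cont_onM; first exact: cont_onM.
  by apply: cont_onD; apply: cont_onM => //; exact: cont_onM.
apply: cont_onM; first by apply: cont_onM => //; exact: cont_on_sqr.
by apply: cont_onD; exact: cont_onM.
Qed.

Lemma spacetime_integrable (f : spacetime R -> R) r : cont_on Q f ->
  (forall x s, ~ box r x -> f (x, s) = 0) ->
  (area \x lambda)%E.-integrable (Omega `*` `]0, t[) (EFin \o f).
Proof.
move=> cf f0; have /andP[t0 tT] := ht.
apply: (@cont_on_integrable_spacetime _ _ (closure Omega) f r).
- exact: open_measurable_plane.
- exact: closed_closure.
- exact: subset_closure.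
- apply: cont_onS cf => -[x s] [/= cx]; rewrite !in_itv/= => /andP[s0 st].
  by split=> //=; rewrite in_itv/= s0 (le_lt_trans st).
by move=> x s _ _ xr; apply: f0 => /=; apply/negP; rewrite -ltNge.
Qed.

Let energy_density_out r x s : 0 < r -> ~ box (2 * r) x -> energy_density r (x, s) = 0.
Proof.
move=> r0 /(bump_box r0)[b b1 b2]; rewrite /energy_density/= b b1 b2.
by move: (w _) (w1 _) (w2 _) (wt _) (v1 _) (v2 _) => ? ? ? ? ? ?; ring.
Qed.

Lemma time_slice_cont (f : spacetime R -> R) x : closure Omega x -> cont_on Q f ->
  cont_on (`[0, t]%classic : set R) (fun s => f (x, s)).
Proof.
move=> cx cg; have /andP[t0 tT] := ht.
apply: (@cont_on_comp _ _ _ _ Q (fun s => (x, s)) f) => //.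
  move=> s; rewrite /= in_itv/= => /andP[s0 st]; split=> //=.
  by rewrite in_itv/= s0 (le_lt_trans st).
move=> s _; apply: cvg_within_filter.
have cs : {for s, continuous (fun s : R => s)} by exact: cvg_id.
exact: (cvg_pair (cvg_cst _) cs).
Qed.

(** The time derivative only contributes the final enstrophy, as the initial one is 0. *)
Lemma time_part_ge0 r : 0 < r ->
  0 <= \int[(area \x lambda)%E]_(z in Omega `*` `]0, t[) (bump r z.1 ^+ 2 * (w z * wt z)).
Proof.
move=> r0; have /andP[t0 tT] := ht; have [cb _ _] := bump_cont r.
have cf : cont_on Q (fun z => bump r z.1 ^+ 2 * (w z * wt z)).
  by apply: cont_onM; [exact: cont_on_sqr|apply: cont_onM; exact: vort_cont].
have mi : measurable (`]0, t[%classic : set (measurableTypeR R)) by exact: measurable_itv.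
have sliceI (f : spacetime R -> R) x : Omega x -> cont_on Q f ->
    lambda.-integrable `[0, t] (EFin \o (fun s => f (x, s))).
  by move=> Ox cg; apply: cont_on_itv_integrable; apply: time_slice_cont => //; exact: subset_closure.
rewrite (@Rintegral_prod1 _ _ _ _ R area lambda).
- apply: Rintegral_ge0 => x Ox.
  pose h s := 2^-1 * (bump r x ^+ 2 * w (x, s) ^+ 2).
  suff -> : \int[lambda]_(s in `]0, t[) (bump r x ^+ 2 * (w (x, s) * wt (x, s))) = h t - h 0.
    rewrite /h /w (vort_initial oO (lt_trans t0 tT) hv Ox) expr0n/= !mulr0 subr0.
    by apply: mulr_ge0; [rewrite invr_ge0|apply: mulr_ge0; exact: sqr_ge0].
  have fi := sliceI _ x Ox cf.
  have fio : lambda.-integrable `]0, t] (EFin \o (fun s => bump r x ^+ 2 * (w (x, s) * wt (x, s)))).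
    by apply: integrableS fi => //; apply: subset_itv; rewrite bnd_simp.
  rewrite Rintegral_itv_bndo_bndc; last first.
    by apply: integrableS fi => //; apply: subset_itv; rewrite bnd_simp.
  rewrite Rintegral_itv_obnd_cbnd//.
  have cw' (f : spacetime R -> R) : cont_on Q f -> cont_on (`[0, t]%classic : set R) (fun s => f (x, s)).
    by apply: time_slice_cont; exact: subset_closure.
  apply: (@Rintegral_ftc R 0 t (fun s => bump r x ^+ 2 * (w (x, s) * wt (x, s))) h t0).
  - exact: (cw' _ cf).
  - apply: cont_onM; first exact: cont_on_cst.
    apply: cont_onM; first exact: cont_on_cst.
    by apply: (cw' (fun z => w z ^+ 2)); apply: cont_on_sqr; exact: vort_cont.
  move=> s /andP[s0 st].
  have Iz : (Omega `*` `]0, T[) (x, s) by split=> //=; rewrite in_itv/= s0 (lt_trans st).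
  have D := is_derive_time_slice (vort_is_derive oO hv [::] Et Iz).
  have DD := is_deriveM D D.
  have H := is_deriveZ (2^-1 * bump r x ^+ 2) DD.
  have -> : h = (2^-1 * bump r x ^+ 2) *: (fun s => w (x, s) * w (x, s)).
    by apply/funext => u; rewrite /h -[RHS]/(2^-1 * bump r x ^+ 2 * (w (x, u) * w (x, u))) expr2 mulrA.
  apply: (@is_derive_eq _ _ _ _ _ _ _ _ H).
  rewrite -![_ *: _]/(_ * _) -/w -/(wt _).
  by move: (w _) (wt _) (bump _ _) => ? ? ?; field.
- exact: open_measurable_plane.
- exact: mi.
- apply: (spacetime_integrable cf (r := 2 * r)) => x s /(bump_box r0)[-> _ _].
  by rewrite expr0n mul0r.
move=> x Ox; apply: integrableS (sliceI _ x Ox cf) => //.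
by apply: subset_itv; rewrite bnd_simp.
Qed.

Let A : set (borel_plane R * measurableTypeR R) := Omega `*` `]0, t[.

Let mA : measurable A.
Proof. by apply: measurableX; [exact: open_measurable_plane|exact: measurable_itv]. Qed.

(** The errors of the cut-off live on a square of area [16 * r ^+ 2] and have size
   [e / r ^+ 2]: decay of the vorticity like [|x|^(-1/2)] is exactly what bounds their
   integral by a multiple of [e]. *)
Lemma energy_lower r e M (B : set (borel_plane R * measurableTypeR R)) a :
  1 <= r -> 0 <= e -> 0 <= M ->
  (forall z, A z -> v1 z ^+ 2 + v2 z ^+ 2 <= M ^+ 2) ->
  (forall z, A z -> r <= enorm z.1 -> enorm z.1 * w z ^+ 2 <= e) ->
  measurable B -> B `<=` A -> (forall z, B z -> enorm z.1 <= r /\ a <= w1 z ^+ 2 + w2 z ^+ 2) ->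
  ((area \x lambda)%E B < +oo)%E ->
  2^-1 * a * fine ((area \x lambda)%E B) - 16 * t * (256 + 12 * M) * e <=
  \int[(area \x lambda)%E]_(z in A) energy_density r z.
Proof.
move=> r1 e0 M0 hM he mB BA hB Bfin; have /andP[t0 tT] := ht.
have r0 : 0 < r by exact: lt_le_trans r1.
have [cb cb1 cb2] := bump_cont r.
pose D : set (borel_plane R * measurableTypeR R) := box (2 * r) `*` setT.
have mD : measurable D by apply: measurableX => //; exact: measurable_box.
have mAD : measurable (A `&` D) by exact: measurableI.
pose G1 (z : spacetime R) := 2^-1 * (bump r z.1 ^+ 2 * (w1 z ^+ 2 + w2 z ^+ 2)).
pose G2 (z : spacetime R) := bump r z.1 ^+ 2 * (w z * wt z).
pose K := e * (256 + 12 * M) * r^-1 ^+ 2.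
have K0 : 0 <= K.
  apply: mulr_ge0; last exact: sqr_ge0.
  by apply: mulr_ge0 => //; apply: addr_ge0; [exact: ler0n|apply: mulr_ge0 => //; exact: ler0n].
have I1 : (area \x lambda)%E.-integrable A (EFin \o G1).
  apply: (@spacetime_integrable G1 (2 * r)); last first.
    by move=> x s /(bump_box r0)[b _ _]; rewrite /G1/= b expr0n mul0r mulr0.
  apply: cont_onM; first exact: cont_on_cst.
  apply: cont_onM; first exact: cont_on_sqr.
  by apply: cont_onD; apply: cont_on_sqr; exact: vort_cont.
have I2 : (area \x lambda)%E.-integrable A (EFin \o G2).
  apply: (@spacetime_integrable G2 (2 * r)); last first.
    by move=> x s /(bump_box r0)[b _ _]; rewrite /G2/= b expr0n mul0r.
  by apply: cont_onM; [exact: cont_on_sqr|apply: cont_onM; exact: vort_cont].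
have IP : (area \x lambda)%E.-integrable A (EFin \o energy_density r).
  apply: (@spacetime_integrable _ (2 * r)); first exact: energy_density_cont.
  by move=> x s; exact: energy_density_out.
have ADfin : ((area \x lambda)%E (A `&` D) <= (16 * r ^+ 2 * t)%:E)%E.
  have mb : measurable (box (2 * r) : set (borel_plane R)) by exact: measurable_box.
  have mi : measurable (`]0, t[%classic : set (measurableTypeR R)) by exact: measurable_itv.
  apply: (@le_trans _ _ ((area \x lambda)%E (box (2 * r) `*` `]0, t[%classic))).
    apply: le_measure; rewrite ?inE//; first exact: measurableX.
    by move=> [x s] [[/= _ st] [/= xb _]].
  have /= -> := @product_measure1E _ _ _ _ R area lambda _ _ mb mi.
  have r20 : 0 <= 2 * r by rewrite mulr_ge0// ltW.
  rewrite plane_measure_box// /= lebesgue_measure_itv/= lte_fin t0 -EFinD -EFinM lee_fin.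
  by rewrite subr0 (_ : (2 * (2 * r)) ^+ 2 = 16 * r ^+ 2)//; ring.
have ADfin' : ((area \x lambda)%E (A `&` D) < +oo)%E by exact: le_lt_trans ADfin (ltry _).
have IK : (area \x lambda)%E.-integrable (A `&` D) (EFin \o (fun=> K)).
  by apply: (@integrable_bounded _ _ _ _ _ (fun=> K) `|K|).
have J1 : (area \x lambda)%E.-integrable (A `&` D) (EFin \o G1).
  by apply: integrableS I1 => //; exact: subIsetl.
have J2 : (area \x lambda)%E.-integrable (A `&` D) (EFin \o G2).
  by apply: integrableS I2 => //; exact: subIsetl.
have JP : (area \x lambda)%E.-integrable (A `&` D) (EFin \o energy_density r).
  by apply: integrableS IP => //; exact: subIsetl.
have J12 : (area \x lambda)%E.-integrable (A `&` D) (EFin \o (fun z => G1 z + G2 z)).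
  exact: (integrableD mAD J1 J2).
have supp (f : spacetime R -> R) : (forall x s, ~ box (2 * r) x -> f (x, s) = 0) ->
    \int[(area \x lambda)%E]_(z in A) f z = \int[(area \x lambda)%E]_(z in A `&` D) f z.
  by move=> f0; apply: Rintegral_support => -[x s] _ nD; apply: f0 => xb; apply: nD.
have L1 : 2^-1 * a * fine ((area \x lambda)%E B) <= \int[(area \x lambda)%E]_(z in A `&` D) G1 z.
  rewrite -supp; last by move=> x s /(bump_box r0)[b _ _]; rewrite /G1/= b expr0n mul0r mulr0.
  apply: Rintegral_ge_const => //.
    move=> z _; apply: mulr_ge0; first by rewrite invr_ge0.
    by apply: mulr_ge0; [exact: sqr_ge0|apply: addr_ge0; exact: sqr_ge0].
  move=> z /hB[zr az]; rewrite /G1; have [-> _ _] := bump_in r0 zr.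
  by rewrite expr1n mul1r ler_wpM2l// invr_ge0.
have L2 : 0 <= \int[(area \x lambda)%E]_(z in A `&` D) G2 z.
  rewrite -supp; last by move=> x s /(bump_box r0)[b _ _]; rewrite /G2/= b expr0n mul0r.
  exact: time_part_ge0.
have L3 : \int[(area \x lambda)%E]_(z in A `&` D) K <= 16 * t * (256 + 12 * M) * e.
  rewrite Rintegral_cst//; apply: (@le_trans _ _ (K * (16 * r ^+ 2 * t))).
    by rewrite ler_wpM2l// -lee_fin fineK// ge0_fin_numE.
  by rewrite /K le_eqVlt; apply/orP; left; apply/eqP; field; rewrite gt_eqF.
rewrite supp; last by move=> x s; exact: energy_density_out.
apply: (@le_trans _ _ (\int[(area \x lambda)%E]_(z in A `&` D) (G1 z + G2 z - K))).
  by rewrite (RintegralB mAD J12 IK) (RintegralD mAD J1 J2); lra.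
apply: le_Rintegral => //; first exact: (integrableB mAD J12 IK).
move=> z [Az _]; have [zr|zr] := leP (enorm z.1) r.
  rewrite /G1 /G2 /energy_density; have [-> -> ->] := bump_in r0 zr.
  have := sqr_ge0 (w1 z); have := sqr_ge0 (w2 z); rewrite expr1n !mul1r !mul0r.
  by move: (w z) (w1 z ^+ 2) (w2 z ^+ 2) (wt z) K0 => ? ? ? ? ? ? ?; lra.
rewrite /G1 /G2 /K /energy_density; apply: cutoff_error => //.
- exact: bump_itv.
- by rewrite invr_ge0 (ltW r0) invf_le1.
- by rewrite exprVn; exact: dbump_le.
- exact: hM.
rewrite ler_pdivlMr//; apply: le_trans (he z Az (ltW zr)).
by rewrite mulrC ler_wpM2r ?sqr_ge0// ltW.
Qed.

End energy.

(** * Vanishing of the vorticity *)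

Section vorticity_vanishes.
Context {R : realType}.
Variables (Omega : set (plane R)) (T t : R) (nu : plane R -> plane R)
  (sigma : {measure set (borel_plane R) -> \bar R})
  (v : spacetime R -> plane R) (p : spacetime R -> R).
Hypotheses (oO : open Omega) (smO : smooth_boundary Omega)
  (hnu : outward_unit_normal Omega nu) (hsigma : surface_measure Omega sigma).
Hypothesis hv : smooth_bounded_solution Omega T (fun=> 0) v p.
Hypothesis ht : 0 < t < T.

Notation area := (@plane_measure R).
Notation lambda := (@lebesgue_measure R).
Notation E1 := (e1 R).
Notation E2 := (e2 R).

Hypothesis hL1 : (product_measure1 sigma lambda).-integrable
  (frontier Omega `*` `]0, t[)
  (fun z : spacetime R => (vorticity_flux Omega nu v z)%:E).
Hypothesis hflux : (\int[lambda]_(s in `]0%R, t[)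
  \int[sigma]_(x in frontier Omega) (vorticity_flux Omega nu v (x, s))%:E <= 0)%E.

Let S := sigma_finite_copy (surface_measure_sigma_finite oO hnu hsigma smO).
Let flux := vorticity_flux Omega nu v.
Let B : set (borel_plane R * measurableTypeR R) := frontier Omega `*` `]0, t[.

Let mF : measurable (frontier Omega : set (borel_plane R)).
Proof. exact: measurable_frontier. Qed.
Let mi : measurable (`]0, t[%classic : set (measurableTypeR R)).
Proof. exact: measurable_itv. Qed.
Let mB : measurable B. Proof. exact: measurableX. Qed.

Let fluxI : (S \x lambda)%E.-integrable B (EFin \o flux).
Proof. exact: hL1. Qed.

Let cut_flux_measurable r : measurable_fun B (fun z => bump r z.1 ^+ 2 * flux z).
Proof.
have mf : measurable_fun B flux by apply/measurable_EFinP; exact: measurable_int fluxI.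
apply: measurable_funM => //.
apply: cont_on_measurable_spacetime => //.
have [c _ _ _] := bump_C1bar r (setT : set (plane R)).
have cb : cont_on B (fun z => bump r z.1).
  apply: (@cont_on_comp _ _ _ B (closure setT) fst (bump r)) => //.
    by move=> z _; exact: subset_closure.
  by apply: continuous_cont_on => z; exact: cvg_fst.
exact: cont_on_sqr.
Qed.

Let cut_flux_le r z : `|bump r z.1 ^+ 2 * flux z| <= `|flux z|.
Proof.
have /andP[b0 b1] := bump_itv r z.1.
by rewrite normrM ger0_norm ?sqr_ge0// ler_piMl// expr_le1.
Qed.

Let cut_fluxI r : (S \x lambda)%E.-integrable B (EFin \o (fun z => bump r z.1 ^+ 2 * flux z)).
Proof.
apply: (@le_integrable _ _ _ _ _ mB _ (EFin \o flux)) => //.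
  by apply/measurable_EFinP; exact: cut_flux_measurable.
by move=> z _; rewrite /= lee_fin; exact: cut_flux_le.
Qed.

Lemma energy_flux r : 0 < r ->
  \int[(area \x lambda)%E]_(z in Omega `*` `]0, t[) energy_density hv r z =
  \int[(S \x lambda)%E]_(z in B) (bump r z.1 ^+ 2 * flux z).
Proof.
move=> r0; have /andP[t0 tT] := ht.
have I s : (`]0, t[%classic : set R) s -> 0 < s < T.
  by rewrite /= in_itv/= => /andP[-> st]; exact: lt_trans st tT.
rewrite (@Rintegral_prod2 _ _ _ _ R area lambda)//; first last.
- by move=> s /I st; have [] := energy_slice oO smO hnu hsigma hv r0 st.
- apply: (@spacetime_integrable R Omega T t oO ht (energy_density hv r) (2 * r)).
    exact: energy_density_cont.
  move=> x s /(bump_box r0)[b b1 b2].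
  by rewrite /energy_density/= b b1 b2; move: (vort _ _ _) => ?; ring.
- exact: open_measurable_plane.
rewrite (@Rintegral_prod2 _ _ _ _ R S lambda)//.
  by apply: eq_Rintegral => s /set_mem/I st; have [] := energy_slice oO smO hnu hsigma hv r0 st.
by move=> s /I st; have [] := energy_slice oO smO hnu hsigma hv r0 st.
Qed.

(** The cut-offs tend to 1 boundedly, so that the sign of the flux survives in the limit. *)
Lemma cut_flux_eventually (c : R) : 0 < c -> exists N, forall n, (N <= n)%N ->
  \int[(S \x lambda)%E]_(z in B) (bump n.+1%:R z.1 ^+ 2 * flux z) <= c.
Proof.
move=> c0.
have cv : ((\int[(S \x lambda)%E]_(z in B) (bump n.+1%:R z.1 ^+ 2 * flux z)%:E)%E @[n --> \oo] -->
    (\int[(S \x lambda)%E]_(z in B) (flux z)%:E)%E).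
  apply: (@dominated_cvg _ _ _ _ B mB _ _ (fun z => `|flux z|%:E)) => //.
  - by move=> n; apply/measurable_EFinP; exact: cut_flux_measurable.
  - move=> z _; apply: cvg_near_cst; near=> n.
    have zn : enorm z.1 <= n.+1%:R.
      by apply: (@le_trans _ _ n%:R); [near: n; exact: nbhs_infty_ger|rewrite ler_nat].
    by have [-> _ _] := bump_in (ltr0Sn _ n) zn; rewrite expr1n mul1r.
  - exact: integrable_norm fluxI.
  by move=> n z _; rewrite lee_fin; exact: cut_flux_le.
have l0 : ((\int[(S \x lambda)%E]_(z in B) (flux z)%:E) < c%:E)%E.
  rewrite (@integral_prod2 _ _ _ _ R S lambda)//.
  exact: le_lt_trans hflux _.
have := cv _ (open_nbhs_nbhs (conj (@open_ereal_lt_ereal R c%:E) l0)).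
move=> [N _ HN]; exists N => n Nn; have := HN n Nn => /= H.
apply: ltW; rewrite -lte_fin /Rintegral fineK//.
exact: (integrable_fin_num mB (cut_fluxI _)).
Unshelve. all: by end_near. Qed.

Hypothesis heps : vorticity_tail Omega v t r @[r --> +oo] --> 0%E.

Let A : set (borel_plane R * measurableTypeR R) := Omega `*` `]0, t[.

Let oA : open (A : set (spacetime R)).
Proof.
rewrite openE => -[x s] [/= Ox Ts]; exists (Omega, `]0, t[%classic) => //; split=> /=.
  exact: open_nbhs_nbhs.
by apply: open_nbhs_nbhs; split=> //; exact: interval_open.
Qed.

Let AI z : A z -> (Omega `*` `]0, T[) z.
Proof.
case: z => x s [/= Ox]; rewrite /= in_itv/= => /andP[s0 st]; split=> //=.
by rewrite in_itv/= s0 (lt_trans st)//; case/andP: ht.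
Qed.

Lemma vorticity_tail_le e : 0 < e -> exists N, forall n, (N <= n)%N -> forall z, A z -> n.+1%:R <= enorm z.1 ->
  enorm z.1 * vort hv [::] z ^+ 2 <= e.
Proof.
move=> e0; have s0 : 0 < Num.sqrt e by rewrite sqrtr_gt0.
have l0 : (0%E < (Num.sqrt e)%:E)%E by rewrite lte_fin.
have [r [_ Hr]] := heps (open_nbhs_nbhs (conj (@open_ereal_lt_ereal R (Num.sqrt e)%:E) l0)).
have [N _ HN] : \forall n \near \oo, r < n%:R by exact: nbhs_infty_gtr.
exists N => n Nn z Az zn.
have rn : r < n.+1%:R by apply: lt_trans (HN n Nn) _; rewrite ltr_nat.
have /= sup := Hr _ rn.
have : ((Num.sqrt (enorm z.1) * `|omega v z|)%:E <= vorticity_tail Omega v t n.+1%:R)%E.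
  by apply: ereal_sup_ubound; exists z => //; move: z Az zn => [x s] [/= ? ?] ?; split.
move=> /le_lt_trans/(_ sup); rewrite lte_fin => h.
rewrite (vortE hv); last exact: AI.
have h0 : 0 <= Num.sqrt (enorm z.1) * `|omega v z| by rewrite mulr_ge0// sqrtr_ge0.
have : (Num.sqrt (enorm z.1) * `|omega v z|) ^+ 2 <= Num.sqrt e ^+ 2.
  by rewrite ler_sqr ?nnegrE ?sqrtr_ge0// ltW.
by rewrite exprMn !sqr_sqrtr ?enorm_ge0 ?(ltW e0)// real_normK ?num_real.
Qed.

Let ball_measure (x : plane R) (s d : R) : 0 < d ->
  let C := (`]x.1 - d, x.1 + d[%classic `*` `]x.2 - d, x.2 + d[%classic) `*`
    `]s - d, s + d[%classic in
  measurable (C : set (borel_plane R * measurableTypeR R)) /\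
  (area \x lambda)%E C = ((2 * d) ^+ 3)%:E.
Proof.
move=> d0 C.
have [mp mup] := plane_measure_square x d0.
have ml : measurable (`]s - d, s + d[%classic : set (measurableTypeR R)) by exact: measurable_itv.
split; first exact: measurableX.
have /= -> := @product_measure1E _ _ _ _ R area lambda _ _ mp ml.
by rewrite mup lebesgue_itv_centered// -EFinM; congr EFin; ring.
Qed.

(** A nonzero gradient contributes a fixed amount [c] to the energy on a small cube.  The
   cut-off errors take at most [c / 2] of it, but the flux is eventually below [c / 4]. *)
Lemma vorticity_gradient0 z : A z -> vort hv [:: E1] z = 0 /\ vort hv [:: E2] z = 0.
Proof.
move=> Az; set w1 := vort hv [:: E1]; set w2 := vort hv [:: E2].
apply: contrapT => nz; have /andP[t0 tT] := ht.
pose a := (w1 z ^+ 2 + w2 z ^+ 2) / 2.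
have a0 : 0 < a.
  rewrite divr_gt0// lt_neqAle addr_ge0 ?sqr_ge0// andbT; apply/eqP => /esym/eqP.
  by rewrite paddr_eq0 ?sqr_ge0// !sqrf_eq0 => /andP[/eqP h1 /eqP h2]; apply: nz.
have cg : {for z, continuous (fun y => w1 y ^+ 2 + w2 y ^+ 2)}.
  have c1 : {for z, continuous w1} by apply: cont_at (AI Az) => //; exact: vort_cont.
  have c2 : {for z, continuous w2} by apply: cont_at (AI Az) => //; exact: vort_cont.
  by apply: cvgD; rewrite expr2; apply: cvgM.
have : \forall y \near z, A y /\ a < w1 y ^+ 2 + w2 y ^+ 2.
  apply: filterI; first exact: open_nbhs_nbhs.
  by apply: (@cvgr_gt _ _ _ _ _ _ cg); rewrite /a ltr_pdivrMr// ltr_pMr ?ltr1n//; move: a0; rewrite /a; lra.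
move=> /(@nbhs_normP R (spacetime R))[d /= d0 Hd].
pose C : set (borel_plane R * measurableTypeR R) :=
  (`]z.1.1 - d, z.1.1 + d[%classic `*` `]z.1.2 - d, z.1.2 + d[%classic) `*` `]z.2 - d, z.2 + d[%classic.
have [mC muC] := @ball_measure z.1 z.2 d d0; rewrite -/C in mC muC.
have CE y : C y -> `|z - y| < d.
  case: y => -[y1 y2] s [[/= h1 h2]]; move: h1 h2; rewrite /= !in_itv/= => /andP[? ?] /andP[? ?] /andP[? ?].
  rewrite [`|_|]/(Num.max (Num.max `|z.1.1 - y1| `|z.1.2 - y2|) `|z.2 - s|).
  by rewrite !gt_max !ltr_norml; apply/andP; split; [apply/andP; split|]; apply/andP; split; lra.
have CA : C `<=` A by move=> y /CE/Hd[].
have [M hM] := sol_bounded hv.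
have M0 : 0 <= M by apply: le_trans (hM _ (AI Az)); exact: enorm_ge0.
pose c := 2^-1 * a * (2 * d) ^+ 3.
have c0 : 0 < c.
  by apply: mulr_gt0; [apply: mulr_gt0 => //; rewrite invr_gt0|apply: exprn_gt0; exact: mulr_gt0].
pose k := 16 * t * (256 + 12 * M).
have k0 : 0 < k.
  apply: mulr_gt0; first by apply: mulr_gt0 => //; exact: ltr0Sn.
  by apply: ltr_pwDl; [exact: ltr0Sn|apply: mulr_ge0 => //; exact: ler0n].
have e0 : 0 < c / 2 / k by rewrite !divr_gt0.
have [N1 HN1] := vorticity_tail_le e0.
have c4 : 0 < c / 4 by rewrite divr_gt0.
have [N2 HN2] := cut_flux_eventually c4.
have [N3 _ HN3] : \forall n \near \oo, 2 * (`|z.1| + d) <= n%:R by exact: nbhs_infty_ger.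
pose n := maxn N1 (maxn N2 N3).
have n1 : (N1 <= n)%N by exact: leq_maxl.
have n2 : (N2 <= n)%N by rewrite /n maxnCA leq_maxl.
have n3 : (N3 <= n)%N by rewrite /n maxnA leq_maxr.
have r1 : (1 : R) <= n.+1%:R by rewrite ler1n.
have := @energy_lower _ _ _ _ _ _ oO hv ht n.+1%:R (c / 2 / k) M C a r1 (ltW e0) M0 _ _ mC CA _ _.
rewrite muC energy_flux// => H.
have H4 : c - k * (c / 2 / k) <= c / 4.
  apply: le_trans (HN2 n n2); apply: H.
  - move=> y /AI Iy; rewrite /ext1 /ext2 ext_nil -sqr_enorm.
    by rewrite ler_sqr ?nnegrE ?enorm_ge0//; exact: hM.
  - by move=> y Ay yr; exact: HN1 n1 y Ay yr.
  - move=> y Cy; have yd := CE y Cy; have [_ ya] := Hd y yd; split; last exact: ltW.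
    apply: (le_trans (enorm_le_norm _)); apply: (@le_trans _ _ n%:R); last by rewrite ler_nat.
    apply: le_trans (HN3 n n3); rewrite ler_wpM2l//.
    have : `|z.1 - y.1| < d by apply: le_lt_trans yd; rewrite [leRHS]/(Num.max _ _) le_max lexx.
    by have := ler_normB z.1 (z.1 - y.1); rewrite subKr; lra.
  - by rewrite ltry.
have : k * (c / 2 / k) = c / 2 by rewrite mulrC divfK// gt_eqF.
lra.
Qed.

End vorticity_vanishes.

(** * A Liouville theorem for harmonic functions *)

Section log_cutoff.
Context {R : realType}.
Variable rho : R.
Hypothesis rho0 : 0 < rho.
Implicit Types (x : plane R) (n : nat).

Let radius n : R := rho * 2 ^+ n.
Let radius_gt0 n : 0 < radius n. Proof. by rewrite mulr_gt0// exprn_gt0. Qed.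
Let radiusS n : radius n.+1 = 2 * radius n. Proof. by rewrite /radius exprS mulrCA. Qed.
Let radius_ge n : rho <= radius n.
Proof. by rewrite ler_peMr ?(ltW rho0)// exprn_ege1// ler1n. Qed.

(** Up to normalisation a discrete logarithm of [2 ^ n * rho / |x|]: each dyadic annulus
   contributes the same amount to the Dirichlet integral, which therefore grows like [n]
   while the square of the value near the origin grows like [n ^ 2]. *)
Fixpoint dyadic n x : R := if n is m.+1 then dyadic m x + bump (radius m) x else 0.
Fixpoint ddyadic1 n x : R := if n is m.+1 then ddyadic1 m x + dbump1 (radius m) x else 0.
Fixpoint ddyadic2 n x : R := if n is m.+1 then ddyadic2 m x + dbump2 (radius m) x else 0.

Lemma dyadic_C1bar n Omega : C1bar Omega (dyadic n) (ddyadic1 n) (ddyadic2 n).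
Proof.
elim: n => [|n IH]; first exact: C1bar_cst.
exact: (C1barD IH (bump_C1bar (radius n) Omega)).
Qed.

Lemma dyadic_in n x : enorm x <= rho -> dyadic n x = n%:R.
Proof.
move=> xr; elim: n => [|n IH] //=.
have [-> _ _] := bump_in (radius_gt0 n) (le_trans xr (radius_ge n)).
by rewrite IH -natr1.
Qed.

Lemma dyadic_out n x : radius n <= enorm x -> [/\ dyadic n x = 0, ddyadic1 n x = 0 & ddyadic2 n x = 0].
Proof.
elim: n => [|n IH] //=; rewrite radiusS => xr.
have [|-> -> ->] := IH.
  by apply: le_trans xr; rewrite ler_peMl ?(ltW (radius_gt0 n))// ler1n.
by have [-> -> ->] := bump_out (radius_gt0 n) xr; rewrite !addr0.
Qed.

Lemma ddyadic_sqrS n x : ddyadic1 n.+1 x ^+ 2 + ddyadic2 n.+1 x ^+ 2 =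
  (ddyadic1 n x ^+ 2 + ddyadic2 n x ^+ 2) + (dbump1 (radius n) x ^+ 2 + dbump2 (radius n) x ^+ 2).
Proof.
have [xr|/ltW xr] := leP (enorm x) (radius n).
  by have /= [_ -> ->] := bump_in (radius_gt0 n) xr; rewrite !addr0 expr0n/= !addr0.
by have /= [_ -> ->] := dyadic_out xr; rewrite !add0r expr0n/= !add0r.
Qed.

Lemma dyadic_box n x : ~ box (radius n) x -> [/\ dyadic n x = 0, ddyadic1 n x = 0 & ddyadic2 n x = 0].
Proof.
move=> /negP; rewrite -ltNge => xr; apply: dyadic_out.
by apply: ltW; apply: lt_le_trans xr _; exact: norm_le_enorm.
Qed.

Variable Omega : set (plane R).
Hypothesis oO : open Omega.
Notation area := (@plane_measure R).

Lemma dyadic_supp : exists r : nat -> R, forall n x, ~ box (r n) x ->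
  [/\ dyadic n x = 0, ddyadic1 n x = 0 & ddyadic2 n x = 0].
Proof. by exists radius => n x; exact: dyadic_box. Qed.

Let mO : measurable (Omega : set (borel_plane R)).
Proof. exact: open_measurable_plane. Qed.

Lemma ddyadic_integrable n : area.-integrable Omega
  (EFin \o (fun x => ddyadic1 n x ^+ 2 + ddyadic2 n x ^+ 2)).
Proof.
have [_ c1 c2 _] := dyadic_C1bar n Omega.
apply: (@cont_on_integrable _ _ (closure Omega) _ (radius n)) => //.
- exact: closed_closure.
- exact: subset_closure.
- by apply: cont_onD; exact: cont_on_sqr.
move=> x _ xr; have [|_ -> ->] := @dyadic_box n x; last by rewrite expr0n addr0.
by apply/negP; rewrite -ltNge.
Qed.

Lemma dirichlet_bump_le r : 0 < r ->
  area.-integrable Omega (EFin \o (fun x => dbump1 r x ^+ 2 + dbump2 r x ^+ 2)) /\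
  \int[area]_(x in Omega) (dbump1 r x ^+ 2 + dbump2 r x ^+ 2) <= 2048.
Proof.
move=> r0; have [_ c1 c2 _] := bump_C1bar r Omega.
have out x : ~ box (2 * r) x -> dbump1 r x ^+ 2 + dbump2 r x ^+ 2 = 0.
  by move=> /(bump_box r0)[_ -> ->]; rewrite expr0n addr0.
have I : area.-integrable Omega (EFin \o (fun x => dbump1 r x ^+ 2 + dbump2 r x ^+ 2)).
  apply: (@cont_on_integrable _ _ (closure Omega) _ (2 * r)) => //.
  - exact: closed_closure.
  - exact: subset_closure.
  - by apply: cont_onD; exact: cont_on_sqr.
  by move=> x _ xr; apply: out; apply/negP; rewrite -ltNge.
split=> //; have mb : measurable (box (2 * r) : set (borel_plane R)) by exact: measurable_box.
have mX : measurable (Omega `&` box (2 * r) : set (borel_plane R)) by exact: measurableI.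
have r20 : 0 <= 2 * r by rewrite mulr_ge0// ltW.
have Xle : (area (Omega `&` box (2 * r)) <= (16 * r ^+ 2)%:E)%E.
  rewrite (_ : 16 * r ^+ 2 = (2 * (2 * r)) ^+ 2); last by ring.
  rewrite -plane_measure_box//; apply: le_measure; rewrite ?inE//; exact: subIsetr.
have Xfin : (area (Omega `&` box (2 * r)) < +oo)%E by exact: le_lt_trans Xle (ltry _).
rewrite (@Rintegral_support _ _ _ area Omega (box (2 * r))); last by move=> x _; exact: out.
apply: (@le_trans _ _ (\int[area]_(x in Omega `&` box (2 * r)) (128 / r ^+ 2))).
  apply: le_Rintegral => //.
  - by apply: integrableS I => //; exact: subIsetl.
  - by apply: (@integrable_bounded _ _ _ _ _ (fun=> 128 / r ^+ 2) `|128 / r ^+ 2|).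
  by move=> x _; exact: dbump_le.
rewrite Rintegral_cst//; apply: (@le_trans _ _ (128 / r ^+ 2 * (16 * r ^+ 2))).
  by rewrite ler_wpM2l ?divr_ge0 ?sqr_ge0// -lee_fin fineK// ge0_fin_numE.
by rewrite le_eqVlt; apply/orP; left; apply/eqP; field; rewrite gt_eqF.
Qed.

Lemma dirichlet_dyadic_le n :
  \int[area]_(x in Omega) (ddyadic1 n x ^+ 2 + ddyadic2 n x ^+ 2) <= 2048 * n%:R.
Proof.
elim: n => [|n IH].
  rewrite mulr0 (@eq_Rintegral _ _ _ area Omega (fun=> 0)); first by rewrite Rintegral_cst// mul0r.
  by move=> x _ /=; rewrite expr0n addr0.
have [I L] := dirichlet_bump_le (radius_gt0 n).
rewrite (@eq_Rintegral _ _ _ area Omega _ _ (fun x _ => ddyadic_sqrS n x)) RintegralD//.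
  by rewrite -[n.+1%:R]natr1 mulrDr mulr1; lra.
exact: ddyadic_integrable.
Qed.

End log_cutoff.

Section liouville.
Context {R : realType}.
Variables (Omega : set (plane R)) (nu : plane R -> plane R)
  (sigma : {measure set (borel_plane R) -> \bar R}).
Hypotheses (oO : open Omega) (smO : smooth_boundary Omega)
  (hnu : outward_unit_normal Omega nu) (hsigma : surface_measure Omega sigma).
Variables f f1 f2 f11 f12 f21 f22 : plane R -> R.
Hypotheses (C : C1bar Omega f f1 f2) (C1 : C1bar Omega f1 f11 f12) (C2 : C1bar Omega f2 f21 f22).
Hypothesis harm : forall x, Omega x -> f11 x + f22 x = 0.
Hypothesis f0 : forall x, frontier Omega x -> f x = 0.
Variable M : R.
Hypothesis fM : forall x, Omega x -> `|f x| <= M.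

Notation area := (@plane_measure R).

Let mO : measurable (Omega : set (borel_plane R)).
Proof. exact: open_measurable_plane. Qed.

(** Caccioppoli's inequality, up to the boundary: the field [S^2 f grad f] has no flux through
   it, since [f] vanishes there. *)
Lemma caccioppoli S S1 S2 r : C1bar Omega S S1 S2 ->
  (forall x, ~ box r x -> [/\ S x = 0, S1 x = 0 & S2 x = 0]) ->
  area.-integrable Omega (EFin \o (fun x => S1 x ^+ 2 + S2 x ^+ 2)) ->
  area.-integrable Omega (EFin \o (fun x => S x ^+ 2 * (f1 x ^+ 2 + f2 x ^+ 2))) /\
  \int[area]_(x in Omega) (S x ^+ 2 * (f1 x ^+ 2 + f2 x ^+ 2)) <=
    4 * M ^+ 2 * \int[area]_(x in Omega) (S1 x ^+ 2 + S2 x ^+ 2).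
Proof.
move=> CS S0 IS.
have [cS cS1 cS2 _] := CS; have [cf cf1 cf2 _] := C.
have I1 : area.-integrable Omega (EFin \o (fun x => S x ^+ 2 * (f1 x ^+ 2 + f2 x ^+ 2))).
  apply: (@cont_on_integrable _ _ (closure Omega) _ r) => //.
  - exact: closed_closure.
  - exact: subset_closure.
  - by apply: cont_onM; [exact: cont_on_sqr|apply: cont_onD; exact: cont_on_sqr].
  by move=> x _ xr; have [|-> _ _] := S0 x; [apply/negP; rewrite -ltNge|rewrite expr0n mul0r].
split=> //.
have CF u u1 u2 Cu := C1barM (C1barM CS CS) (@C1barM _ _ _ _ _ u u1 u2 C Cu).
have G := divergence_theorem oO hnu hsigma smO (CF _ _ _ C1) (CF _ _ _ C2) (r := r).
pose D x := S x ^+ 2 * (f1 x ^+ 2 + f2 x ^+ 2) + 2 * S x * f x * (S1 x * f1 x + S2 x * f2 x).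
have [|||ID _ E] := green_for_eq (D' := D) (G := fun=> 0) oO (G _).
- by move=> x /S0[-> _ _]; rewrite !mul0r.
- move=> x Ox; rewrite /D.
  have -> : f22 x = - f11 x by apply/eqP; rewrite eq_sym -subr_eq0 -opprD oppr_eq0 harm.
  by ring.
- by move=> x Fx; rewrite f0//; ring.
have {}E : \int[area]_(x in Omega) D x = 0.
  rewrite E Rintegral_cst ?mul0r//; exact: measurable_frontier.
have IM : area.-integrable Omega (EFin \o (fun x => 2 * M ^+ 2 * (S1 x ^+ 2 + S2 x ^+ 2))).
  exact: (integrableZl mO (2 * M ^+ 2) IS).
have Ihalf : area.-integrable Omega (EFin \o (fun x => 2^-1 * (S x ^+ 2 * (f1 x ^+ 2 + f2 x ^+ 2)))).
  exact: (integrableZl mO 2^-1 I1).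
have : \int[area]_(x in Omega) (2^-1 * (S x ^+ 2 * (f1 x ^+ 2 + f2 x ^+ 2))
    - 2 * M ^+ 2 * (S1 x ^+ 2 + S2 x ^+ 2)) <= \int[area]_(x in Omega) D x.
  apply: le_Rintegral => //; first exact: (integrableB mO Ihalf IM).
  move=> x Ox; rewrite /D.
  have young (y z : R) : - (2^-1 * y ^+ 2) - 2 * z ^+ 2 <= 2 * (y * z).
    by have := sqr_ge0 (y + 2 * z); rewrite (_ : (y + 2 * z) ^+ 2 = y ^+ 2 + 4 * (y * z) + 4 * z ^+ 2); [lra|ring].
  have y1 := young (S x * f1 x) (f x * S1 x); have y2 := young (S x * f2 x) (f x * S2 x).
  have fM2 : f x ^+ 2 <= M ^+ 2.
    rewrite -[f x ^+ 2]real_normK ?num_real// ler_sqr ?nnegrE//; first exact: fM.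
    by apply: le_trans (fM Ox).
  have p0 : 0 <= S1 x ^+ 2 + S2 x ^+ 2 by rewrite addr_ge0 ?sqr_ge0.
  have h := ler_wpM2r p0 fM2.
  have -> : 2 * S x * f x * (S1 x * f1 x + S2 x * f2 x) =
    2 * (S x * f1 x * (f x * S1 x)) + 2 * (S x * f2 x * (f x * S2 x)) by ring.
  have -> : S x ^+ 2 * (f1 x ^+ 2 + f2 x ^+ 2) = (S x * f1 x) ^+ 2 + (S x * f2 x) ^+ 2 by ring.
  have e : f x ^+ 2 * (S1 x ^+ 2 + S2 x ^+ 2) = (f x * S1 x) ^+ 2 + (f x * S2 x) ^+ 2 by ring.
  rewrite e in h; rewrite -[2 * M ^+ 2 * _]mulrA; lra.
rewrite E (RintegralB mO Ihalf IM) (RintegralZl _ mO I1) (RintegralZl _ mO IS).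
by lra.
Qed.

(** The logarithmic cut-off equals [n] on a given square, so that [n ^+ 2] times the Dirichlet
   integral over the square is at most a multiple of [n], for every [n]. *)
Theorem liouville x : Omega x -> f1 x = 0 /\ f2 x = 0.
Proof.
move=> Ox; apply: contrapT => nz.
pose a := (f1 x ^+ 2 + f2 x ^+ 2) / 2.
have a0 : 0 < a.
  rewrite divr_gt0// lt_neqAle addr_ge0 ?sqr_ge0// andbT; apply/eqP => /esym/eqP.
  by rewrite paddr_eq0 ?sqr_ge0// !sqrf_eq0 => /andP[/eqP h1 /eqP h2]; apply: nz.
have [c1 c2] := C1bar_continuous oO C Ox.
have cg : {for x, continuous (fun y => f1 y ^+ 2 + f2 y ^+ 2)}.
  by apply: cvgD; rewrite expr2; apply: cvgM.
have : \forall y \near x, Omega y /\ a < f1 y ^+ 2 + f2 y ^+ 2.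
  apply: filterI; first exact: open_nbhs_nbhs.
  by apply: (@cvgr_gt _ _ _ _ _ _ cg); rewrite /a ltr_pdivrMr// ltr_pMr ?ltr1n//; move: a0; rewrite /a; lra.
move=> /(@nbhs_normP R (plane R))[d /= d0 Hd].
pose B : set (borel_plane R) := `]x.1 - d, x.1 + d[%classic `*` `]x.2 - d, x.2 + d[%classic.
have [mB muB] := plane_measure_square x d0; rewrite -/B in mB muB.
have BE y : B y -> `|x - y| < d.
  case: y => y1 y2 []; rewrite /= !in_itv/= => /andP[? ?] /andP[? ?].
  by rewrite plane_normE/= gt_max !ltr_norml; apply/andP; split; apply/andP; split; lra.
have BO : B `<=` Omega by move=> y /BE/Hd[].
pose rho := 2 * (`|x| + d).
have rho0 : 0 < rho by rewrite mulr_gt0// ltr_wpDl.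
pose m := fine (area B).
have m0 : 0 < m by rewrite /m muB/= exprn_gt0// mulr_gt0.
have key n : n%:R ^+ 2 * a * m <= 4 * M ^+ 2 * (2048 * n%:R).
  have [r Hr] := @dyadic_supp R rho rho0.
  have [I L] := caccioppoli (dyadic_C1bar rho n Omega) (@Hr n) (ddyadic_integrable rho0 oO n).
  apply: (@le_trans _ _ (4 * M ^+ 2 * \int[area]_(y in Omega) (ddyadic1 rho n y ^+ 2 + ddyadic2 rho n y ^+ 2))); last first.
    by apply: ler_wpM2l; [apply: mulr_ge0 => //; exact: sqr_ge0|exact: (dirichlet_dyadic_le rho0 oO)].
  apply: le_trans L; apply: Rintegral_ge_const => //.
  - by rewrite [X in (X < _)%E](_ : _ = ((2 * d) ^+ 2)%:E); [exact: ltry|exact: muB].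
  - by move=> y _; rewrite mulr_ge0 ?sqr_ge0// addr_ge0 ?sqr_ge0.
  move=> y By; have yd := BE y By; have [_ ya] := Hd y yd.
  rewrite dyadic_in//; first by rewrite ler_wpM2l ?sqr_ge0// ltW.
  apply: (le_trans (enorm_le_norm _)); rewrite ler_wpM2l//.
  by have := ler_normB x (x - y); rewrite subKr; lra.
have am : 0 < a * m by exact: mulr_gt0.
pose K := 4 * M ^+ 2 * 2048.
have K0 : 0 <= K.
  apply: mulr_ge0; last exact: ler0n.
  by apply: mulr_ge0; [exact: ler0n|exact: sqr_ge0].
have [N _ HN] : \forall n \near \oo, K / (a * m) < n%:R by exact: nbhs_infty_gtr.
have := HN N (leqnn N); have := key N; rewrite mulrA -/K; move: {HN} K K0 => K K0 L.
rewrite /= ltr_pdivrMr// => H.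
have N0 : 0 < N%:R :> R by have := le_lt_trans K0 H; rewrite pmulr_lgt0.
move: L; rewrite leNgt => /negP; apply.
rewrite (_ : N%:R ^+ 2 * a * m = N%:R * (a * m) * N%:R); last by ring.
by rewrite ltr_pM2r.
Qed.

End liouville.

(** * Domains of the plane and functions of sublinear growth *)

Section plane_domains.
Context {R : realType}.
Implicit Types (Omega : set (plane R)).

(** The indicator function has derivative 0 everywhere, and is thus constant on segments. *)
Lemma plane_clopen (B : set (plane R)) : B !=set0 -> open B -> closed B -> B = setT.
Proof.
move=> [x Bx] oB cB; apply/seteqP; split=> // y _.
have D z : is_derive z (y - x) (\1_B : plane R -> R) 0.
  have [Bz|nBz] := pselect (B z).
    apply: (@is_derive_open R (plane R) R B (fun=> 1) _ z _ 0 oB) => //.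
    by move=> u Bu; rewrite indicE mem_set.
  have oC : open (~` B) by rewrite openC.
  apply: (@is_derive_open R (plane R) R (~` B) (fun=> 0) _ z _ 0 oC) => //.
  by move=> u nBu; rewrite indicE memNset.
have := @constant_on_segment R _ (\1_B : plane R -> R) x (y - x) 1 (fun c _ => D _).
rewrite scale1r subrKC !indicE (mem_set Bx) => /eqP; apply: contraPP => nBy.
by rewrite memNset// eq_sym oner_eq0.
Qed.

Lemma plane_connected : connected (setT : set (plane R)).
Proof.
move=> B B0 [C oC EC] [D cD ED]; apply: plane_clopen => //.
  by rewrite EC setTI.
by rewrite ED setTI.
Qed.

Lemma no_frontier Omega : Omega !=set0 -> open Omega -> frontier Omega = set0 -> Omega = setT.
Proof.
move=> O0 oO F0; apply: plane_clopen => // x cx.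
apply: contrapT => nx; have : frontier Omega x by split => //; move=> /interior_subset.
by rewrite F0.
Qed.

Lemma enorm_axis1 (h : R) : 0 <= h -> enorm ((h, 0) : plane R) = h.
Proof. by move=> h0; rewrite /enorm/= expr0n addr0 sqrtr_sqr ger0_norm. Qed.

Lemma enorm_axis2 (h : R) : 0 <= h -> enorm ((0, h) : plane R) = h.
Proof. by move=> h0; rewrite /enorm/= expr0n add0r sqrtr_sqr ger0_norm. Qed.

(** Along a line in the direction [w] the function is affine with slope [a]. *)
Lemma sublinear_slope (p : plane R -> R) (w : plane R) (a : R) : enorm w = 1 ->
  (forall x, is_derive x w p a) ->
  (forall e, 0 < e -> exists r : R, forall x : plane R, r <= enorm x -> `|p x| <= e * enorm x) ->
  a = 0.
Proof.
move=> w1 D sub; apply/eqP; apply: contraT => a0.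
have na : 0 < `|a| by rewrite normr_gt0.
have e0 : 0 < `|a| / 4 by rewrite divr_gt0.
have [r Hr] := sub _ e0.
pose h := `|r| + (4 * `|p 0| / `|a| + 1).
have q0 : 0 <= 4 * `|p 0| / `|a| by rewrite divr_ge0// mulr_ge0.
have h0 : 0 < h by rewrite /h; have := normr_ge0 r; lra.
have hr : r <= enorm (h *: w).
  by rewrite enormZ ?w1 ?mulr1 ?(ltW h0)// /h; have := ler_norm r; lra.
have := Hr _ hr; rewrite enormZ ?w1 ?mulr1 ?(ltW h0)// => ph.
have [c _] := @mvt_line R _ p (fun=> a) 0 w 0 h (ltW h0) (fun c _ => D _).
rewrite scale0r !add0r subr0 => E.
have : `|a| * h <= `|p (h *: w)| + `|p 0|.
  by rewrite -[h in X in X <= _](gtr0_norm h0) -normrM -E; exact: ler_normB.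
have : `|p 0| < `|a| / 4 * h.
  have : 4 * `|p 0| / `|a| < h by rewrite /h; have := normr_ge0 r; lra.
  by rewrite ltr_pdivrMr//; lra.
have : 0 < `|a| * h by exact: mulr_gt0.
rewrite -mulrA (mulrC 4^-1) mulrA in ph *.
by lra.
Qed.

End plane_domains.

(** * The flow is at rest *)

Section flow_at_rest.
Context {R : realType}.
Variables (Omega : set (plane R)) (T t : R) (nu : plane R -> plane R)
  (sigma : {measure set (borel_plane R) -> \bar R})
  (v : spacetime R -> plane R) (p : spacetime R -> R).
Hypotheses (oO : open Omega) (cO : connected Omega) (O0 : Omega !=set0) (smO : smooth_boundary Omega)
  (hnu : outward_unit_normal Omega nu) (hsigma : surface_measure Omega sigma).
Hypothesis hv : smooth_bounded_solution Omega T (fun=> 0) v p.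
Hypothesis hp : admissible_pressure Omega T p.
Hypothesis ht : 0 < t < T.
Hypothesis heps : vorticity_tail Omega v t r @[r --> +oo] --> 0%E.

Notation lambda := (@lebesgue_measure R).
Notation E1 := (e1 R).
Notation E2 := (e2 R).
Notation Et := (et R).

Hypothesis hL1 : (product_measure1 sigma lambda).-integrable
  (frontier Omega `*` `]0, t[)
  (fun z : spacetime R => (vorticity_flux Omega nu v z)%:E).
Hypothesis hflux : (\int[lambda]_(s in `]0%R, t[)
  \int[sigma]_(x in frontier Omega) (vorticity_flux Omega nu v (x, s))%:E <= 0)%E.

Let A : set (spacetime R) := Omega `*` `]0, t[.
Let I : set (spacetime R) := Omega `*` `]0, T[.

Let oA : open A.
Proof.
rewrite openE => -[x s] [/= Ox Ts]; exists (Omega, `]0, t[%classic) => //; split=> /=.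
  exact: open_nbhs_nbhs.
by apply: open_nbhs_nbhs; split=> //; exact: interval_open.
Qed.

Let AI z : A z -> I z.
Proof.
case: z => x s [/= Ox]; rewrite /= in_itv/= => /andP[s0 st]; split=> //=.
by rewrite in_itv/= s0 (lt_trans st)//; case/andP: ht.
Qed.

Let AT x s : A (x, s) -> 0 < s < T.
Proof. by move=> /AI[/= _]; rewrite in_itv. Qed.

Let As x y s : A (x, s) -> Omega y -> A (y, s).
Proof. by move=> [/= _ ts] Oy; split. Qed.

Let grad0 z : A z -> vort hv [:: E1] z = 0 /\ vort hv [:: E2] z = 0.
Proof. exact: (vorticity_gradient0 oO smO hnu hsigma hv ht hL1 hflux heps). Qed.

Let slope (f f1 f2 : spacetime R -> R) s :
  (forall z, I z -> is_derive z E1 f (f1 z)) -> (forall z, I z -> is_derive z E2 f (f2 z)) ->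
  (forall z, A z -> f1 z = 0 /\ f2 z = 0) -> (`]0, t[%classic : set R) s ->
  forall x y, Omega x -> Omega y -> f (y, s) = f (x, s).
Proof.
move=> D1 D2 f0 ts; apply: (connected_constant (f := fun x => f (x, s))) => // x Ox.
have Az : A (x, s) by split.
have [z1 z2] := f0 _ Az; split; apply: is_derive_space_slice.
  by have := D1 _ (AI Az); rewrite z1.
by have := D2 _ (AI Az); rewrite z2.
Qed.

Let comp_zero (f f1 f2 f11 f12 f21 f22 : spacetime R -> R) M z : A z ->
  (forall s, 0 < s < T -> [/\ C1bar Omega (fun x => f (x, s)) (fun x => f1 (x, s)) (fun x => f2 (x, s)),
    C1bar Omega (fun x => f1 (x, s)) (fun x => f11 (x, s)) (fun x => f12 (x, s)) &
    C1bar Omega (fun x => f2 (x, s)) (fun x => f21 (x, s)) (fun x => f22 (x, s))]) ->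
  (forall z, A z -> f11 z + f22 z = 0) ->
  (forall x s, frontier Omega x -> 0 < s < T -> f (x, s) = 0) ->
  (forall z, I z -> `|f z| <= M) -> f1 z = 0 /\ f2 z = 0.
Proof.
case: z => x s Az H harm f0 fM; have sT := AT Az; have [C C1 C2] := H s sT.
apply: (liouville oO smO hnu hsigma C C1 C2 _ _ (M := M)).
- by move=> y Oy; apply: harm; exact: (As Az Oy).
- by move=> y Fy; exact: f0.
- by move=> y Oy; apply: fM; apply: AI; exact: (As Az Oy).
- by case: Az.
Qed.

Let ext_slices1 l s : 0 < s < T -> C1bar Omega (fun x => ext1 hv l (x, s))
  (fun x => ext1 hv (E1 :: l) (x, s)) (fun x => ext1 hv (E2 :: l) (x, s)).
Proof.
move=> sT; apply: (space_slice_C1bar (f := ext1 hv l) sT); try exact: ext1_cont.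
by move=> z Iz; split; exact: ext1_is_derive.
Qed.

Let ext_slices2 l s : 0 < s < T -> C1bar Omega (fun x => ext2 hv l (x, s))
  (fun x => ext2 hv (E1 :: l) (x, s)) (fun x => ext2 hv (E2 :: l) (x, s)).
Proof.
move=> sT; apply: (space_slice_C1bar (f := ext2 hv l) sT); try exact: ext2_cont.
by move=> z Iz; split; exact: ext2_is_derive.
Qed.

(** The Laplacian of a solenoidal field is the rotated gradient of its vorticity. *)
Lemma velocity_harmonic z : A z ->
  ext1 hv [:: E1; E1] z + ext1 hv [:: E2; E2] z = 0 /\
  ext2 hv [:: E1; E1] z + ext2 hv [:: E2; E2] z = 0.
Proof.
move=> Az; have Iz := AI Az; have [g1 g2] := grad0 Az.
have d1 := ext_div_derive oO hv E1 Iz; have d2 := ext_div_derive oO hv E2 Iz.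
have s1 : ext1 hv [:: E1; E2] z = ext1 hv [:: E2; E1] z by exact: ext1_swap.
have s2 : ext2 hv [:: E1; E2] z = ext2 hv [:: E2; E1] z by exact: ext2_swap.
move: g1 g2; rewrite /vort/= => /eqP; rewrite subr_eq0 => /eqP g1 /eqP; rewrite subr_eq0 => /eqP g2.
split; first by rewrite -[RHS]d1 s2 g2.
by rewrite g1 s1 -[RHS]d2.
Qed.

Lemma velocity_bounded : exists M, forall z, I z -> `|ext1 hv [::] z| <= M /\ `|ext2 hv [::] z| <= M.
Proof.
have [M HM] := sol_bounded hv; exists M => z /HM vM.
have := le_trans (norm_le_enorm _) vM; rewrite plane_normE ge_max => /andP[? ?].
by rewrite /ext1 /ext2 ext_nil.
Qed.

Lemma velocity_gradient0 z : A z -> [/\ ext1 hv [:: E1] z = 0, ext1 hv [:: E2] z = 0,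
  ext2 hv [:: E1] z = 0 & ext2 hv [:: E2] z = 0].
Proof.
move=> Az; have [M HM] := velocity_bounded.
have ns x s : frontier Omega x -> 0 < s < T -> ext1 hv [::] (x, s) = 0 /\ ext2 hv [::] (x, s) = 0.
  by move=> Fx sT; rewrite /ext1 /ext2 ext_nil (sol_no_slip hv Fx sT).
have [h1 h2] : ext1 hv [:: E1] z = 0 /\ ext1 hv [:: E2] z = 0.
  apply: (@comp_zero _ _ _ _ _ _ _ M z Az (fun s sT => And3 (ext_slices1 [::] sT)
    (ext_slices1 [:: E1] sT) (ext_slices1 [:: E2] sT))).
  - by move=> y /velocity_harmonic[].
  - by move=> x s Fx sT; have [] := ns x s Fx sT.
  - by move=> y /HM[].
have [h3 h4] : ext2 hv [:: E1] z = 0 /\ ext2 hv [:: E2] z = 0.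
  apply: (@comp_zero _ _ _ _ _ _ _ M z Az (fun s sT => And3 (ext_slices2 [::] sT)
    (ext_slices2 [:: E1] sT) (ext_slices2 [:: E2] sT))).
  - by move=> y /velocity_harmonic[].
  - by move=> x s Fx sT; have [] := ns x s Fx sT.
  - by move=> y /HM[].
by [].
Qed.

Let ext1_const s x y : (`]0, t[%classic : set R) s -> Omega x -> Omega y ->
  ext1 hv [::] (y, s) = ext1 hv [::] (x, s).
Proof.
move=> ts; apply: (slope (f := ext1 hv [::]) (f1 := ext1 hv [:: E1]) (f2 := ext1 hv [:: E2])) => //.
- by move=> ? ?; exact: ext1_is_derive.
- by move=> ? ?; exact: ext1_is_derive.
by move=> z /velocity_gradient0[].
Qed.

Let ext2_const s x y : (`]0, t[%classic : set R) s -> Omega x -> Omega y ->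
  ext2 hv [::] (y, s) = ext2 hv [::] (x, s).
Proof.
move=> ts; apply: (slope (f := ext2 hv [::]) (f1 := ext2 hv [:: E1]) (f2 := ext2 hv [:: E2])) => //.
- by move=> ? ?; exact: ext2_is_derive.
- by move=> ? ?; exact: ext2_is_derive.
by move=> z /velocity_gradient0[].
Qed.

Let boundary_value (f f1 f2 : plane R -> R) x0 x : C1bar Omega f f1 f2 -> frontier Omega x0 ->
  f x0 = 0 -> (forall y, Omega y -> f y = f x) -> f x = 0.
Proof.
move=> [cf _ _ _] F0 f0 fc; have [c0 _] := frontier_open oO F0.
apply/eqP; apply: contraT => nz; have e0 : 0 < `|f x| by rewrite normr_gt0.
have := @cvgr_dist_lt _ _ _ _ _ _ _ (cf _ c0) _ e0 => H.
have {}H : \forall y \near x0, closure Omega y -> `|f x0 - f y| < `|f x| by exact: H.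
have [y [Oy Hy]] := c0 _ H.
have := Hy (subset_closure Oy); by rewrite f0 sub0r normrN fc// ltxx.
Qed.

(** With a boundary, the value there is 0.  On the whole plane the momentum equation makes
   the pressure gradient constant in space, hence 0 by the growth condition. *)
Lemma time_derivative0 z : A z -> ext1 hv [:: Et] z = 0 /\ ext2 hv [:: Et] z = 0.
Proof.
case: z => x s Az; have Ox : Omega x by case: Az.
have ts : (`]0, t[%classic : set R) s by case: Az.
have [[x0 Fx0]|F0] := pselect (frontier Omega !=set0).
  have rest y : A y -> ext1 hv [::] y = 0 /\ ext2 hv [::] y = 0.
    case: y => y r Ay; have rT := AT Ay; have Oy : Omega y by case: Ay.
    have tr : (`]0, t[%classic : set R) r by case: Ay.
    have v0 := sol_no_slip hv Fx0 rT; split.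
      apply: (boundary_value (ext_slices1 [::] rT) Fx0 (x := y)).
        by rewrite /ext1 ext_nil v0.
      by move=> u Ou; exact: ext1_const.
    apply: (boundary_value (ext_slices2 [::] rT) Fx0 (x := y)).
      by rewrite /ext2 ext_nil v0.
    by move=> u Ou; exact: ext2_const.
  split.
    apply: (is_derive_zero_open oA _ Az (ext1_is_derive oO hv [::] Et (AI Az))).
    by move=> y /rest[].
  apply: (is_derive_zero_open oA _ Az (ext2_is_derive oO hv [::] Et (AI Az))).
  by move=> y /rest[].
have FE : frontier Omega = set0.
  by apply/seteqP; split=> // y Fy; exfalso; apply: F0; exists y.
have OT := no_frontier O0 oO FE.
have Ay y : A (y, s) by split=> //=; rewrite OT.
have growth := hp OT (AT Az).
have g1 y : A y -> ext1 hv [:: E1; Et] y = 0 /\ ext1 hv [:: E2; Et] y = 0.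
  move=> Ay'; rewrite !(@ext1_swap _ _ _ _ _ oO hv _ _ _ Et (AI Ay')); split.
    apply: (is_derive_zero_open oA _ Ay' (ext1_is_derive oO hv [:: E1] Et (AI Ay'))).
    by move=> u /velocity_gradient0[].
  apply: (is_derive_zero_open oA _ Ay' (ext1_is_derive oO hv [:: E2] Et (AI Ay'))).
  by move=> u /velocity_gradient0[].
have g2 y : A y -> ext2 hv [:: E1; Et] y = 0 /\ ext2 hv [:: E2; Et] y = 0.
  move=> Ay'; rewrite !(@ext2_swap _ _ _ _ _ oO hv _ _ _ Et (AI Ay')); split.
    apply: (is_derive_zero_open oA _ Ay' (ext2_is_derive oO hv [:: E1] Et (AI Ay'))).
    by move=> u /velocity_gradient0[].
  apply: (is_derive_zero_open oA _ Ay' (ext2_is_derive oO hv [:: E2] Et (AI Ay'))).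
  by move=> u /velocity_gradient0[].
have c1 y : ext1 hv [:: Et] (y, s) = ext1 hv [:: Et] (x, s).
  apply: (slope (f := ext1 hv [:: Et]) _ _ g1) => //; last by rewrite OT.
  - by move=> ? ?; exact: ext1_is_derive.
  - by move=> ? ?; exact: ext1_is_derive.
have c2 y : ext2 hv [:: Et] (y, s) = ext2 hv [:: Et] (x, s).
  apply: (slope (f := ext2 hv [:: Et]) _ _ g2) => //; last by rewrite OT.
  - by move=> ? ?; exact: ext2_is_derive.
  - by move=> ? ?; exact: ext2_is_derive.
have D y : is_derive y (ux R) (fun y => p (y, s)) (- ext1 hv [:: Et] (x, s)) /\
    is_derive y (uy R) (fun y => p (y, s)) (- ext2 hv [:: Et] (x, s)).
  have [h1 h2] := velocity_harmonic (Ay y).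
  have [k1 k2 k3 k4] := velocity_gradient0 (Ay y).
  have [D1 D2] := pressure_gradient hv (AI (Ay y)).
  move: D1 D2; rewrite h1 h2 k1 k2 k3 k4 c1 c2 !mulr0 !addr0 !subr0 => D1 D2.
  by split; exact: is_derive_space_slice.
split; apply: oppr_inj; rewrite oppr0.
  apply: (@sublinear_slope _ (fun y => p (y, s)) (ux R)) => //; first exact: enorm_axis1.
  by move=> y; have [] := D y.
apply: (@sublinear_slope _ (fun y => p (y, s)) (uy R)) => //; first exact: enorm_axis2.
by move=> y; have [] := D y.
Qed.

Let at_rest (f ft : spacetime R -> R) x s : Omega x -> 0 <= s <= t ->
  cont_on (closure Omega `*` `[0, T[) f -> f (x, 0) = 0 ->
  (forall z, I z -> is_derive z Et f (ft z)) -> (forall z, A z -> ft z = 0) -> f (x, s) = 0.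
Proof.
move=> Ox /andP[s0 st] cf f0 D ft0.
have Ar r : 0 < r < s -> A (x, r).
  by move=> /andP[r0 rs]; split=> //=; rewrite in_itv/= r0 (lt_le_trans rs).
have [||c _] := @MVT_segment R (fun s => f (x, s)) (fun=> 0) 0 s s0.
- move=> r; rewrite in_itv/= => rs; apply: is_derive_time_slice.
  by have := D _ (AI (Ar r rs)); rewrite ft0//; exact: Ar.
- apply/cont_onP; apply: cont_onS (time_slice_cont ht (subset_closure Ox) cf).
  by move=> r; rewrite /= !in_itv/= => /andP[-> rs]; exact: le_trans rs st.
by rewrite mul0r f0 subr0.
Qed.

Theorem velocity0 x s : Omega x -> 0 <= s <= t -> v (x, s) = 0.
Proof.
move=> Ox st; have i0 := sol_initial hv Ox.
have h1 : ext1 hv [::] (x, s) = 0.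
  apply: (at_rest (ft := ext1 hv [:: Et]) Ox st).
  - exact: ext1_cont.
  - by rewrite /ext1 ext_nil i0.
  - by move=> z Iz; exact: ext1_is_derive.
  - by move=> z /time_derivative0[].
have h2 : ext2 hv [::] (x, s) = 0.
  apply: (at_rest (ft := ext2 hv [:: Et]) Ox st).
  - exact: ext2_cont.
  - by rewrite /ext2 ext_nil i0.
  - by move=> z Iz; exact: ext2_is_derive.
  - by move=> z /time_derivative0[].
by move: h1 h2; rewrite /ext1 /ext2 ext_nil; case: (v _) => a b /= -> ->.
Qed.

End flow_at_rest.

Unset Implicit Arguments.

Theorem corollary1p7 (R : realType) (Omega : set (plane R)) (T t : R)
  (nu : plane R -> plane R)
  (sigma : {measure set (borel_plane R) -> \bar R})
  (v : spacetime R -> plane R) (p : spacetime R -> R)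
  (hOmega : Omega = setT
            \/ (exterior_domain Omega /\ smooth_boundary Omega)
            \/ (perturbed_half_space Omega /\ smooth_boundary Omega))
  (hnu : outward_unit_normal Omega nu)
  (hsigma : surface_measure Omega sigma)
  (hT : 0 < T)
  (hv : smooth_bounded_solution Omega T (fun=> 0) v p)
  (hp : admissible_pressure Omega T p)
  (ht : 0 < t < T)
  (heps : vorticity_tail Omega v t r @[r --> +oo] --> 0%E)
  (hL1 : (product_measure1 sigma (@lebesgue_measure R)).-integrable
           (frontier Omega `*` `]0, t[)
           (fun z : spacetime R => (vorticity_flux Omega nu v z)%:E))
  (hflux : (\int[@lebesgue_measure R]_(s in `]0%R, t[)
             \int[sigma]_(x in frontier Omega)
               (vorticity_flux Omega nu v (x, s))%:E <= 0)%E) :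
  forall (x : plane R) (s : R), Omega x -> 0 <= s <= t -> v (x, s) = 0.
Proof.
have [nO oO cO smO] : [/\ Omega !=set0, open Omega, connected Omega & smooth_boundary Omega].
  case: hOmega => [->|[[[[? ? ?] _] ?]|[[[? ? ?] _] ?]]] //.
  split; [by exists 0|exact: openT|exact: plane_connected|].
  by move=> x [_]; rewrite interiorT => /(_ Logic.I).
by move=> x s; exact: (velocity0 oO cO nO smO hnu hsigma hv hp ht heps hL1 hflux).
Qed.
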